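(* For any $\lambda>0$, the functional $\Phi_\lambda(\mathcal C)=\mathsf A(\mathcal C)^\lambda\,\mathsf L(\mathcal C)^3$, defined on the set of compact convex subsets of the triangle $ABC$ containing $A$ and $B$, attains its maximum, and its unique maximizer is the convex hull of the curve $\mathcal H_\lambda$.
   Context: $ABC$ is the (filled) triangle of area 1 with vertices $A=(0,0)$, $B=(2,0)$, $C=(1,1)$. For a compact convex set $\mathcal C\subset\mathbb R^2$, $\mathsf A(\mathcal C)$ is its area and $\mathsf L(\mathcal C)=\int_{\partial\mathcal C}\kappa(s)^{1/3}\,ds$ its affine perimeter, where $\kappa(s)\ge0$ is the curvature of $\partial\mathcal C$, which exists at almost every boundary point, and $s$ is Euclidean arc length (segments contribute $0$). The map $\Psi(r)=\frac{\sinh(2r)}{2r}-1$ (with $\Psi(0)=0$) is a continuous increasing bijection of $[0,+\infty)$ onto itself; $r_\lambda:=\Psi^{-1}(\lambda)$. For $\lambda>0$, $\mathcal H_\lambda=\{(X(t),Y(t)):t\in[0,1]\}$ with $$X(t)=1+\frac{\sinh(r_\lambda(1-2t))}{\sinh(r_\lambda)},\qquad Y(t)=\frac{2\cosh(r_\lambda)}{\sinh(r_\lambda)^2}\sinh(r_\lambda(1-t))\sinh(r_\lambda t);$$ it is an arc of hyperbola joining $B$ to $A$ inside $ABC$. *)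

(* Defs.v *)
From HB Require Import structures.
From mathcomp Require Import all_boot all_order all_algebra.
From mathcomp Require Import all_classical all_reals all_analysis.
Set Implicit Arguments.
Unset Strict Implicit.
Unset Printing Implicit Defensive.
Import Order.TTheory GRing.Theory Num.Theory.
Import numFieldNormedType.Exports.
Local Open Scope classical_set_scope.
Local Open Scope ring_scope.

Section ConvexSets.
Context {R : realType}.

(* The library norm of [R * R] is the max norm, hence this one. *)
Definition enorm (p : R * R) : R := Num.sqrt (p.1 ^+ 2 + p.2 ^+ 2).

Definition boundary (C : set (R * R)) : set (R * R) :=
  closure C `\` interior C.

Definition convex_hull (S : set (R * R)) : set (R * R) :=
  smallest (@convex_set R (R * R)%type) S.

Definition area (C : set (R * R)) : R :=
  fine ((lebesgue_measure \x lebesgue_measure)%E C).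

End ConvexSets.

Section AffinePerimeter.
Context {R : realType}.
Implicit Types (g : R -> R * R) (C : set (R * R)).

(* Length of the polygonal line inscribed in [g] along the subdivision
   [a :: p] of [a, b], as in [variation] for real-valued functions. *)
Definition polygonal_length (a b : R) g (p : seq R) : R :=
  let G := g \o nth b (a :: p) in
  \sum_(0 <= n < size p) enorm (G n.+1 - G n).

Definition curve_length (a b : R) g : \bar R :=
  ereal_sup [set (polygonal_length a b g p)%:E | p in itv_partition a b].

(* [g], restricted to [0, l], runs once around the closed curve [boundary C]
   at unit speed. *)
Definition arclength_param C (l : R) g : Prop :=
  [/\ 0 < l,
      g 0 = g l,
      {in `[0, l[ &, injective g},
      g @` `[0, l] = boundary C &
      forall s t, 0 <= s -> s <= t -> t <= l ->
        curve_length s t g = (t - s)%:E].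

(* [g (s + h) = g s + h *: T + (h ^+ 2 / 2) *: N + o(h ^+ 2)]. *)
Definition second_order_expansion g (s : R) (T N : R * R) : Prop :=
  h^-1 ^+ 2 *: (g (s + h) - g s - h *: T - (h ^+ 2 / 2) *: N)
    @[h --> 0^'] --> (0 : R * R).

(* Curvature [|g''(s)|] at the arc length parameter [s], the second derivative
   being taken in the sense of second-order expansions: this is the sense in
   which the boundary of a convex set has a curvature at almost every point,
   whereas [derive1 g] may fail to exist on a dense set of corners. At the
   remaining parameters (a null set) the value is 0. *)
Definition curvature g (s : R) : R :=
  enorm (xget 0 [set N | exists T, second_order_expansion g s T N]).

(* The value of the integral does not depend on the arc length
   parametrization, so the supremum merely selects it. When [C] has empty
   interior (a segment, a point), [boundary C] has no such parametrization
   and the supremum of the empty set is 0: segments contribute 0. *)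
Definition affine_perimeter C : R :=
  sup [set L | exists l g, arclength_param C l g /\
    L = \int[lebesgue_measure]_(s in `]0, l[) (curvature g s `^ 3^-1)].

Definition Phi (lambda : R) C : R :=
  area C `^ lambda * affine_perimeter C ^+ 3.

End AffinePerimeter.

Section Hyperbola.
Context {R : realType}.

Definition ptA : R * R := (0, 0).
Definition ptB : R * R := (2, 0).
Definition ptC : R * R := (1, 1).

Definition triangle : set (R * R) := convex_hull [set ptA; ptB; ptC].

Definition sinh (x : R) : R := (expR x - expR (- x)) / 2.
Definition cosh (x : R) : R := (expR x + expR (- x)) / 2.

Definition Psi (r : R) : R :=
  if r == 0 then 0 else sinh (2 * r) / (2 * r) - 1.

Definition r_of (lambda : R) : R := xget 0 [set r | 0 <= r /\ Psi r = lambda].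

Definition hyp_X (lambda t : R) : R :=
  1 + sinh (r_of lambda * (1 - 2 * t)) / sinh (r_of lambda).

Definition hyp_Y (lambda t : R) : R :=
  2 * cosh (r_of lambda) / sinh (r_of lambda) ^+ 2
  * sinh (r_of lambda * (1 - t)) * sinh (r_of lambda * t).

Definition hyperbola (lambda : R) : set (R * R) :=
  [set (hyp_X lambda t, hyp_Y lambda t) | t in `[0, 1]].

Definition admissible (K : set (R * R)) : Prop :=
  [/\ compact K, convex_set K, K `<=` triangle, K ptA & K ptB].

End Hyperbola.

(* Main.v *)
Require Import Defs.
From mathcomp Require Import all_boot all_order all_algebra.
From mathcomp Require Import all_classical all_reals all_analysis.
From mathcomp Require Import measurable_realfun.
From mathcomp Require Import ring lra.
Import Order.TTheory GRing.Theory Num.Theory.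
Import numFieldNormedType.Exports.
Local Open Scope classical_set_scope.
Local Open Scope ring_scope.
Set Implicit Arguments.
Unset Strict Implicit.
Unset Printing Implicit Defensive.

(** An admissible set K is the region between the segment AB and the graph of a
    concave function f on [0, 2] which vanishes at the ends and is 1-Lipschitz,
    because K lies in the triangle. Its affine perimeter is the integral of
    |f''|^(1/3). The proof is an argument of weak duality. For positive weights
    u and v with v^2 u >= 1 the inequality of arithmetic and geometric means gives

      |f''|^(1/3) <= 2/3 v + 1/3 u |f''|.

    Let h be the function whose graph is the hyperbola. The choice
    u = |h''|^(-2/3), v = u^(-1/2) gives equality for f = h, and for a hyperbola u is
    a polynomial of degree 2. Two integrations by parts therefore turn the
    integral of u |f''| into a constant minus a multiple of the integral of f, and
    the affine perimeter of K is bounded by an affine function of its area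
    ([length_integral_le]). The value r_lambda is the one for which this bound
    reads b <= 1 + lambda/3 (1 - a), where a and b are the ratios of the area and of
    the affine perimeter of K to those of the hull of the hyperbola
    ([critical_length], [competitor_length_le]). By concavity of the logarithm,
    a^lambda b^3 <= 1, with equality only if a = 1 ([powR_cube_le]).

    Uniqueness: if a = 1 and f(P) differs from h(P), the weight u is perturbed by a
    small multiple of the tent function with vertex P. The bound changes at first
    order by a multiple of f(P) - h(P), hence can be made strictly smaller
    ([length_integral_lt]).

    The function f need not be twice differentiable, and the boundary of K comes
    with an arbitrary parametrization by arc length, whose curvature is read from
    second-order expansions. Instead of integrating the inequality above, one
    considers the monotone function F = 2/3 V + 1/3 M, where V is an antiderivative
    of v and M ([moment]) is what the integrations by parts give for u |f''|, written
    with a supergradient p of f and the area below f. At a parameter where the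
    boundary has a second-order expansion, the tangent is a unit vector of slope p,
    the curvature is the absolute value of the determinant of the coefficients, and p varies at
    least as fast as the curvature prescribes ([supergradient_slope]); hence the
    lower right derivative of F along the curve is at least the cube root of the
    curvature ([arc_calibrated]). The lemma of Fatou bounds the integral by the
    variation of F ([le_integral_of_right_slope]). The boundary loop is cut at A and
    B into the graph and the base ([loop_dichotomy]), and the base contributes 0.

    That the hull of the hyperbola attains the bound is checked on an explicit
    parametrization of its boundary by arc length ([hull_curve_param],
    [hull_curve_integral_ge]). *)

(** * Integrals dominated by monotone functions *)

Section Integrals.
Context {R : realType}.
Notation mu := (@lebesgue_measure R).
Import HBNNSimple.

(** The integral of a nonnegative function is a supremum over the simple
    functions below it, so that it is monotone without any measurability. The
    curvature of an arbitrary parametrization is integrated in this sense. *)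
Lemma ge0_integral_mono d (T : measurableType d)
    (m : {measure set T -> \bar R}) (D1 D2 : set T) (f1 f2 : T -> \bar R) :
  D1 `<=` D2 ->
  (forall x, D2 x -> 0 <= f2 x)%E ->
  (forall x, D1 x -> 0 <= f1 x)%E ->
  (forall x, D1 x -> f1 x <= f2 x)%E ->
  (\int[m]_(x in D1) f1 x <= \int[m]_(x in D2) f2 x)%E.
Proof.
move=> D12 f20 f10 f12; rewrite !ge0_integralE // ge_ereal_sup// => _ [h/= hfS] <-.
apply: ereal_sup_ubound; exists h => // x; apply: (le_trans (hfS x)).
rewrite !patchE; case: ifPn => [|_]; rewrite ?inE.
  by move=> D1x; rewrite mem_set; [exact: f12|exact: D12].
by case: ifPn => //; rewrite inE => /f20.
Qed.

Lemma lebesgue_measure_translation (h : R) (A : set R) : measurable A ->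
  pushforward mu ((fun x => x + h) : _ -> measurableTypeR R) A = mu A.
Proof.
move=> mA; have mf : measurable_fun [set: R] (fun x : R => x + h).
  by apply: measurable_funD => //; exact: measurable_cst.
pose g : {mfun measurableTypeR R >-> measurableTypeR R} := @mfun_Sub _ _ (measurableTypeR R) (measurableTypeR R) _ (mem_set mf).
have := @lebesgue_measure_unique R (pushforward mu g) _ A mA; rewrite /g => -> //.
move=> _ [[a b]] _ <-.
transitivity (mu `](a - h), (b - h)]); last first.
  rewrite /pushforward; congr (mu _).
  by apply/seteqP; split => x /=; rewrite !in_itv/= ltrBlDr lerBrDr.
rewrite !lebesgue_measure_itv/= !lte_fin ltrD2r; case: ifP => // _.
by rewrite -!EFinB; congr EFin; ring.
Qed.

Lemma ge0_integral_translation (h a b : R) (f : R -> \bar R) :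
  measurable_fun [set: R] f -> (forall r, 0 <= f r)%E ->
  (\int[mu]_(x in `[a, b]) f (x + h)%R = \int[mu]_(x in `[(a + h)%R, (b + h)%R]) f x)%E.
Proof.
move=> mf f0; rewrite (_ : `[a, b]%classic =
    ((fun x => x + h) : _ -> measurableTypeR R) @^-1` `[a + h, b + h]); last first.
  by apply/seteqP; split => x /=; rewrite !in_itv/= !lerD2r.
have mg : measurable_fun [set: R] (fun x : R => x + h).
  by apply: measurable_funD => //; exact: measurable_cst.
pose g : {mfun measurableTypeR R >-> measurableTypeR R} := @mfun_Sub _ _ (measurableTypeR R) (measurableTypeR R) _ (mem_set mg).
transitivity (\int[pushforward mu g]_(x in `[(a + h)%R, (b + h)%R]) f x)%E.
  rewrite ge0_integral_pushforward//=; exact: measurable_funS mf.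
by apply: eq_measure_integral => A mA _; exact: lebesgue_measure_translation.
Qed.

End Integrals.

Section Dini.
Context {R : realType}.
Notation mu := (@lebesgue_measure R).

Lemma lee_limn_einf (u : nat -> \bar R) (x : \bar R) (N : nat) :
  (forall n, (N <= n)%N -> x <= u n)%E -> (x <= limn_einf u)%E.
Proof.
move=> xu; rewrite limn_einf_lim.
have -> : limn (einfs u) = ereal_sup (range (einfs u)).
  by apply/cvg_lim => //; exact: cvg_einfs_sup.
apply: (@le_trans _ _ (einfs u N)); last by apply: ereal_sup_ubound; exists N.
by apply: le_ereal_inf_tmp => _ [n /= Nn <-]; exact: xu.
Qed.

(** The lower right Dini derivative of F at s is at least c. *)
Definition right_slope_ge (F : R -> R) (s c : R) :=
  forall e, 0 < e -> exists2 d, 0 < d &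
    forall h, 0 < h -> h < d -> h * (c - e) <= F (s + h) - F s.

(** After a translation by h the integrals of F over the common part cancel;
    what remains is the integral over a window of length h beyond b, where F
    is at most F b, minus the one over a window at a, where F is at least F a. *)
Lemma integral_shift_diff_le (F : R -> R) (a b h : R) : a <= b -> 0 < h ->
  nondecreasing_fun F -> (forall x, F a <= F x) -> (forall x, F x <= F b) ->
  (\int[mu]_(s in `[a, b]) (F (s + h) - F s)%:E <= (h * (F b - F a))%:E)%E.
Proof.
move=> ab h0 Fnd Fa Fb.
pose G x := F x - F a.
have G0 x : 0 <= G x by rewrite subr_ge0.
have Gnd : nondecreasing_fun G by move=> x y xy; rewrite lerD2r Fnd.
have mG D : measurable D -> measurable_fun D (EFin \o G).
  by move=> mD; apply/measurable_EFinP; exact: nondecreasing_measurable.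
have mGh D : measurable D -> measurable_fun D (EFin \o (fun s => G (s + h))).
  move=> mD; apply/measurable_EFinP; apply: nondecreasing_measurable => //.
  by move=> x y xy; apply: Gnd; rewrite lerD2r.
have mGG D : measurable D -> measurable_fun D (EFin \o (fun s => F (s + h) - F s)).
  move=> mD; apply/measurable_EFinP.
  rewrite (_ : (fun _ => _) = (fun s => G (s + h)) \- G); last first.
    by apply/funext => s; rewrite /G/=; ring.
  by apply: measurable_funB; apply/measurable_EFinP; [exact: mGh|exact: mG].
have D0 x : 0 <= F (x + h) - F x by rewrite subr_ge0 Fnd// lerDl ltW.
have fin : (\int[mu]_(s in `[a, b]) (G s)%:E \is a fin_num)%E.
  rewrite ge0_fin_numE; last by apply: integral_ge0 => x _; rewrite lee_fin.
  apply: (@le_lt_trans _ _ (\int[mu]_(s in `[a, b]) (cst (G b)%:E s)))%E.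
    by apply: ge0_integral_mono => // x _; rewrite lee_fin ?G0// lerD2r.
  by rewrite integral_cst//= lebesgue_measure_itv/=; case: ifP => _; rewrite ?mule0 ?ltry// EFinM ltry.
rewrite -(leeD2rE _ _ fin) -ge0_integralD//=; last first.
- exact: mG.
- by move=> x _; rewrite lee_fin.
- exact: mGG.
- by move=> x _; rewrite lee_fin.
under eq_integral do rewrite -EFinD.
rewrite (_ : (fun s => _) = (fun s => (G (s + h))%:E)); last first.
  by apply/funext => s; rewrite /G; congr EFin; ring.
rewrite (@ge0_integral_translation _ h a b (EFin \o G))//=; last first.
  exact: mG.
pose U : set R := `[a, b]%classic `|` `]b, (b + h)]%classic.
apply: (@le_trans _ _ (\int[mu]_(x in U) (G x)%:E)%E).
  apply: ge0_integral_mono => // [x /=|x _|x _]; rewrite ?lee_fin//.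
  rewrite !in_itv/= => /andP[ahx xbh].
  have [xb|bx] := leP x b; [left|right] => //=; rewrite !in_itv/= ?xb ?bx ?xbh ?andbT//.
  by rewrite (le_trans _ ahx)// lerDl ltW.
rewrite /U ge0_integral_setU//=; last 3 first.
- by apply: mG; exact: measurableU.
- by move=> x _; rewrite lee_fin.
- apply/disj_set2P; rewrite -subset0 => x /= []; rewrite !in_itv/= => /andP[_ +] /andP[+ _].
  by move=> /le_lt_trans /[apply]; rewrite ltxx.
rewrite addeC leeD2r//.
pose V : set R := `]b, (b + h)]%classic.
apply: (@le_trans _ _ (\int[mu]_(s in V) (cst (G b)%:E s))%E).
  by apply: ge0_integral_mono => // x _; rewrite lee_fin ?G0// lerD2r.
rewrite /V integral_cst//= lebesgue_measure_itv/= lte_fin ltrDl h0.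
by rewrite -EFinB -EFinM lee_fin /G/=; lra.
Qed.

(** One-sided form of the inequality of Lebesgue for the derivative of a
    monotone function: the lemma of Fatou is applied to the difference
    quotients of step 1 / (n + 1), whose lower limit dominates phi. The bounds
    on F outside [a, b] make the quotients near b harmless. *)
Lemma le_integral_of_right_slope0 (phi F : R -> R) (a b : R) : a <= b ->
  nondecreasing_fun F -> (forall x, F a <= F x) -> (forall x, F x <= F b) ->
  (forall s, s \in `]a, b[ -> 0 <= phi s) ->
  (forall s, s \in `]a, b[ -> right_slope_ge F s (phi s)) ->
  (\int[mu]_(s in `]a, b[) (phi s)%:E <= (F b - F a)%:E)%E.
Proof.
move=> ab Fnd Fa Fb phi0 slope.
pose h n : R := n.+1%:R^-1.
have h0 n : 0 < h n by rewrite invr_gt0.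
pose Gn n s : \bar R := ((h n)^-1 * (F (s + h n) - F s))%:E.
have D0 n x : 0 <= F (x + h n) - F x by rewrite subr_ge0 Fnd// lerDl ltW.
have Gn0 n s : (0 <= Gn n s)%E by rewrite lee_fin mulr_ge0// invr_ge0 ltW.
have mF n : measurable_fun [set: R] (fun s => F (s + h n) - F s).
  rewrite -[X in measurable_fun _ X]/((fun s => F (s + h n)) \- F).
  apply: measurable_funB; apply: nondecreasing_measurable => //.
  by move=> x y xy; apply: Fnd; rewrite lerD2r.
have mGn n : measurable_fun `[a, b] (Gn n).
  apply: (measurable_funS measurableT) => //.
  apply/measurable_EFinP; apply: measurable_funM => //.
pose V : set R := `[a, b]%classic.
apply: (@le_trans _ _ (\int[mu]_(s in V) limn_einf (Gn ^~ s))%E).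
  apply: ge0_integral_mono => [|x _|x /phi0|x xab].
  - exact: subset_itv_oo_cc.
  - by apply: (@lee_limn_einf _ _ 0%N) => n _; exact: Gn0.
  - by rewrite lee_fin.
  - apply/lee_addgt0Pr => e e0; rewrite -leeBlDr// -EFinB.
    have [d d0 hd] := slope _ xab _ e0.
    have [N hN] : exists N, forall n, (N <= n)%N -> h n < d.
      have [N _ HN] := near_infty_natSinv_lt (PosNum d0).
      by exists N => n Nn; apply: HN.
    apply: (@lee_limn_einf _ _ N) => n Nn.
    rewrite /Gn lee_fin mulrC ler_pdivlMr// mulrC.
    by apply: hd => //; exact: hN.
have := @fatou _ _ _ mu `[a, b] _ Gn mGn (fun n x _ => Gn0 n x).
move=> /(_ (measurable_itv _)) /le_trans; apply.
rewrite limn_einf_lim.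
have -> : limn (einfs (fun n => \int[mu]_(x in `[a, b]) Gn n x)%E)
   = ereal_sup (range (einfs (fun n => \int[mu]_(x in `[a, b]) Gn n x)%E)).
  by apply/cvg_lim => //; exact: cvg_einfs_sup.
apply: ge_ereal_sup => _ [n _ <-].
apply: (@le_trans _ _ (\int[mu]_(x in `[a, b]) Gn n x)%E).
  by apply: ereal_inf_lbound; exists n => /=.
rewrite /Gn; under eq_integral do rewrite EFinM.
rewrite ge0_integralZl_EFin//; last 3 first.
- by move=> x _; rewrite lee_fin.
- by apply/measurable_EFinP; exact: measurable_funS (mF n).
- by rewrite invr_ge0 ltW.
apply: (@le_trans _ _ ((h n)^-1%:E * (h n * (F b - F a))%:E)%E).
  apply: lee_wpmul2l; first by rewrite lee_fin invr_ge0 ltW.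
  by apply: integral_shift_diff_le.
by rewrite -EFinM mulKf// gt_eqF.
Qed.

End Dini.

Section Majorant.
Context {R : realType}.
Notation mu := (@lebesgue_measure R).

(** The slope condition may fail on a finite set E: a small jump of F just to
    the right of each point of E makes the right slope infinite there, at an
    arbitrarily small cost. *)
Lemma le_integral_of_right_slope (phi F : R -> R) (E : seq R) (a b : R) :
  a <= b -> {in `[a, b] &, nondecreasing_fun F} ->
  (forall s, s \in `]a, b[ -> 0 <= phi s) ->
  (forall s, s \in `]a, b[ -> s \notin E -> right_slope_ge F s (phi s)) ->
  (\int[mu]_(s in `]a, b[) (phi s)%:E <= (F b - F a)%:E)%E.
Proof.
move=> ab Fnd phi0 slope.
(* F is extended by constants outside [a, b]. *)
pose cl x := Num.min b (Num.max a x).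
have cl_in x : cl x \in `[a, b].
  by rewrite in_itv/= le_min ge_min lexx ab le_max lexx.
have cl_id x : x \in `[a, b] -> cl x = x.
  by rewrite in_itv/= => /andP[ax xb]; rewrite /cl max_r// min_r.
have cl_nd : nondecreasing_fun cl.
  move=> x y xy; rewrite /cl le_min ge_min lexx/= ge_min; apply/orP; right.
  by rewrite ge_max !le_max lexx/= xy orbT.
apply/lee_addgt0Pr => e e0.
pose n : R := (size E).+1%:R.
have n0 : 0 < n by [].
pose J x : R := \sum_(i <- E) (i < x)%R%:R.
have J_nd : nondecreasing_fun J.
  move=> x y xy; apply: ler_sum => i _; rewrite ler_nat.
  by case: ltP => // ix; rewrite (lt_le_trans ix xy).
have J0 x : 0 <= J x by apply: sumr_ge0 => i _.
have Jn x : J x <= n.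
  rewrite /J /n -sum1_size; apply: (@le_trans _ _ (\sum_(i <- E) 1%:R)).
    by apply: ler_sum => i _; rewrite ler_nat; case: ltP.
  by rewrite -natr_sum ler_nat.
(* height of each jump: at most size E of them, hence a total below e *)
pose dl := e / n.
have dl0 : 0 < dl by rewrite divr_gt0.
pose F' x := F (cl x) + dl * J (cl x).
have F'_nd : nondecreasing_fun F'.
  by move=> x y xy; rewrite lerD ?Fnd ?cl_nd// ler_pM2l ?J_nd ?cl_nd.
have clab x : cl a <= cl x <= cl b.
  rewrite (cl_id a) ?(cl_id b) ?in_itv/= ?lexx ?ab//.
  exact: cl_in.
have F'a x : F' a <= F' x.
  have /andP[h _] := clab x; rewrite /F' lerD ?Fnd// ler_pM2l// J_nd//.
have F'b x : F' x <= F' b.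
  have /andP[_ h] := clab x; rewrite /F' lerD ?Fnd// ler_pM2l// J_nd//.
apply: (@le_trans _ _ (F' b - F' a)%:E).
  apply: le_integral_of_right_slope0 => // s sab.
  have /andP[sa sb] : (a < s) && (s < b) by move: sab; rewrite in_itv.
  have cls h : 0 <= h -> h < b - s -> cl (s + h) = s + h.
    by move=> h0 hb; apply: cl_id; rewrite in_itv/=; lra.
  have cls0 : cl s = s by have := cls 0; rewrite addr0 => ->//; lra.
  have [sE|sE] := boolP (s \in E).
    move=> e' e'0; exists (Num.min (b - s) (dl / (phi s + 1))).
      by rewrite lt_min subr_gt0 sb divr_gt0//; have := phi0 _ sab; lra.
    move=> h h0; rewrite lt_min => /andP[hb hd].
    have p1 : 0 < phi s + 1 by have := phi0 _ sab; lra.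
    apply: (@le_trans _ _ dl).
      move: hd; rewrite ltr_pdivlMr// => hd.
      by apply: le_trans (ltW hd); rewrite ler_pM2l//; lra.
    rewrite /F' cls ?(ltW h0)// cls0.
    have : F s <= F (s + h).
      by apply: Fnd; rewrite ?in_itv/=; [lra|lra|rewrite lerDl ltW].
    suff : J s + 1 <= J (s + h) by move=> /(ler_wpM2l (ltW dl0)); lra.
    rewrite /J (perm_big _ (perm_to_rem sE)) big_cons/=.
    rewrite [leRHS](perm_big _ (perm_to_rem sE)) big_cons/=.
    rewrite ltxx ltrDl h0 mulr0n mulr1n add0r.
    rewrite [leLHS]addrC; apply: lerD => //.
    apply: ler_sum => i _; rewrite ler_nat.
    by case: ltP => // ix; rewrite (lt_trans ix)// ltrDl.
  move=> e' e'0; have [d d0 hd] := slope _ sab sE _ e'0.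
  exists (Num.min (b - s) d); first by rewrite lt_min d0 subr_gt0 sb.
  move=> h h0; rewrite lt_min => /andP[hb hlt].
  rewrite /F' cls ?(ltW h0)// cls0; have := hd _ h0 hlt.
  have : dl * J s <= dl * J (s + h).
    by rewrite ler_pM2l// J_nd// lerDl ltW.
  lra.
rewrite /F' (cl_id a) ?(cl_id b) ?in_itv/= ?lexx ?ab// -EFinD lee_fin.
have : dl * J b <= e.
  rewrite -[leRHS](@divfK _ n) ?gt_eqF//; rewrite ler_pM2l//.
have := mulr_ge0 (ltW dl0) (J0 a); lra.
Qed.

(** A certificate that the integral of phi over ]a, b[ is at most B. Unlike
    the integral inequality itself, it can be glued along subdivisions without
    measurability; the junctions go into the exceptional set E. *)
Definition majorized (phi : R -> R) (a b B : R) := exists F : R -> R, exists E : seq R,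
  [/\ {in `[a, b] &, nondecreasing_fun F}, F b - F a <= B &
  forall s, s \in `]a, b[ -> s \notin E -> right_slope_ge F s (phi s)].

Lemma majorized_nil phi a : majorized phi a a 0.
Proof.
exists (cst 0), [::]; split => [x y //||s]; first by rewrite /= subrr.
by rewrite in_itv/= => /andP[/lt_trans h /h]; rewrite ltxx.
Qed.

Lemma majorized_cat phi a b c B1 B2 : a <= b -> b <= c ->
  majorized phi a b B1 -> majorized phi b c B2 -> majorized phi a c (B1 + B2).
Proof.
move=> ab bc [F1 [E1 [nd1 l1 s1]]] [F2 [E2 [nd2 l2 s2]]].
pose F x := if x <= b then F1 x else F2 x - F2 b + F1 b.
exists F, (b :: E1 ++ E2); split.
- move=> x y; rewrite !in_itv/= => /andP[ax xc] /andP[ay yc] xy; rewrite /F.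
  have [yb|yb] := leP y b.
    by rewrite (le_trans xy yb) nd1// in_itv/= ?ax ?ay/=; lra.
  have [xb|xb] := leP x b.
    have : F1 x <= F1 b by rewrite nd1// in_itv/= ?ax ?ab ?xb/=.
    have : F2 b <= F2 y by rewrite nd2// ?in_itv/= ?lexx ?bc ?yc ?(ltW yb).
    lra.
  have : F2 x <= F2 y by rewrite nd2// ?in_itv/= ?xc ?yc ?(ltW yb) ?(ltW xb).
  lra.
- rewrite /F ab; have [cb|cb] := leP c b; last lra.
  have -> : c = b by lra.
  have : F2 b <= F2 c by rewrite nd2// ?in_itv/= ?lexx ?bc.
  by lra.
move=> s; rewrite in_itv/= inE mem_cat !negb_or => /andP[as_ sc] /and3P[sb sE1 sE2].
move=> e e0; have [slb|slb] := ltP s b.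
  have [|d d0 hd] := s1 s _ sE1 _ e0; first by rewrite in_itv/= as_.
  exists (Num.min (b - s) d); first by rewrite lt_min d0 subr_gt0 slb.
  move=> h h0; rewrite lt_min => /andP[hb hlt]; rewrite /F !ifT ?hd//; lra.
have {}slb : b < s by rewrite lt_neqAle eq_sym sb.
have [|d d0 hd] := s2 s _ sE2 _ e0; first by rewrite in_itv/= slb.
exists d => // h h0 hlt; rewrite /F !ifF; last 2 first.
- by apply/negbTE; rewrite -ltNge.
- by apply/negbTE; rewrite -ltNge; lra.
have := hd _ h0 hlt; lra.
Qed.

Lemma majorizedW phi a b B B' : B <= B' -> majorized phi a b B -> majorized phi a b B'.
Proof. by move=> BB' [F [E [nd l s]]]; exists F, E; split => //; exact: le_trans BB'. Qed.

Lemma majorized_integral phi a b B : a <= b ->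
  (forall s, s \in `]a, b[ -> 0 <= phi s) -> majorized phi a b B ->
  (\int[mu]_(s in `]a, b[) (phi s)%:E <= B%:E)%E.
Proof.
move=> ab phi0 [F [E [nd l s]]].
by apply: (le_trans (le_integral_of_right_slope ab nd phi0 s)); rewrite lee_fin.
Qed.

End Majorant.

(** * Concave functions and the moment of their second derivative *)

Section Cap.
Context {R : realType}.

(** A concave 1-Lipschitz function f on [0, 2] with a chosen supergradient p.
    Every estimate is expressed through p, which is defined everywhere and
    monotone, instead of a derivative of f. *)
Record cap (f p : R -> R) : Prop := Cap {
  cap_sg : forall x z, 0 <= x <= 2 -> 0 <= z <= 2 -> f z <= f x + p x * (z - x);
  cap_p : forall x, 0 <= x <= 2 -> `|p x| <= 1 }.

Arguments cap_sg {f p} _ x z.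
Arguments cap_p {f p} _ x.

Variables f p : R -> R.
Hypothesis fp : cap f p.

Lemma cap_slope x y : 0 <= x -> x <= y -> y <= 2 ->
  p y * (y - x) <= f y - f x /\ f y - f x <= p x * (y - x).
Proof.
move=> x0 xy y2.
have := cap_sg fp x y; have := cap_sg fp y x.
have -> : 0 <= x <= 2 by lra.
have -> : 0 <= y <= 2 by lra.
move=> /(_ isT isT) h1 /(_ isT isT) h2; split; lra.
Qed.

Lemma cap_p_noninc x y : 0 <= x -> x <= y -> y <= 2 -> p y <= p x.
Proof.
move=> x0 xy y2; have [h1 h2] := cap_slope x0 xy y2.
move: xy; rewrite le_eqVlt => /predU1P[->//|xy].
by rewrite -(@ler_pM2r _ (y - x)) ?subr_gt0//; lra.
Qed.

Lemma cap_lip x y : 0 <= x <= 2 -> 0 <= y <= 2 -> `|f y - f x| <= `|y - x|.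
Proof.
wlog xy : x y / x <= y.
  move=> H x2 y2; have [xy|/ltW yx] := leP x y; first exact: H.
  by rewrite distrC [leRHS]distrC H.
move=> x2 y2; have [||h1 h2] := @cap_slope x y _ xy; [lra|lra|].
have /ler_normlP[a1 a2] := cap_p fp x x2; have /ler_normlP[b1 b2] := cap_p fp y y2.
rewrite [leRHS]ger0_norm ?subr_ge0// ler_norml; apply/andP; split; nra.
Qed.

(** Monotonicity is a local property: the step d can be iterated. *)
Lemma local_nondecreasing (G : R -> R) (a b d : R) : 0 < d ->
  (forall x y, a <= x -> x <= y -> y <= b -> y - x <= d -> G x <= G y) ->
  {in `[a, b] &, nondecreasing_fun G}.
Proof.
move=> d0 H.
have K n : forall x y, a <= x -> x <= y -> y <= b -> y - x <= d * n%:R -> G x <= G y.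
  elim: n => [|n IH] x y ax xy yb.
    by rewrite mulr0 => ?; have -> : x = y by lra.
  move=> yx; have [yxd|yxd] := leP (y - x) d; first exact: H.
  rewrite -natr1 in yx.
  apply: (@le_trans _ _ (G (x + d))); first by apply: H; lra.
  by apply: IH; lra.
move=> x y; rewrite !in_itv/= => /andP[ax xb] /andP[ay yb] xy.
apply: (K (Num.bound ((y - x) / d))) => //.
rewrite mulrC -ler_pdivrMr//; apply/ltW/archi_boundP.
by rewrite divr_ge0// ?subr_ge0// ltW.
Qed.

(* Ar stands for the antiderivative of f; the tangent line above the graph
   gives this bound. *)
Variable Ar : R -> R.
Hypothesis ArP : forall x y, 0 <= x -> x <= y -> y <= 2 ->
  Ar y - Ar x <= (y - x) * f x + p x * (y - x) ^+ 2 / 2.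

Section Moment.
Variables al be ga : R.
Hypothesis ga0 : 0 <= ga.

Definition quad x := al + be * x + ga * x ^+ 2.
(** An antiderivative of - quad * p' (p' being the second derivative of f),
    obtained by integrating by parts twice: the second derivative of quad is
    the constant 2 ga, so that f itself enters only through its antiderivative
    Ar, that is, through the area. *)
Definition moment x := - p x * quad x + (be + 2 * ga * x) * f x - 2 * ga * Ar x.

Let C := `|be| + 4 * ga.

(** Discrete form of d moment = - quad dp, which makes sense across the jumps
    of p. The error is bounded by a multiple of (y - x) * (p x - p y), not
    only of (y - x) ^+ 2: it stays negligible with respect to the main term
    even where p hardly varies. *)
Lemma moment_incr x y : 0 <= x -> x <= y -> y <= 2 ->
  (quad x - 2 * C * (y - x)) * (p x - p y) <= moment y - moment x.
Proof.
move=> x0 xy y2.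
have [s1 s2] := cap_slope x0 xy y2.
have pp := cap_p_noninc x0 xy y2.
have arP := ArP x0 xy y2.
(* r and th are the errors of the tangent line at y and of the trapezoidal
   rule; both are controlled by D. *)
pose k := y - x; pose D := p x - p y; pose r := f y - f x - k * p y.
pose th := Ar y - Ar x - k * (f x + f y) / 2.
pose ub := be + ga * (x + y).
have D0 : 0 <= D by rewrite subr_ge0.
have k0 : 0 <= k by rewrite subr_ge0.
have k2 : k <= 2 by rewrite /k; lra.
have r0 : 0 <= r by rewrite /r /k; lra.
have r1 : r <= k * D by rewrite /r /k /D; lra.
have th1 : th <= k ^+ 2 * D / 2.
  rewrite /th /k /D.
  have := ler_wpM2l (k0 : 0 <= y - x) s1.
  move: arP; rewrite !expr2; lra.
have -> : moment y - moment x = quad x * D + ub * r - 2 * ga * th.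
  by rewrite /moment /quad /D /ub /r /th /k; field.
have ubC : `|ub| <= C.
  rewrite /ub /C (le_trans (ler_normD _ _))// lerD2l normrM ger0_norm// mulrC.
  by rewrite ler_wpM2r// ger0_norm; lra.
have C0 : 0 <= C by rewrite /C addr_ge0// mulr_ge0.
have e1 : - (C * (k * D)) <= ub * r.
  have : `|ub * r| <= C * (k * D).
    rewrite normrM; apply: ler_pM => //; by rewrite ger0_norm.
  by rewrite ler_norml => /andP[].
have e2 : 2 * ga * th <= C * (k * D).
  apply: (@le_trans _ _ (2 * ga * (k ^+ 2 * D / 2))).
    by rewrite ler_wpM2l// mulr_ge0.
  have -> : 2 * ga * (k ^+ 2 * D / 2) = (ga * k) * (k * D) by field.
  rewrite ler_wpM2r ?mulr_ge0//.
  apply: (@le_trans _ _ (4 * ga)); last by rewrite /C lerDr.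
  by rewrite mulrC ler_wpM2r//; lra.
rewrite -/k -/D; lra.
Qed.

Lemma quad_lip x y : 0 <= x <= 2 -> 0 <= y <= 2 ->
  `|quad y - quad x| <= C * `|y - x|.
Proof.
move=> x2 y2; have -> : quad y - quad x = (be + ga * (x + y)) * (y - x).
  by rewrite /quad; ring.
rewrite normrM ler_wpM2r// /C (le_trans (ler_normD _ _))// lerD2l normrM ger0_norm// mulrC.
by rewrite ler_wpM2r// ger0_norm; lra.
Qed.

(** On steps short with respect to the lower bound m of quad, the main term of
    moment_incr dominates the error. *)
Lemma moment_nondecreasing a b m : 0 <= a -> b <= 2 -> 0 < m ->
  (forall x, a <= x -> x <= b -> m <= quad x) ->
  {in `[a, b] &, nondecreasing_fun moment}.
Proof.
move=> a0 b2 m0 mq.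
have C0 : 0 <= C by rewrite /C addr_ge0// mulr_ge0.
apply: (@local_nondecreasing _ _ _ (m / (2 * C + 1))); first by rewrite divr_gt0//; lra.
move=> x y ax xy yb; rewrite ler_pdivlMr; last lra.
move=> yx.
rewrite -subr_ge0; apply: le_trans (@moment_incr x y _ xy _); [|lra|lra].
apply: mulr_ge0; last by rewrite subr_ge0 cap_p_noninc//; lra.
rewrite subr_ge0 (le_trans _ (mq x ax _))//; last lra.
by apply: le_trans yx; nra.
Qed.

Lemma moment_abs x y : 0 <= x <= 2 -> 0 <= y <= 2 ->
  (quad x - 3 * C * `|y - x|) * `|p y - p x| <= `|moment y - moment x|.
Proof.
have C0 : 0 <= C by rewrite /C addr_ge0// mulr_ge0.
move=> x2 y2; have [xy|/ltW yx] := leP x y.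
  have a := @cap_p_noninc x y; have b := @moment_incr x y.
  have {}a : p y <= p x by apply: a; lra.
  have {}b : (quad x - 2 * C * (y - x)) * (p x - p y) <= moment y - moment x by apply: b; lra.
  apply: le_trans (ler_norm _); apply: le_trans b.
  have -> : `|p y - p x| = p x - p y by rewrite distrC ger0_norm// subr_ge0.
  have -> : `|y - x| = y - x by rewrite ger0_norm// subr_ge0.
  by rewrite ler_wpM2r ?subr_ge0//; nra.
have a := @cap_p_noninc y x; have b := @moment_incr y x.
have {}a : p x <= p y by apply: a; lra.
have {}b : (quad y - 2 * C * (x - y)) * (p y - p x) <= moment x - moment y by apply: b; lra.
rewrite [leRHS]distrC; apply: le_trans (ler_norm _); apply: le_trans b.
have -> : `|p y - p x| = p y - p x by rewrite ger0_norm// subr_ge0.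
rewrite ler_wpM2r ?subr_ge0//.
have := quad_lip x2 y2; rewrite [`|y - x|]distrC [`|x - y|]ger0_norm ?subr_ge0//.
rewrite ler_norml => /andP[h _]; lra.
Qed.

End Moment.
End Cap.

(** * Second-order expansions and slopes of chords *)

Section Jets.
Context {R : realType}.

Lemma cvg_scale_dnbhs (th : R) : th != 0 -> (th * h) @[h --> (0:R)^'+] --> (0:R)^'.
Proof.
move=> th0 A /= [e /= e0 HA].
have t0 : 0 < `|th| by rewrite normr_gt0.
exists (e / `|th|) => /=; first by rewrite divr_gt0.
move=> h /=; rewrite sub0r normrN => he h0.
apply: HA => /=; last by rewrite mulf_neq0// gt_eqF.
by rewrite sub0r normrN normrM mulrC -ltr_pdivlMr.
Qed.

Lemma cvg_right_id : h @[h --> (0:R)^'+] --> (0:R).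
Proof. exact: cvg_at_right_filter. Qed.

Lemma near_right_gt0 : \forall h \near (0:R)^'+, 0 < h.
Proof. exact: nbhs_right_gt. Qed.

Definition jet2 (X : R -> R) (s a b : R) : Prop :=
  h^-1 ^+ 2 * (X (s + h) - X s - h * a - h ^+ 2 / 2 * b) @[h --> 0^'] --> (0:R).

(** The increment is measured at s + th * h with h > 0, so that the values 1,
    -1 and 1 - de of th give the right side, the left side and a pair of
    nearby points on the same side. *)
Definition quot (X : R -> R) s th (h : R) := h^-1 * (X (s + th * h) - X s).

Lemma jet2_quot2 X s a b th : jet2 X s a b ->
  h^-1 * (quot X s th h - th * a) @[h --> 0^'+] --> th ^+ 2 / 2 * b.
Proof.
move=> j; have [->|th0] := eqVneq th 0.
  rewrite expr0n !mul0r; apply: cvg_near_cst; near=> h.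
  by rewrite /quot !mul0r addr0 subrr mulr0 subrr mulr0.
have /= k := cvg_comp _ _ (cvg_scale_dnbhs th0) j.
pose r h := (th * h)^-1 ^+ 2 *
  (X (s + th * h) - X s - (th * h) * a - (th * h) ^+ 2 / 2 * b).
have {}k : r h @[h --> 0^'+] --> (0:R) by exact: k.
rewrite -[X in _ --> X]add0r -[X in _ --> X + _](mulr0 (th ^+ 2)).
apply: (@cvg_trans _ ((th ^+ 2 * r h + th ^+ 2 / 2 * b) @[h --> 0^'+])).
  apply: near_eq_cvg; near=> h.
  have h0 : 0 < h by near: h; exact: near_right_gt0.
  by rewrite /quot /r; field; rewrite th0 gt_eqF.
apply: cvgD; last exact: cvg_cst.
by apply: cvgM => //; exact: cvg_cst.
Unshelve. all: by end_near. Qed.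

Lemma jet2_quot X s a b th : jet2 X s a b -> quot X s th h @[h --> 0^'+] --> th * a.
Proof.
move=> j; have k := jet2_quot2 (th := th) j.
rewrite -[X in _ --> X]add0r -[X in _ --> X + _](mul0r (th ^+ 2 / 2 * b)).
apply: (@cvg_trans _ ((h * (h^-1 * (quot X s th h - th * a)) + th * a) @[h --> 0^'+])).
  apply: near_eq_cvg; near=> h.
  have h0 : 0 < h by near: h; exact: near_right_gt0.
  by rewrite mulrA divff ?gt_eqF// mul1r subrK.
apply: cvgD; last exact: cvg_cst.
by apply: cvgM => //; exact: cvg_right_id.
Unshelve. all: by end_near. Qed.

(** The slope of the chord between the parameters s + t1 h and s + t2 h
    differs from that of the tangent by h times the derivative of the slope at
    the middle (t1 + t2) / 2. An expansion at the single point s suffices,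
    because the gap (t1 - t2) h is comparable to h. *)
Lemma jet2_slope X Y s a1 b1 a2 b2 t1 t2 :
  jet2 X s a1 b1 -> jet2 Y s a2 b2 -> a1 != 0 -> t1 != t2 ->
  h^-1 * ((Y (s + t1 * h) - Y (s + t2 * h)) / (X (s + t1 * h) - X (s + t2 * h))
    - a2 / a1) @[h --> 0^'+] -->
  (t1 + t2) / 2 * (a1 * b2 - a2 * b1) / a1 ^+ 2.
Proof.
move=> jX jY a10 t12.
pose e (Z : R -> R) th a h := h^-1 * (quot Z s th h - th * a).
have t120 : t1 - t2 != 0 by rewrite subr_eq0.
have DX : (quot X s t1 h - quot X s t2 h) @[h --> 0^'+] --> t1 * a1 - t2 * a1.
  by apply: cvgB; exact: (jet2_quot jX).
have DX0 : t1 * a1 - t2 * a1 != 0 by rewrite -mulrBl mulf_neq0.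
have -> : (t1 + t2) / 2 * (a1 * b2 - a2 * b1) / a1 ^+ 2 =
  (a1 * (t1 ^+ 2 / 2 * b2 - t2 ^+ 2 / 2 * b2) -
   a2 * (t1 ^+ 2 / 2 * b1 - t2 ^+ 2 / 2 * b1)) * (a1 * (t1 * a1 - t2 * a1))^-1.
  by field; rewrite ?a10 ?t120 ?DX0.
apply: (@cvg_trans _ (((a1 * (e Y t1 a2 h - e Y t2 a2 h) - a2 * (e X t1 a1 h - e X t2 a1 h))
   * (a1 * (quot X s t1 h - quot X s t2 h))^-1) @[h --> 0^'+])).
  apply: near_eq_cvg; near=> h.
  have h0 : 0 < h by near: h; exact: near_right_gt0.
  have q0 : quot X s t1 h - quot X s t2 h != 0.
    by near: h; exact: (cvgr_neq0 _ DX DX0).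
  have x0 : X (s + t1 * h) - X (s + t2 * h) != 0.
    apply: contra_neq q0 => q0; rewrite /quot -mulrBr.
    by rewrite opprB addrA subrK q0 mulr0.
  have E Z t : quot Z s t h = (Z (s + t * h) - Z s) / h by rewrite /quot mulrC.
  rewrite /e !E; field.
  by rewrite a10 x0 gt_eqF.
apply: cvgM; last first.
  apply: cvgV; first by rewrite mulf_neq0.
  by apply: cvgM => //; exact: cvg_cst.
by apply: cvgB; (apply: cvgM; [exact: cvg_cst|]); apply: cvgB; (exact: (jet2_quot2 jX) || exact: (jet2_quot2 jY)).
Unshelve. all: by end_near. Qed.

Lemma second_order_expansionP (g : R -> R * R) s T N :
  second_order_expansion g s T N <->
  jet2 (fun t => (g t).1) s T.1 N.1 /\ jet2 (fun t => (g t).2) s T.2 N.2.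
Proof.
rewrite /second_order_expansion /jet2; split.
  move=> H; split.
    exact: (cvg_comp _ _ H (@cvg_fst _ _ (nbhs (0:R)) (nbhs (0:R)) _)).
  exact: (cvg_comp _ _ H (@cvg_snd _ _ (nbhs (0:R)) (nbhs (0:R)) _)).
move=> [H1 H2]; exact: (cvg_pair H1 H2).
Qed.

End Jets.

(** * Arc length on the graph of a concave function *)

Section Enorm.
Context {R : realType}.
Implicit Types u v : R * R.

Lemma enorm_ge0 u : 0 <= enorm u. Proof. exact: sqrtr_ge0. Qed.

Lemma enorm_sqr u : enorm u ^+ 2 = u.1 ^+ 2 + u.2 ^+ 2.
Proof. by rewrite sqr_sqrtr// addr_ge0// sqr_ge0. Qed.

Lemma enorm_le u c : 0 <= c -> (enorm u <= c) = (u.1 ^+ 2 + u.2 ^+ 2 <= c ^+ 2).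
Proof. by move=> c0; rewrite -enorm_sqr ler_pXn2r// nnegrE enorm_ge0. Qed.

Lemma enormN u : enorm (- u) = enorm u.
Proof. by rewrite /enorm /= !sqrrN. Qed.

Lemma chord_le_curve_length (a b : R) (g : R -> R * R) : a < b ->
  ((enorm (g b - g a))%:E <= curve_length a b g)%E.
Proof.
move=> ab; apply: ereal_sup_ubound; exists [:: b]; first exact: itv_partition1.
by rewrite /polygonal_length /= big_nat1.
Qed.

(** P is a potential: the bounds on the chords of a subdivision telescope. *)
Lemma curve_length_le (a b : R) (g : R -> R * R) (P : R -> R) :
  (forall u v : R, a <= u -> u < v -> v <= b -> enorm (g v - g u) <= P v - P u) ->
  (curve_length a b g <= (P b - P a)%:E)%E.
Proof.
move=> H; apply: ge_ereal_sup => _ [q abq <-]; rewrite lee_fin /polygonal_length.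
have hs : nth b (a :: q) (size q) = b by exact: itv_partition_nth_size abq.
rewrite -[X in P X - _]hs -[X in _ - P X]/(nth b (a :: q) 0).
rewrite -(@telescope_sumr _ 0%N (size q) (P \o nth b (a :: q)))//.
apply: ler_sum_nat => i /andP[_ iq] /=.
have [/= pa _] := abq.
apply: H.
- by apply: (itv_partition_nth_ge _ abq); rewrite ltnS ltnW.
- by move/(pathP b) : pa => /(_ _ iq).
- by rewrite -[nth b q i]/(nth b (a :: q) i.+1); apply: (itv_partition_nth_le _ abq).
Qed.

End Enorm.

Section Pieces.
Context {R : realType}.
Variables f p : R -> R.
Hypothesis fp : cap f p.

(** All slopes of f over [al, be] lie between p be and p al, so that a small
    chord has nearly the direction of the large one. *)
Lemma cap_piece al be u v : 0 <= al -> al < be -> be <= 2 ->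
  al <= u -> u <= v -> v <= be ->
  enorm (v - u, f v - f u) <=
  (v - u) * (Num.sqrt (1 + ((f be - f al) / (be - al)) ^+ 2) + (p al - p be)).
Proof.
move=> al0 albe be2 alu uv vbe.
set sg := (f be - f al) / (be - al).
have ba0 : 0 < be - al by rewrite subr_gt0.
have sgE : sg * (be - al) = f be - f al by rewrite /sg divfK// gt_eqF.
have s1 := @cap_slope _ _ _ fp al be al0 (ltW albe) be2.
have [h1 h2] : p be <= sg /\ sg <= p al.
  by rewrite -[p be <= sg](ler_pM2r ba0) -[sg <= p al](ler_pM2r ba0) sgE.
have [t1 t2] : p v * (v - u) <= f v - f u /\ f v - f u <= p u * (v - u).
  by apply: (cap_slope fp); lra.
have q1 : p u <= p al by apply: (cap_p_noninc fp); lra.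
have q2 : p be <= p v by apply: (cap_p_noninc fp); lra.
(* w is the deviation of the small chord from the direction of the large one;
   it is at most k * D. *)
set k := v - u in t1 t2 *; have k0 : 0 <= k by rewrite /k subr_ge0.
set D := p al - p be.
set w := f v - f u - sg * k.
have wD : `|w| <= k * D.
  rewrite ler_norml /w /D; apply/andP; split; nra.
have D0 : 0 <= D by rewrite /D; lra.
set S := Num.sqrt (1 + sg ^+ 2).
have S0 : 0 <= S by exact: sqrtr_ge0.
have S2 : S ^+ 2 = 1 + sg ^+ 2 by rewrite sqr_sqrtr// addr_ge0// sqr_ge0.
have sgS : `|sg| <= S by rewrite -sqrtr_sqr ler_wsqrtr// lerDr.
rewrite enorm_le/=; last by rewrite mulr_ge0// addr_ge0.
have -> : f v - f u = sg * k + w by rewrite /w; ring.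
have : sg * w <= S * (k * D).
  apply: le_trans (ler_norm _) _; rewrite normrM; apply: ler_pM => //.
have : w ^+ 2 <= (k * D) ^+ 2.
  by rewrite -[leLHS]real_normK ?num_real// ler_pXn2r ?nnegrE// mulr_ge0.
move=> e1 e2.
have := ler_wpM2l k0 e2; rewrite !expr2 in S2 e1 *.
have : k ^+ 2 * S ^+ 2 = k ^+ 2 * (1 + sg ^+ 2) by rewrite !expr2 S2.
rewrite !expr2; nra.
Qed.

Lemma cap_slope_between u v w : 0 <= u <= 2 -> 0 <= v <= 2 -> 0 <= w <= 2 ->
  (u <= v /\ v < w) \/ (v <= u /\ w < v) ->
  let sl := (f v - f w) / (v - w) in
  `|p u - p v| <= `|p u - sl| /\ `|p u - sl| <= `|p u - p w|.
Proof.
move=> u2 v2 w2 [[uv vw]|[uv vw]] sl.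
  have slE : sl * (w - v) = f w - f v.
    by rewrite /sl -(opprB v w) mulrN divfK ?opprB// subr_eq0 lt_eqF.
  have wv0 : 0 < w - v by rewrite subr_gt0.
  have [h1 h2] : p w <= sl /\ sl <= p v.
    rewrite -[p w <= sl](ler_pM2r wv0) -[sl <= p v](ler_pM2r wv0) slE.
    by apply: (cap_slope fp); lra.
  have h3 : p v <= p u by apply: (cap_p_noninc fp); lra.
  by split; rewrite !ger0_norm; lra.
have slE : sl * (v - w) = f v - f w by rewrite /sl divfK// subr_eq0 gt_eqF.
have wv0 : 0 < v - w by rewrite subr_gt0.
have [h1 h2] : p v <= sl /\ sl <= p w.
  rewrite -[p v <= sl](ler_pM2r wv0) -[sl <= p w](ler_pM2r wv0) slE.
  by apply: (cap_slope fp); lra.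
have h3 : p u <= p v by apply: (cap_p_noninc fp); lra.
by split; rewrite !ler0_norm; lra.
Qed.

End Pieces.

Section Arc.
Context {R : realType}.
Variables f p : R -> R.
Hypothesis fp : cap f p.

(** A piece of the graph of f travelled monotonically, in either direction, at
    unit speed. *)
Record graph_arc (g : R -> R * R) (s1 s2 : R) : Prop := GraphArc {
  arc_x : forall t, s1 <= t -> t <= s2 -> 0 <= (g t).1 <= 2;
  arc_y : forall t, s1 <= t -> t <= s2 -> (g t).2 = f (g t).1;
  arc_len : forall a b, s1 <= a -> a <= b -> b <= s2 ->
    curve_length a b g = (b - a)%:E;
  arc_mono : (forall a b, s1 <= a -> a < b -> b <= s2 -> (g a).1 < (g b).1) \/
    (forall a b, s1 <= a -> a < b -> b <= s2 -> (g b).1 < (g a).1) }.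

Variables (g : R -> R * R) (s1 s2 : R).
Hypothesis arc : graph_arc g s1 s2.
Notation x := (fun t => (g t).1).
Notation y := (fun t => (g t).2).

Lemma arc_lip a b : s1 <= a -> a <= b -> b <= s2 -> enorm (g b - g a) <= b - a.
Proof.
move=> sa; rewrite le_eqVlt => /predU1P[<- _|ab bs].
  by rewrite !subrr /enorm /= expr0n addr0 sqrtr0.
by rewrite -lee_fin -(arc_len arc sa (ltW ab) bs); exact: chord_le_curve_length.
Qed.

(** An arc of a concave graph exceeds its chord by at most the variation of
    the slope times the horizontal displacement, since all chords of a
    subdivision have nearly the same direction. *)
Lemma arc_chord a b : s1 <= a -> a < b -> b <= s2 ->
  b - a <= enorm (g b - g a) + `|x b - x a| * `|p (x b) - p (x a)|.
Proof.
move=> sa ab bs.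
have xa2 : 0 <= x a <= 2 by apply: (arc_x arc) => //; lra.
have xb2 : 0 <= x b <= 2 by apply: (arc_x arc) => //; lra.
have ya : y a = f (x a) by apply: (arc_y arc) => //; lra.
have yb : y b = f (x b) by apply: (arc_y arc) => //; lra.
have E al be (c := Num.sqrt (1 + ((f be - f al) / (be - al)) ^+ 2)) : al < be ->
  enorm (be - al, f be - f al) = (be - al) * c.
  move=> albe; have d0 : 0 < be - al by rewrite subr_gt0.
  rewrite /enorm/= /c -[X in X * _]ger0_norm ?(ltW d0)// -sqrtr_sqr -sqrtrM ?sqr_ge0//.
  by congr Num.sqrt; field; rewrite gt_eqF.
have gE c d : s1 <= c -> c <= s2 -> s1 <= d -> d <= s2 ->
   g d - g c = (x d - x c, f (x d) - f (x c)).
  move=> c1 c2 d1 d2; rewrite -(arc_y arc c1 c2) -(arc_y arc d1 d2).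
  by move: (g d) (g c) => [? ?] [? ?].
rewrite -lee_fin -(arc_len arc sa (ltW ab) bs).
case: (arc_mono arc) => mono.
  have xab := mono _ _ sa ab bs.
  have pab : p (x b) <= p (x a) by apply: (cap_p_noninc fp); lra.
  pose c := Num.sqrt (1 + ((f (x b) - f (x a)) / (x b - x a)) ^+ 2) + (p (x a) - p (x b)).
  apply: (@le_trans _ _ (x b * c - x a * c)%:E).
    apply: (@curve_length_le _ a b g (fun t => x t * c)) => u v au uv vb.
    rewrite gE; try lra; rewrite -mulrBl.
    apply: (cap_piece fp); try lra.
    - case: (ltgtP a u) au => // [au _|-> _//]; apply/ltW/mono; lra.
    - by apply/ltW/mono; lra.
    - case: (ltgtP v b) vb => // [vb _|-> _//]; apply/ltW/mono; lra.
  rewrite lee_fin gE; try lra.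
  rewrite E// -mulrBl [`|x b - x a|]gtr0_norm ?subr_gt0//.
  by rewrite distrC ger0_norm ?subr_ge0// /c mulrDr.
have xab := mono _ _ sa ab bs.
have pab : p (x a) <= p (x b) by apply: (cap_p_noninc fp); lra.
pose c := Num.sqrt (1 + ((f (x a) - f (x b)) / (x a - x b)) ^+ 2) + (p (x b) - p (x a)).
apply: (@le_trans _ _ (- x b * c - - x a * c)%:E).
  apply: (@curve_length_le _ a b g (fun t => - x t * c)) => u v au uv vb.
  rewrite -enormN opprB gE; try lra.
  have -> : - x v * c - - x u * c = (x u - x v) * c by ring.
  apply: (cap_piece fp); try lra.
  - case: (ltgtP v b) vb => // [vb _|-> _//]; apply/ltW/mono; lra.
  - by apply/ltW/mono; lra.
  - case: (ltgtP a u) au => // [au _|-> _//]; apply/ltW/mono; lra.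
rewrite lee_fin -enormN opprB gE; try lra.
have -> : - x b * c - - x a * c = (x a - x b) * c by ring.
rewrite E// [`|x b - x a|]distrC [`|x a - x b|]gtr0_norm ?subr_gt0//.
by rewrite ger0_norm ?subr_ge0// /c mulrDr.
Qed.

(** As f is 1-Lipschitz the abscissa controls the arc length; in particular
    tangents are never vertical. *)
Lemma arc_bilip a b : s1 <= a -> a < b -> b <= s2 -> b - a <= 4 * `|x b - x a|.
Proof.
move=> sa ab bs.
have xa2 : 0 <= x a <= 2 by apply: (arc_x arc) => //; lra.
have xb2 : 0 <= x b <= 2 by apply: (arc_x arc) => //; lra.
have ya : y a = f (x a) by apply: (arc_y arc) => //; lra.
have yb : y b = f (x b) by apply: (arc_y arc) => //; lra.
apply: (le_trans (arc_chord sa ab bs)).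
have h1 : enorm (g b - g a) <= 2 * `|x b - x a|.
  rewrite enorm_le ?mulr_ge0//= ya yb.
  have := cap_lip fp xa2 xb2; rewrite -(@ler_pXn2r _ 2%N)// ?nnegrE// !real_normK ?num_real//.
  rewrite exprMn real_normK ?num_real//; have := sqr_ge0 (x b - x a); lra.
have h2 : `|p (x b) - p (x a)| <= 2.
  have := cap_p fp xa2; have := cap_p fp xb2; have := ler_normB (p (x b)) (p (x a)); lra.
have := ler_wpM2l (normr_ge0 (x b - x a)) h2; lra.
Qed.

End Arc.

(** * The curvature of a concave graph *)

Section ArcPoint.
Context {R : realType}.
Variables f p : R -> R.
Hypothesis fp : cap f p.
Variables (g : R -> R * R) (s1 s2 : R).
Hypothesis arc : graph_arc f g s1 s2.
Notation x := (fun t => (g t).1).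
Notation y := (fun t => (g t).2).

Variables (s a1 a2 b1 b2 : R).
Hypotheses (s1s : s1 < s) (ss2 : s < s2).
Hypotheses (jx : jet2 x s a1 b1) (jy : jet2 y s a2 b2).

Lemma near_arc (th : R) : \forall h \near (0:R)^'+, s1 <= s + th * h <= s2.
Proof.
have th1 : 0 < `|th| + 1 by rewrite ltr_wpDl.
pose d := Num.min (s - s1) (s2 - s) / (`|th| + 1).
have d0 : 0 < d by rewrite divr_gt0// lt_min !subr_gt0 s1s.
near=> h.
have h0 : 0 < h by near: h; exact: near_right_gt0.
have hd : h < d by near: h; exact: nbhs_right_lt.
move: hd; rewrite /d ltr_pdivlMr// lt_min => /andP[h1 h2].
have : `|th * h| <= h * (`|th| + 1) by rewrite normrM (gtr0_norm h0); nra.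
rewrite ler_norml => /andP[h3 h4]; apply/andP; split; lra.
Unshelve. all: by end_near. Qed.

Let quotE X th h : 0 < h -> X (s + th * h) - X s = h * quot X s th h.
Proof. by move=> h0; rewrite /quot mulrA divff ?gt_eqF// mul1r. Qed.

Lemma point_x2 : 0 <= x s <= 2.
Proof. by apply: (arc_x arc); apply: ltW. Qed.

Lemma tangent_x_neq0 : a1 != 0.
Proof.
suff : 4^-1 <= `|a1| by apply: contraTneq => ->; rewrite normr0 -ltNge invr_gt0.
have := jet2_quot (th := 1) jx; rewrite mul1r => /cvg_norm /cvgr_to_ge; apply.
near=> h.
have h0 : 0 < h by near: h; exact: near_right_gt0.
have /andP[_ hs2] : s1 <= s + 1 * h <= s2 by near: h; exact: near_arc.
have := @arc_bilip _ _ _ fp _ _ _ arc s (s + 1 * h) (ltW s1s) _ hs2.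
rewrite (quotE x)// normrM (gtr0_norm h0) mul1r => /(_ _)/wrap[]; first by rewrite ltrDl.
have -> : s + h - s = h * 1 by ring.
by rewrite mulrCA ler_pM2l//; lra.
Unshelve. all: by end_near. Qed.

(** The supergradient inequality on the right and on the left of s gives both
    inequalities. *)
Lemma tangent_slope : p (x s) = a2 / a1.
Proof.
have a10 := tangent_x_neq0.
have K th : 0 <= p (x s) * (th * a1) - th * a2.
  have cv : p (x s) * quot x s th h - quot y s th h @[h --> 0^'+] -->
      p (x s) * (th * a1) - th * a2.
    apply: cvgB; last exact: (jet2_quot (th := th) jy).
    by apply: cvgM; [exact: cvg_cst|exact: (jet2_quot (th := th) jx)].
  apply: (cvgr_to_ge cv); near=> h.
  have h0 : 0 < h by near: h; exact: near_right_gt0.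
  have /andP[h1 h2] : s1 <= s + th * h <= s2 by near: h; exact: near_arc.
  have ys : y s = f (x s) by apply: (arc_y arc); exact: ltW.
  have := cap_sg fp point_x2 (arc_x arc h1 h2).
  rewrite -ys -(arc_y arc h1 h2) -(@ler_pM2l _ h)// => H.
  rewrite -(@ler_pM2l _ h)// mulr0 mulrBr mulrCA -!quotE//.
  rewrite ler_pM2l// in H; lra.
have k1 := K 1; have k2 := K (-1).
have E : p (x s) * a1 = a2 by lra.
by rewrite -E mulfK.
Unshelve. all: by end_near. Qed.

(** The expansion controls chords of the curve but not p; p is recovered by
    monotonicity, being squeezed between slopes of chords. *)
Lemma near_slope_between th1 th2 : 0 < th1 -> th1 < th2 ->
  \forall h \near (0:R)^'+,
   let sl := (y (s + th1 * h) - y (s + th2 * h)) / (x (s + th1 * h) - x (s + th2 * h)) in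
   `|p (x s) - p (x (s + th1 * h))| <= `|p (x s) - sl| /\
   `|p (x s) - sl| <= `|p (x s) - p (x (s + th2 * h))|.
Proof.
move=> t1 t12; near=> h.
have h0 : 0 < h by near: h; exact: near_right_gt0.
have /andP[h1 h2] : s1 <= s + th1 * h <= s2 by near: h; exact: near_arc.
have /andP[h3 h4] : s1 <= s + th2 * h <= s2 by near: h; exact: near_arc.
rewrite /= !(arc_y arc)//; apply: (cap_slope_between fp point_x2 (arc_x arc _ _) (arc_x arc _ _)) => //.
have k1 : s < s + th1 * h by rewrite ltrDl mulr_gt0.
have k2 : s + th1 * h < s + th2 * h by rewrite ltrD2l ltr_pM2r.
case: (arc_mono arc) => mono; [left|right]; split; try (apply: ltW); apply: mono => //; exact: ltW.
Unshelve. all: by end_near. Qed.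

(** The value of p at parameter s + h is squeezed between p (x s) and the
    slope of the chord from h to 2 h, which tends to the slope of the tangent. *)
Lemma supergradient_cvg : p (x (s + h)) @[h --> (0:R)^'+] --> p (x s).
Proof.
have a10 := tangent_x_neq0.
have c12 : (1 : R) != 2 by rewrite lt_eqF// ltr1n.
have := jet2_slope jx jy a10 c12; set L := (1 + 2) / 2 * _ / _; set q := (X in X @ _) => cq.
have cq' : h * q h @[h --> 0^'+] --> (0 : R).
  rewrite -[X in _ --> X](mul0r L).
  by apply: cvgM; [exact: cvg_right_id|exact: cq].
apply/cvgrPdist_le => e e0; near=> h.
have h0 : 0 < h by near: h; exact: near_right_gt0.
have [H _] : let sl := (y (s + 1 * h) - y (s + 2 * h)) / (x (s + 1 * h) - x (s + 2 * h)) in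
   `|p (x s) - p (x (s + 1 * h))| <= `|p (x s) - sl| /\
   `|p (x s) - sl| <= `|p (x s) - p (x (s + 2 * h))|.
  by near: h; apply: near_slope_between => //; rewrite ltr1n.
rewrite !mul1r in H; apply: (le_trans H); rewrite tangent_slope distrC.
have -> : (y (s + h) - y (s + 2 * h)) / (x (s + h) - x (s + 2 * h)) - a2 / a1 = h * q h.
  by rewrite /q mulrA divff ?gt_eqF// !mul1r.
have : `|h * q h| < e.
  by near: h; move/cvgr0Pnorm_lt : cq' => /(_ _ e0).
exact: ltW.
Unshelve. all: by end_near. Qed.

Let lipq th : th = 1 \/ th = -1 -> \forall h \near (0:R)^'+,
  quot x s th h ^+ 2 + quot y s th h ^+ 2 <= 1.
Proof.
move=> th1; near=> h.
have h0 : 0 < h by near: h; exact: near_right_gt0.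
have /andP[h1 h2] : s1 <= s + th * h <= s2 by near: h; exact: near_arc.
have : enorm (g (s + th * h) - g s) <= h.
  case: th1 h1 h2 => ->; rewrite ?mul1r ?mulN1r => h1 h2.
    by apply: le_trans (arc_lip arc _ _ _) _; rewrite ?(ltW s1s)//; lra.
  by rewrite -enormN opprB; apply: le_trans (arc_lip arc _ _ _) _; rewrite ?(ltW ss2)//; lra.
rewrite enorm_le ?(ltW h0)//= (quotE x)// (quotE y)// !exprMn -mulrDr.
by rewrite -[leRHS]mulr1 ler_pM2l// exprn_gt0.
Unshelve. all: by end_near. Qed.

(** By arc_chord and supergradient_cvg, short chords are asymptotically as
    long as the arcs. *)
Lemma unit_tangent : a1 ^+ 2 + a2 ^+ 2 = 1.
Proof.
have cq : quot x s 1 h ^+ 2 + quot y s 1 h ^+ 2 @[h --> 0^'+] --> a1 ^+ 2 + a2 ^+ 2.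
  have := jet2_quot (th := 1) jx; have := jet2_quot (th := 1) jy; rewrite !mul1r => cy cx.
  by apply: cvgD; rewrite expr2; under eq_fun do rewrite expr2; exact: cvgM.
have u1 : a1 ^+ 2 + a2 ^+ 2 <= 1.
  by apply: (cvgr_to_le cq); apply: lipq; left.
suff l1 : 1 <= Num.sqrt (a1 ^+ 2 + a2 ^+ 2).
  apply/eqP; rewrite eq_le u1/=.
  by rewrite -(@ler_sqrt _ 1) ?sqrtr1// addr_ge0// sqr_ge0.
have cs : Num.sqrt (quot x s 1 h ^+ 2 + quot y s 1 h ^+ 2) +
    `|quot x s 1 h| * `|p (x (s + h)) - p (x s)| @[h --> 0^'+] -->
    Num.sqrt (a1 ^+ 2 + a2 ^+ 2) + `|1 * a1| * `|p (x s) - p (x s)|.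
  apply: cvgD; first exact: (continuous_cvg _ (@sqrt_continuous R _) cq).
  apply: cvgM; first by apply: cvg_norm; exact: (jet2_quot (th := 1) jx).
  by apply: cvg_norm; apply: cvgB; [exact: supergradient_cvg|exact: cvg_cst].
rewrite subrr normr0 mulr0 addr0 in cs.
apply: (cvgr_to_ge cs); near=> h.
have h0 : 0 < h by near: h; exact: near_right_gt0.
have /andP[_ hs2] : s1 <= s + 1 * h <= s2 by near: h; exact: near_arc.
have := @arc_chord _ _ _ fp _ _ _ arc s (s + 1 * h) (ltW s1s) _ hs2.
rewrite /enorm/= (quotE x)// (quotE y)// !mul1r => /(_ _)/wrap[]; first by rewrite ltrDl.
rewrite !exprMn -mulrDr sqrtrM ?sqr_ge0// sqrtr_sqr normrM (gtr0_norm h0).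
move=> H; rewrite -(ler_pM2l h0) mulrDr [X in _ + X]mulrA.
by apply: le_trans H; lra.
Unshelve. all: by end_near. Qed.

(** The chords from s to s + h and to s - h have length at most h. As the
    tangent is unit, the second-order term of their squared length has the
    sign of the inner product on one side and the opposite sign on the other,
    and is nonpositive on both. *)
Lemma normal_orthogonal : a1 * b1 + a2 * b2 = 0.
Proof.
have u := unit_tangent.
pose e X a th h := h^-1 * (quot X s th h - th * a).
have K th : th = 1 \/ th = -1 -> th * (a1 * b1 + a2 * b2) <= 0.
  move=> th1; have th2 : th ^+ 2 = 1 by case: th1 => ->; rewrite ?sqrrN expr1n.
  have c X a b : jet2 X s a b ->
     e X a th h * (quot X s th h + th * a) @[h --> 0^'+] --> th * (a * b).
    move=> j.
    have -> : th * (a * b) = th ^+ 2 / 2 * b * (th * a + th * a) by rewrite th2; field.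
    apply: cvgM; first exact: jet2_quot2.
    by apply: cvgD; [exact: jet2_quot j|exact: cvg_cst].
  rewrite mulrDr.
  apply: (cvgr_to_le (cvgD (c _ _ _ jx) (c _ _ _ jy))); near=> h.
  have h0 : 0 < h by near: h; exact: near_right_gt0.
  have l : quot x s th h ^+ 2 + quot y s th h ^+ 2 <= 1 by near: h; exact: lipq.
  rewrite [leLHS](_ : _ = h^-1 * ((quot x s th h ^+ 2 + quot y s th h ^+ 2) -
      th ^+ 2 * (a1 ^+ 2 + a2 ^+ 2))); last first.
    by rewrite fctE /e; ring.
  by rewrite th2 u mul1r pmulr_rle0 ?invr_gt0// subr_le0.
by have := K 1 (or_introl erefl); have := K (-1) (or_intror erefl); lra.
Unshelve. all: by end_near. Qed.

(** Identity of Lagrange: for a unit T and an orthogonal N the norm of N is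
    the absolute value of their determinant, which is what governs the
    variation of the slope. *)
Lemma curvature_det : enorm (b1, b2) = `|a1 * b2 - a2 * b1|.
Proof.
rewrite /enorm /= -sqrtr_sqr; congr Num.sqrt.
have u := unit_tangent; have o := normal_orthogonal.
rewrite -[LHS]mul1r -u.
have -> : (a1 * b2 - a2 * b1) ^+ 2 =
 (a1 ^+ 2 + a2 ^+ 2) * (b1 ^+ 2 + b2 ^+ 2) - (a1 * b1 + a2 * b2) ^+ 2 by ring.
by rewrite o expr0n subr0.
Qed.

(** The variation of p from s to s + h is at least that of the slope of the
    chord between (1 - de) h and h, which jet2_slope evaluates as (1 - de / 2)
    times the expected value. *)
Lemma supergradient_slope e : 0 < e -> \forall h \near (0:R)^'+,
  (`|a1 * b2 - a2 * b1| / a1 ^+ 2 - e) * h <= `|p (x (s + h)) - p (x s)|.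
Proof.
move=> e0; have a10 := tangent_x_neq0.
set k := _ / a1 ^+ 2.
have k0 : 0 <= k by rewrite divr_ge0// sqr_ge0.
pose de := Num.min (1/2) (e / (k + 1)).
have de0 : 0 < de by rewrite lt_min divr_gt0//= divr_gt0// ltr_wpDl.
have de1 : de < 1 by rewrite gt_min; apply/orP; left; lra.
have dek : de * k < e.
  apply: (@le_lt_trans _ _ (e / (k + 1) * k)).
    by rewrite ler_wpM2r// ge_min lexx orbT.
  by rewrite mulrAC ltr_pdivrMr ?ltr_wpDl//; nra.
pose th := 1 - de.
have th1 : (th : R) != 1 by rewrite /th lt_eqF//; lra.
have := jet2_slope jx jy a10 th1; set L := (th + 1) / 2 * _ / _; set q := (X in X @ _) => cq.
have L1 : k - e < `|L|.
  have -> : `|L| = (th + 1) / 2 * k.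
    by rewrite /L /k normrM [`|_ * (_ - _)|]normrM normfV ger0_norm ?(ger0_norm (sqr_ge0 a1)) ?mulrA// /th; lra.
  by rewrite /th; nra.
near=> h.
have h0 : 0 < h by near: h; exact: near_right_gt0.
have : k - e < `|q h|.
  by near: h; exact: (cvgr_gt _ (cvg_norm cq)).
have [_ H] : let sl := (y (s + th * h) - y (s + 1 * h)) / (x (s + th * h) - x (s + 1 * h)) in
   `|p (x s) - p (x (s + th * h))| <= `|p (x s) - sl| /\
   `|p (x s) - sl| <= `|p (x s) - p (x (s + 1 * h))|.
  by near: h; apply: near_slope_between => //; rewrite /th; lra.
rewrite !mul1r tangent_slope in H *; move=> qh.
rewrite [leRHS]distrC; apply: le_trans H.
rewrite distrC.
have -> : (y (s + th * h) - y (s + h)) / (x (s + th * h) - x (s + h)) - a2 / a1 = h * q h.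
  by rewrite /q mulrA divff ?gt_eqF// !mul1r.
by rewrite normrM (gtr0_norm h0) mulrC ler_pM2l// ltW.
Unshelve. all: by end_near. Qed.

End ArcPoint.

(** * Calibrations of the affine length *)

Section Calibration.
Context {R : realType}.

(** Inequality between the arithmetic and geometric means of A, A and B. *)
Lemma cube_root_le (k A B : R) : 0 <= k -> 0 <= A -> 0 <= B -> k <= A ^+ 2 * B ->
  k `^ 3^-1 <= 2 / 3 * A + 1 / 3 * B.
Proof.
move=> k0 A0 B0 kAB.
set Z := 2 / 3 * A + 1 / 3 * B.
have Z0 : 0 <= Z by rewrite /Z; lra.
have ZE : A ^+ 2 * B <= Z ^+ 3.
  rewrite -subr_ge0.
  have -> : Z ^+ 3 - A ^+ 2 * B = (A - B) ^+ 2 * (8 * A + B) / 27 by rewrite /Z; field.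
  by rewrite divr_ge0// mulr_ge0 ?sqr_ge0//; lra.
have -> : Z = (Z ^+ 3) `^ 3^-1.
  by rewrite -powR_mulrn// -powRrM divff ?powRr1// pnatr_eq0.
by apply: ge0_ler_powR; rewrite ?invr_ge0 ?nnegrE ?exprn_ge0//; exact: le_trans ZE.
Qed.

(** Near x the variation of F dominates 2 / 3 v |dx| + 1 / 3 u |dp|. Since v
    ^+ 2 * u >= 1 this is at least the affine length element |dp|^(1/3)
    |dx|^(2/3), by cube_root_le. *)
Definition calibrates (p F : R -> R) (x : R) := exists u v : R,
  [/\ 0 < u, 0 < v, 1 <= v ^+ 2 * u & forall e : R, 0 < e -> exists2 d : R, 0 < d &
    forall z : R, 0 <= z <= 2 -> `|z - x| < d ->
      2 / 3 * (v - e) * `|z - x| + 1 / 3 * (u - e) * `|p z - p x| <= `|F z - F x| ].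

Variables f p : R -> R.
Hypothesis fp : cap f p.

Lemma curvature_cases (g : R -> R * R) s :
  curvature g s = 0 \/ exists T N, second_order_expansion g s T N /\
    curvature g s = enorm N.
Proof.
rewrite /curvature; set S := [set N | _].
have [[N SN]|S0] := pselect (exists N, S N).
  right; have [T HT] := xgetPex 0 (ex_intro _ N SN).
  by exists T, (xget 0 S).
left; rewrite xgetPN; last by move=> N SN; apply: S0; exists N.
by rewrite /enorm /= expr0n addr0 sqrtr0.
Qed.

(** In terms of the arc length h, with tangent (a1, a2) and curvature kap, the
    abscissa varies by |a1| h and p by at least kap / a1 ^+ 2 * h. The product
    (v |a1|) ^+ 2 * (u kap / a1 ^+ 2) does not depend on a1 and is at least
    kap. *)
Lemma arc_calibrated (g : R -> R * R) s1 s2 s F : graph_arc f g s1 s2 ->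
  s1 < s -> s < s2 -> calibrates p F (g s).1 ->
  forall e, 0 < e -> exists2 d, 0 < d & forall h, 0 < h -> h < d ->
    h * (curvature g s `^ 3^-1 - e) <= `|F (g (s + h)).1 - F (g s).1|.
Proof.
move=> arc s1s ss2 [u [v [u0 v0 vu HF]]] e e0.
have [->|[T [N [TN ->]]]] := curvature_cases g s.
  exists 1 => // h h0 _; rewrite powR0 ?invr_eq0 ?pnatr_eq0// sub0r.
  by apply: (@le_trans _ _ 0) => //; rewrite mulrN oppr_le0 mulr_ge0// ltW.
have [jx jy] := (second_order_expansionP g s T N).1 TN.
set a1 := T.1 in jx; set a2 := T.2 in jy; set b1 := N.1 in jx; set b2 := N.2 in jy.
have a10 : a1 != 0 := tangent_x_neq0 fp arc s1s ss2 jx.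
have kE : enorm N = `|a1 * b2 - a2 * b1|.
  by rewrite -(curvature_det fp arc s1s ss2 jx jy).
set kap := enorm N in kE *.
have kap0 : 0 <= kap by rewrite kE.
pose t := `|a1|; pose k := kap / a1 ^+ 2.
have t0 : 0 < t by rewrite normr_gt0.
have k0 : 0 <= k by rewrite divr_ge0// sqr_ge0.
have AG : kap `^ 3^-1 <= 2 / 3 * (v * t) + 1 / 3 * (u * k).
  apply: cube_root_le; [exact: kap0|exact: mulr_ge0 (ltW v0) (ltW t0)|exact: mulr_ge0 (ltW u0) k0|].
  have -> : (v * t) ^+ 2 * (u * k) = v ^+ 2 * u * kap.
    by rewrite /k exprMn /t real_normK ?num_real//; field.
  by rewrite -[leLHS]mul1r ler_wpM2r.
(* Each of u, v, t, k is replaced by an approximation within e1; C bounds the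
   resulting loss divided by e1. *)
pose C := 2 / 3 * (v + t) + 1 / 3 * (u * (k + 1) + k) + 1.
have C0 : 0 < C.
  have : 0 <= u * (k + 1) by rewrite mulr_ge0// ?ltW// ltr_wpDl.
  by rewrite /C; lra.
pose e1 := Num.min (Num.min u v) (Num.min t (e / C)) / 2.
have e10 : 0 < e1 by rewrite divr_gt0// !lt_min u0 v0 t0 divr_gt0.
have : e1 * 2 = Num.min (Num.min u v) (Num.min t (e / C)) by rewrite /e1 divfK ?pnatr_eq0.
move=> e1E.
have [e1u e1v e1t e1e] : [/\ e1 < u, e1 < v, e1 < t & e1 < e / C].
  have : e1 < e1 * 2 by lra.
  by rewrite e1E !lt_min => /andP[/andP[-> ->] /andP[-> ->]].
have {}e1e : e1 * C < e by rewrite -ltr_pdivlMr.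
have [d d0 Hd] := HF _ e10.
have key : \forall h \near (0:R)^'+,
    h * (kap `^ 3^-1 - e) <= `|F (g (s + h)).1 - F (g s).1|.
  have qx : `|quot (fun t => (g t).1) s 1 h| @[h --> 0^'+] --> t.
    by rewrite /t -[a1]mul1r; apply: cvg_norm; exact: (jet2_quot jx).
  near=> h.
  have h0 : 0 < h by near: h; exact: near_right_gt0.
  have /andP[hs1 hs2] : s1 <= s + 1 * h <= s2 by near: h; exact: near_arc.
  have q1 : t - e1 < `|quot (fun t => (g t).1) s 1 h|.
    by near: h; apply: (cvgr_gt _ qx); rewrite ltrBlDr ltrDl.
  have q2 : `|quot (fun t => (g t).1) s 1 h| < t + 1.
    by near: h; apply: (cvgr_lt _ qx); rewrite ltrDl.
  have q3 : (k - e1) * h <= `|p (g (s + h)).1 - p (g s).1|.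
    rewrite /k kE; near: h.
    exact: (supergradient_slope fp arc s1s ss2 jx jy).
  have dx : `|(g (s + h)).1 - (g s).1| = h * `|quot (fun t => (g t).1) s 1 h|.
    by rewrite /quot mul1r normrM gtr0_norm ?invr_gt0// mulrA divff ?gt_eqF// mul1r.
  have hd : `|(g (s + h)).1 - (g s).1| < d.
    rewrite dx; apply: (@lt_le_trans _ _ (h * (t + 1))); first by rewrite ltr_pM2l.
    rewrite -ler_pdivlMr; last exact: addr_gt0.
    near: h; apply: nbhs_right_le; exact: divr_gt0 d0 (addr_gt0 t0 ltr01).
  have hs1' : s1 <= s + h by move: hs1; rewrite mul1r.
  have hs2' : s + h <= s2 by move: hs2; rewrite mul1r.
  apply: le_trans (Hd _ (arc_x arc hs1' hs2') hd).
  rewrite dx.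
  have r1 : (v - e1) * (t - e1) * h <= (v - e1) * (h * `|quot (fun t => (g t).1) s 1 h|).
    rewrite -mulrA ler_pM2l ?subr_gt0// mulrC ler_pM2l// ltW//.
  have r2 : (u - e1) * ((k - e1) * h) <= (u - e1) * `|p (g (s + h)).1 - p (g s).1|.
    by rewrite ler_pM2l// subr_gt0.
  apply: (@le_trans _ _ (2 / 3 * ((v - e1) * (t - e1) * h) + 1 / 3 * ((u - e1) * ((k - e1) * h)))); last lra.
  have -> : 2 / 3 * ((v - e1) * (t - e1) * h) + 1 / 3 * ((u - e1) * ((k - e1) * h))
    = h * (2 / 3 * ((v - e1) * (t - e1)) + 1 / 3 * ((u - e1) * (k - e1))) by ring.
  rewrite ler_pM2l//.
  have : e1 * C = 2 / 3 * (e1 * (v + t)) + 1 / 3 * (e1 * (u * (k + 1) + k)) + e1 by rewrite /C; ring.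
  have : 0 <= e1 * (u * k) by exact: mulr_ge0 (ltW e10) (mulr_ge0 (ltW u0) k0).
  have : 0 < e1 ^+ 2 by rewrite exprn_gt0.
  rewrite expr2; lra.
move: key => /= [r r0 Hr].
exists r => // h h0 hr; apply: Hr => //=.
by rewrite sub0r normrN gtr0_norm.
Unshelve. all: by end_near. Qed.

(** The abscissa P, at which F may have a kink, is met at a single parameter
    sP, the only exceptional one. *)
Lemma arc_majorized (g : R -> R * R) s1 s2 (P : R) F : graph_arc f g s1 s2 ->
  s1 < s2 ->
  {in `[0, 2] &, nondecreasing_fun F} ->
  (forall z, 0 < z < 2 -> z != P -> calibrates p F z) ->
  majorized (fun s => curvature g s `^ 3^-1) s1 s2 `|F (g s2).1 - F (g s1).1|.
Proof.
move=> arc s12 Fnd calF.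
pose sP := xget 0 [set s | s1 <= s <= s2 /\ (g s).1 = P].
have inj s : s1 <= s -> s <= s2 -> (g s).1 = P -> s = sP.
  move=> h1 h2 gs; have : [set s | s1 <= s <= s2 /\ (g s).1 = P] sP.
    by apply: (xgetPex 0); exists s; split => //; rewrite h1 h2.
  move=> [/andP[k1 k2]]; rewrite -gs => E.
  case: (arc_mono arc) => mono; apply/eqP; case: ltgtP => // lt.
  - by have := mono _ _ h1 lt k2; rewrite E ltxx.
  - by have := mono _ _ k1 lt h2; rewrite E ltxx.
  - by have := mono _ _ h1 lt k2; rewrite E ltxx.
  - by have := mono _ _ k1 lt h2; rewrite E ltxx.
have x01 s : s1 <= s -> s <= s2 -> (g s).1 \in `[0, 2].
  by move=> h1 h2; rewrite in_itv/=; exact: (arc_x arc).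
have cal s : s1 < s -> s < s2 -> s != sP -> calibrates p F (g s).1.
  move=> h1 h2 sP'; apply: calF; last first.
    by apply: contra_neq sP' => /inj; apply; exact: ltW.
  have /andP[y1 y2] := arc_x arc (lexx _) (ltW s12).
  have /andP[z1 z2] := arc_x arc (ltW s12) (lexx _).
  case: (arc_mono arc) => mono.
    have := mono _ _ (lexx _) h1 (ltW h2); have := mono _ _ (ltW h1) h2 (lexx _); lra.
  have := mono _ _ (lexx _) h1 (ltW h2); have := mono _ _ (ltW h1) h2 (lexx _); lra.
case: (arc_mono arc) => mono.
  exists (F \o (fun s => (g s).1)), [:: sP]; split => //=.
  - move=> a b; rewrite !in_itv/= => /andP[a1 a2] /andP[b1 b2] ab.
    apply: Fnd; rewrite ?x01//.
    by have [->//|nab] := eqVneq a b; apply/ltW/mono => //; rewrite lt_neqAle nab.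
  - exact: ler_norm.
  move=> s; rewrite in_itv/= inE => /andP[h1 h2] ns e e0.
  have [d d0 Hd] := arc_calibrated arc h1 h2 (cal _ h1 h2 ns) e0.
  exists (Num.min d (s2 - s)); first by rewrite lt_min d0 subr_gt0.
  move=> h h0; rewrite lt_min => /andP[hd hs]; apply: (le_trans (Hd _ h0 hd)).
  rewrite ger0_norm// subr_ge0; apply: Fnd; rewrite ?x01//; try lra.
  by apply/ltW/mono; lra.
exists (fun s => - F (g s).1), [:: sP]; split => //=.
- move=> a b; rewrite !in_itv/= => /andP[a1 a2] /andP[b1 b2] ab; rewrite lerN2.
  apply: Fnd; rewrite ?x01//.
  by have [->//|nab] := eqVneq a b; apply/ltW/mono => //; rewrite lt_neqAle nab.
- by rewrite distrC; apply: le_trans (ler_norm _); lra.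
move=> s; rewrite in_itv/= inE => /andP[h1 h2] ns e e0.
have [d d0 Hd] := arc_calibrated arc h1 h2 (cal _ h1 h2 ns) e0.
exists (Num.min d (s2 - s)); first by rewrite lt_min d0 subr_gt0.
move=> h h0; rewrite lt_min => /andP[hd hs]; apply: (le_trans (Hd _ h0 hd)).
rewrite ler0_norm ?opprB ?opprK; first by rewrite addrC.
rewrite subr_le0; apply: Fnd; rewrite ?x01//; try lra.
by apply/ltW/mono; lra.
Qed.

End Calibration.

Lemma cap0 {R : realType} : cap (fun=> 0 : R) (fun=> 0).
Proof. by split => *; rewrite ?mul0r ?addr0 ?normr0. Qed.

(** On a segment the second-order term vanishes: its component along the
    segment by normal_orthogonal, the other one because the ordinate is
    constant. *)
Lemma flat_majorized {R : realType} (g : R -> R * R) s1 s2 :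
  graph_arc (fun=> 0) g s1 s2 ->
  majorized (fun s => curvature g s `^ 3^-1) s1 s2 0.
Proof.
move=> arc; exists (fun=> 0), [::]; split => [//||s]; first by rewrite /= subrr.
rewrite in_itv/= => /andP[s1s ss2] _.
suff -> : curvature g s = 0.
  move=> e e0; exists 1 => // h h0 _; rewrite powR0 ?invr_eq0 ?pnatr_eq0//.
  by rewrite subrr sub0r mulrN oppr_le0 mulr_ge0// ltW.
have [->//|[T [N [TN ->]]]] := curvature_cases g s.
have [jx jy] := (second_order_expansionP g s T N).1 TN.
have := curvature_det cap0 arc s1s ss2 jx jy; rewrite -surjective_pairing => ->.
have := tangent_slope cap0 arc s1s ss2 jx jy => /= E.
have a10 := tangent_x_neq0 cap0 arc s1s ss2 jx.
have T2 : T.2 = 0.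
  by move/esym/eqP : E; rewrite mulf_eq0 invr_eq0 (negbTE a10) orbF => /eqP.
have := normal_orthogonal cap0 arc s1s ss2 jx jy; rewrite T2 mul0r addr0.
move=> /eqP; rewrite mulf_eq0 (negbTE a10)/= => /eqP N1.
have N2 : 1 / 2 * N.2 = 0.
  have := jet2_quot2 (th := 1) jy; rewrite expr1n; set q := (X in X @ _) => cv.
  have cv0 : q h @[h --> 0^'+] --> (0 : R).
    apply: cvg_near_cst; near=> h.
    have /andP[h1 h2] : s1 <= s + 1 * h <= s2 by near: h; exact: near_arc.
    by rewrite /q /quot (arc_y arc h1 h2) (arc_y arc (ltW s1s) (ltW ss2)) T2; ring.
  by apply: cvg_unique cv cv0.
have -> : N.2 = 0 by lra.
by rewrite mulr0 mul0r subrr normr0.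
Unshelve. all: by end_near. Qed.

(** * Hypographs and their boundaries *)

Section Hypograph.
Context {R : realType}.

Definition hypograph (f : R -> R) : set (R * R) :=
  [set q | 0 <= q.1 <= 2 /\ 0 <= q.2 <= f q.1].

Lemma interiorP (K : set (R * R)) q :
  interior K q <-> exists2 e, 0 < e & forall k, `|q.1 - k.1| < e -> `|q.2 - k.2| < e -> K k.
Proof.
rewrite /interior; split.
  by move=> /nbhs_ballP[e /= e0 H]; exists e => // k k1 k2; apply: H.
by move=> [e e0 H]; apply/nbhs_ballP; exists e => // k [k1 k2]; exact: H.
Qed.

Lemma closureP (K : set (R * R)) q : closure K q ->
  forall e, 0 < e -> exists k, [/\ K k, `|q.1 - k.1| < e & `|q.2 - k.2| < e].
Proof.
move=> cq e e0; have [k [Kk [k1 k2]]] := cq _ (nbhsx_ballx q _ e0).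
by exists k.
Qed.

Variable f : R -> R.
Hypothesis flip : forall u v, 0 <= u <= 2 -> 0 <= v <= 2 -> `|f v - f u| <= `|v - u|.

Lemma closure_hypograph : closure (hypograph f) = hypograph f.
Proof.
apply/seteqP; split; last exact: subset_closure.
move=> q /closureP cq.
have q1 : 0 <= q.1 <= 2.
  apply/andP; split; apply/ler_addgt0Pr => e e0;
    have [k [[/andP[a b] _]]] := cq _ e0; rewrite ltr_norml => /andP[c d] _; lra.
split => //; apply/andP; split; apply/ler_addgt0Pr => e e0.
  by have [k [[_ /andP[a b]] _]] := cq _ e0; rewrite ltr_norml => /andP[c d]; lra.
have [|k [[k2 /andP[a b]]]] := cq (e / 2); first by rewrite divr_gt0.
move=> k1; rewrite ltr_norml => /andP[c d].
have := flip k2 q1; have := ler_norm (f k.1 - f q.1); rewrite distrC; lra.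
Qed.

Hypotheses (f0 : f 0 = 0) (f2 : f 2 = 0) (fpos : forall z, 0 < z < 2 -> 0 < f z).

Lemma hypograph_f_ge0 z : 0 <= z <= 2 -> 0 <= f z.
Proof.
move=> /andP[]; rewrite le_eqVlt => /predU1P[<- _|z0]; first by rewrite f0.
rewrite le_eqVlt => /predU1P[->|z2]; first by rewrite f2.
by rewrite ltW// fpos// z0.
Qed.

Lemma boundary_hypograph : boundary (hypograph f) =
  [set q | 0 <= q.1 <= 2 /\ (q.2 = 0 \/ q.2 = f q.1)].
Proof.
rewrite /boundary closure_hypograph; apply/seteqP; split => q /=.
  move=> [[/andP[q1 q1'] /andP[q2 q2']] nq]; split; first by rewrite q1.
  have [?|n0] := pselect (q.2 = 0); first by left.
  have [?|nf] := pselect (q.2 = f q.1); first by right.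
  exfalso; apply: nq.
  have p0 : 0 < q.2 by rewrite lt_neqAle q2 andbT eq_sym; exact/eqP.
  have pf : q.2 < f q.1 by rewrite lt_neqAle q2' andbT; exact/eqP.
  have x0 : 0 < q.1.
    by rewrite lt_neqAle q1 andbT; apply: contraTneq pf => <-; rewrite f0 -leNgt.
  have x2 : q.1 < 2.
    by rewrite lt_neqAle q1' andbT; apply: contraTneq pf => ->; rewrite f2 -leNgt.
  apply/interiorP.
  pose e := Num.min (Num.min q.1 (2 - q.1)) (Num.min q.2 ((f q.1 - q.2) / 2)).
  exists e; first by rewrite !lt_min p0 x0 subr_gt0 x2 divr_gt0// subr_gt0.
  move=> k; rewrite !lt_min => /andP[/andP[h1 h2] /andP[_ h3]] /andP[_ /andP[h4 h5]].
  move: (h1) (h2) (h3) (h4) (h5); rewrite !ltr_norml.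
  move=> /andP[a1 a2] /andP[a3 a4] /andP[a5 a6] /andP[a7 a8] /andP[a9 a10].
  have k1 : 0 <= k.1 <= 2 by apply/andP; split; lra.
  split => //; apply/andP; split; first lra.
  have := flip k1 (_ : 0 <= q.1 <= 2); rewrite q1 q1' => /(_ isT).
  have := ler_norm (f q.1 - f k.1); lra.
move=> [q1 q2]; split.
  split => //; have := hypograph_f_ge0 q1 => p0.
  by case: q2 => ->; rewrite ?lexx ?p0.
move=> /interiorP[e e0 H].
have h : `|e / 2| < e by rewrite gtr0_norm ?divr_gt0//; lra.
case: q2 => q2.
  have [] := H (q.1, q.2 - e / 2).
  - by rewrite subrr normr0.
  - by rewrite opprB addrC subrK.
  by move=> _ /=; rewrite q2; lra.
have [] := H (q.1, q.2 + e / 2).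
- by rewrite subrr normr0.
- by rewrite opprD addrA subrr sub0r normrN.
by move=> _ /=; rewrite q2; lra.
Qed.

End Hypograph.

Section LipschitzWithin.
Context {R : realType}.

Lemma lipschitz_within (D : R -> R) (k a b : R) : 0 <= k -> a <= b ->
  (forall s t, a <= s -> s <= t -> t <= b -> `|D t - D s| <= k * (t - s)) ->
  {within `[a, b], continuous D}.
Proof.
move=> k0 ab lip.
pose cl x := Num.min b (Num.max a x).
have cl_in x : a <= cl x <= b by rewrite le_min ge_min lexx ab le_max lexx.
have cl_id x : a <= x <= b -> cl x = x.
  by move=> /andP[ax xb]; rewrite /cl max_r// min_r.
have cl1 x z : x <= z -> cl x <= cl z /\ cl z - cl x <= z - x.
  move=> xz; rewrite /cl; have [h1|h1] := leP a x; have [h2|h2] := leP a z; try lra;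
  have [h3|h3] := leP b a; try lra; have [h4|h4] := leP b x; have [h5|h5] := leP b z; try lra.
have lip' x z : `|D (cl z) - D (cl x)| <= k * `|z - x|.
  wlog xz : x z / x <= z.
    by move=> H; have [|/ltW] := leP x z; [exact: H|rewrite distrC [`|z - x|]distrC; exact: H].
  have [c1 c2] := cl1 _ _ xz.
  have /andP[i1 i2] := cl_in x; have /andP[i3 i4] := cl_in z.
  apply: (le_trans (lip _ _ i1 c1 i4)); apply: ler_wpM2l => //.
  by rewrite ger0_norm ?subr_ge0.
have ct : continuous (D \o cl).
  move=> x; apply/cvgrPdist_le => e e0; near=> z.
  rewrite /= distrC; apply: (le_trans (lip' x z)).
  have : `|x - z| < e / (k + 1).
    near: z; apply: (@cvgr_dist_lt _ _ _ _ _ id) => //; rewrite divr_gt0// ltr_wpDl//.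
  rewrite ltr_pdivlMr ?ltr_wpDl// distrC => h.
  by apply: le_trans (ltW h); rewrite mulrC; apply: ler_wpM2l => //; lra.
apply: (@subspace_eq_continuous _ _ _ (D \o cl)); last exact: continuous_subspaceT.
by move=> x; rewrite inE/= in_itv/= => /cl_id ->.
Unshelve. all: by end_near. Qed.

Lemma same_sign (D : R -> R) (k a b : R) : 0 <= k -> a <= b ->
  (forall s t, a <= s -> s <= t -> t <= b -> `|D t - D s| <= k * (t - s)) ->
  (forall s, a <= s -> s <= b -> D s != 0) ->
  (0 < D a) = (0 < D b).
Proof.
move=> k0 ab lip D0.
have ct := lipschitz_within k0 ab lip.
have a0 := D0 a (lexx _) ab; have b0 := D0 b ab (lexx _).
apply/idP/idP => h; rewrite lt_neqAle eq_sym ?a0 ?b0/= leNgt; apply/negP => h'.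
  have [|c] := @IVT _ D a b 0 ab ct; rewrite ?in_itv/=.
    by rewrite ge_min le_max (ltW h) (ltW h') orbT.
  by move=> /andP[c1 c2] Dc; have := D0 c c1 c2; rewrite Dc eqxx.
have [|c] := @IVT _ D a b 0 ab ct; rewrite ?in_itv/=.
  by rewrite ge_min le_max (ltW h) (ltW h') orbT.
by move=> /andP[c1 c2] Dc; have := D0 c c1 c2; rewrite Dc eqxx.
Qed.

End LipschitzWithin.

(** * Arbitrary parametrizations of the boundary *)

Section Loop.
Context {R : realType}.
Notation mu := (@lebesgue_measure R).
Variables f p : R -> R.
Hypothesis fp : cap f p.
Hypotheses (f0 : f 0 = 0) (f2 : f 2 = 0) (fpos : forall z, 0 < z < 2 -> 0 < f z).
Variables (l : R) (g : R -> R * R).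
Hypothesis param : arclength_param (hypograph f) l g.
Notation x := (fun t => (g t).1).
Notation y := (fun t => (g t).2).

Let l0 : 0 < l. Proof. by case: param. Qed.
Let g0l : g 0 = g l. Proof. by case: param. Qed.
Let gimg : g @` `[0, l] = boundary (hypograph f). Proof. by case: param. Qed.
Let glen : forall s t, 0 <= s -> s <= t -> t <= l -> curve_length s t g = (t - s)%:E.
Proof. by case: param. Qed.

Let bE := boundary_hypograph (cap_lip fp) f0 f2 fpos.

Lemma loop_in t : 0 <= t <= l -> 0 <= x t <= 2 /\ (y t = 0 \/ y t = f (x t)).
Proof.
move=> tl; have : boundary (hypograph f) (g t) by rewrite -gimg; exists t.
by rewrite bE.
Qed.

Lemma loop_onto q : 0 <= q.1 <= 2 -> q.2 = 0 \/ q.2 = f q.1 -> exists2 t, 0 <= t < l & g t = q.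
Proof.
move=> q1 q2; have : (g @` `[0, l]) q by rewrite gimg bE.
move=> [t /=]; rewrite in_itv/= => /andP[t0]; rewrite le_eqVlt => /predU1P[->|tl] <-.
  by exists 0; rewrite ?lexx ?l0.
by exists t; rewrite // t0 tl.
Qed.

Lemma loop_inj s t : 0 <= s -> s < t -> t <= l -> g s = g t -> s = 0 /\ t = l.
Proof.
move=> s0 st; rewrite le_eqVlt => /predU1P[tl|tl] E; last first.
  case: param => _ _ inj _ _.
  have := inj s t; rewrite !in_itv/= s0 tl (lt_trans st tl) (ltW (le_lt_trans s0 st)).
  by move=> /(_ isT isT E) ss; rewrite ss ltxx in st.
split => //; case: param => _ _ inj _ _; apply: inj; rewrite ?in_itv/= ?s0 ?lexx ?l0//.
  by rewrite -tl.
by rewrite E tl g0l.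
Qed.

Lemma loop_lip s t : 0 <= s -> s <= t -> t <= l -> enorm (g t - g s) <= t - s.
Proof.
move=> s0; rewrite le_eqVlt => /predU1P[<- _|st tl].
  by rewrite !subrr /enorm /= expr0n addr0 sqrtr0.
by rewrite -lee_fin -(glen s0 (ltW st) tl); exact: chord_le_curve_length.
Qed.

Lemma loop_lip_coord s t : 0 <= s -> s <= t -> t <= l ->
  `|x t - x s| <= t - s /\ `|y t - y s| <= t - s.
Proof.
move=> s0 st tl; have := loop_lip s0 st tl.
have st0 : 0 <= t - s by rewrite subr_ge0.
rewrite enorm_le//= => h.
split; rewrite -(@ler_pXn2r _ 2%N)// ?nnegrE// real_normK ?num_real//; apply: le_trans h.
  by rewrite lerDl sqr_ge0.
by rewrite lerDr sqr_ge0.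
Qed.

(** A piece of the loop lying on a graph is travelled monotonically, since its
    abscissa is continuous and injective. *)
Lemma loop_arc (h : R -> R) u v : 0 <= u -> u < v -> v <= l -> ~ (u = 0 /\ v = l) ->
  (forall t, u <= t -> t <= v -> y t = h (x t)) -> graph_arc h g u v.
Proof.
move=> u0 uv vl nuv yh.
have tl t : u <= t -> t <= v -> 0 <= t <= l by move=> ut tv; lra.
have inj : {in `[u, v] &, injective x}.
  move=> s t; rewrite !in_itv/= => /andP[s1 s2] /andP[t1 t2] E.
  have gE : g s = g t.
    rewrite (surjective_pairing (g s)) (surjective_pairing (g t)) E.
    by congr pair; rewrite !yh// E.
  have [//|st] := eqVneq s t.
  wlog lst : s t s1 s2 t1 t2 {E st} gE / s < t.
    move=> H; case: (ltgtP s t) st => // st _; first exact: (H s t).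
    by apply/esym; apply: (H t s).
  have s0 : 0 <= s := le_trans u0 s1; have tl' : t <= l := le_trans t2 vl.
  have [e1 e2] := loop_inj s0 lst tl' gE.
  by exfalso; apply: nuv; split; lra.
split => [t t1 t2|t t1 t2|a b a1 ab b2|].
- by have [] := loop_in (tl t t1 t2).
- exact: yh.
- by apply: glen; lra.
have ct : {within `[u, v], continuous x}.
  apply: (@lipschitz_within _ x 1) => //; first exact: ltW.
  move=> s t h1 h2 h3; rewrite mul1r; have [//||//] := @loop_lip_coord s t _ h2; lra.
have [mo|mo] := itv_continuous_inj_mono ct inj; [left|right] => a b a1 ab b2;
  apply: mo => //; rewrite in_itv/=; lra.
Qed.

(* Away from the two corners D vanishes nowhere; its sign tells the graph of f
   from the base. *)
Let D t := y t - f (x t) / 2.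

Let D_lip s t : 0 <= s -> s <= t -> t <= l -> `|D t - D s| <= 2 * (t - s).
Proof.
move=> s0 st tl; have [h1 h2] := loop_lip_coord s0 st tl.
have := cap_lip fp (loop_in (_ : 0 <= s <= l)).1 (loop_in (_ : 0 <= t <= l)).1.
move=> /(_ _ _)/wrap[]; [lra|lra|] => h3.
have -> : D t - D s = (y t - y s) - (f (x t) - f (x s)) / 2 by rewrite /D; lra.
apply: (le_trans (ler_normB _ _)); rewrite normrM [`|2^-1|]gtr0_norm ?invr_gt0//; lra.
Qed.

Let good t := g t <> (0, 0) /\ g t <> (2, 0).

Let good_cases t : 0 <= t <= l -> good t -> [/\ D t != 0, 0 < D t -> y t = f (x t) &
  ~~ (0 < D t) -> y t = 0].
Proof.
move=> tl [n0 n2]; have [/andP[x0 x2] yE] := loop_in tl.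
have {}x0 : 0 < x t.
  rewrite lt_neqAle x0 andbT; apply/eqP => xt; apply: n0.
  by rewrite (surjective_pairing (g t)) -xt; case: yE => ->; rewrite -?xt ?f0.
have {}x2 : x t < 2.
  rewrite lt_neqAle x2 andbT; apply/eqP => xt; apply: n2.
  by rewrite (surjective_pairing (g t)) xt; case: yE => ->; rewrite ?xt ?f2.
have := fpos (_ : 0 < x t < 2); rewrite x0 x2 => /(_ isT) fx.
case: yE => yE; rewrite /D yE; split => //; try lra.
Qed.

Let D_same u v : 0 <= u -> u <= v -> v <= l -> (forall t, u <= t -> t <= v -> good t) ->
  (0 < D u) = (0 < D v).
Proof.
move=> u0 uv vl gd; apply: (@same_sign _ D 2) => //.
  by move=> s t h1 h2 h3; apply: D_lip; lra.
by move=> s h1 h2; have [] := good_cases (_ : 0 <= s <= l) (gd s h1 h2); lra.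
Qed.

Variables (F : R -> R) (P : R).
Hypothesis Fnd : {in `[0, 2] &, nondecreasing_fun F}.
Hypothesis calF : forall z, 0 < z < 2 -> z != P -> calibrates p F z.
Notation phi := (fun s => curvature g s `^ 3^-1).

Let graph_maj u v : 0 <= u -> u <= v -> v <= l -> ~ (u = 0 /\ v = l) ->
  (forall t, u <= t -> t <= v -> y t = f (x t)) ->
  majorized phi u v `|F (x v) - F (x u)|.
Proof.
move=> u0; rewrite le_eqVlt => /predU1P[<- _ _ _|uv vl nuv yf].
  by apply: majorizedW (majorized_nil _ _).
by apply: (arc_majorized fp _ _ Fnd calF) => //; exact: loop_arc.
Qed.

Let flat_maj u v : 0 <= u -> u <= v -> v <= l -> ~ (u = 0 /\ v = l) ->
  (forall t, u <= t -> t <= v -> y t = 0) -> majorized phi u v 0.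
Proof.
move=> u0; rewrite le_eqVlt => /predU1P[<- _ _ _|uv vl nuv yf].
  exact: majorized_nil.
by apply: flat_majorized; exact: loop_arc.
Qed.

(** The parametrization may start anywhere and turn in either direction: m and
    M are the parameters of the two corners in the order in which they are
    met. *)
Lemma loop_corners : exists m M, [/\ 0 <= m, m < M, M < l,
    (g m = (0, 0) /\ g M = (2, 0)) \/ (g m = (2, 0) /\ g M = (0, 0)) &
    forall t, 0 <= t -> t < l -> t != m -> t != M -> good t].
Proof.
have [|a /andP[a0 al] ga] := @loop_onto (0, 0) _ (or_introl erefl); first by rewrite /= lexx ler0n.
have [|b /andP[b0 bl] gb] := @loop_onto (2, 0) _ (or_introl erefl); first by rewrite /= lexx ler0n.
have H t c : 0 <= t -> t < l -> 0 <= c -> c < l -> g t = g c -> t = c.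
  move=> t0 tl c0 cl E; case: (ltgtP t c) => // lt.
    by have [_ e] := loop_inj t0 lt (ltW cl) E; rewrite e ltxx in cl.
  by have [_ e] := loop_inj c0 lt (ltW tl) (esym E); rewrite e ltxx in tl.
have gd t : 0 <= t -> t < l -> t != a -> t != b -> good t.
  move=> t0 tl /eqP ta /eqP tb; split => E; [apply: ta|apply: tb];
    by apply: H => //; rewrite ?ga ?gb.
have ab : a <> b.
  by move=> ab; move: ga; rewrite ab gb => -[] /eqP; rewrite pnatr_eq0.
have [lt|lt|//] := ltgtP a b.
  by exists a, b; split => //; left.
exists b, a; split => //; first by right.
by move=> t t0 tl tb ta; exact: gd.
Qed.

Section Cut.
Variables m M : R.
Hypotheses (m0 : 0 <= m) (mM : m < M) (Ml : M < l).
Hypothesis mab : (g m = (0, 0) /\ g M = (2, 0)) \/ (g m = (2, 0) /\ g M = (0, 0)).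
Hypothesis gdiff : forall t, 0 <= t -> t < l -> t != m -> t != M -> good t.

Let inside t := (m < t) && (t < M).
Let outside t := (0 <= t) && (t < m) || (M < t) && (t < l).

Let ymM : [/\ y m = 0, f (x m) = 0, y M = 0 & f (x M) = 0].
Proof. by case: mab => -[-> ->] /=; rewrite f0 f2. Qed.

Let DmM : D m = 0 /\ D M = 0.
Proof. by have [ym fm yM fM] := ymM; rewrite /D ym yM fm fM mul0r subr0. Qed.

Let goodI t : inside t -> good t.
Proof.
move=> /andP[h1 h2]; apply: gdiff; rewrite ?(gt_eqF h1) ?(lt_eqF h2)//.
- exact: le_trans m0 (ltW h1).
- exact: lt_trans h2 Ml.
Qed.

Let goodL t : 0 <= t -> t < m -> good t.
Proof.
move=> h1 h2; have tM := lt_trans h2 mM; apply: gdiff; rewrite ?(lt_eqF h2) ?(lt_eqF tM)//.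
exact: lt_trans tM Ml.
Qed.

Let goodR t : M < t -> t < l -> good t.
Proof.
by move=> h1 h2; have mt := lt_trans mM h1; apply: gdiff; rewrite ?(gt_eqF h1) ?(gt_eqF mt)//;
  exact: le_trans m0 (ltW mt).
Qed.

Let goodR' t : 0 < m -> M < t -> t <= l -> good t.
Proof.
move=> mp h1; rewrite le_eqVlt => /predU1P[->|]; last exact: goodR.
by have := goodL (lexx 0) mp; rewrite /good g0l.
Qed.

Let M0 : 0 <= M. Proof. exact: le_trans m0 (ltW mM). Qed.
Let ml : m < l. Proof. exact: lt_trans mM Ml. Qed.

Let sameI u v : inside u -> inside v -> (0 < D u) = (0 < D v).
Proof.
wlog uv : u v / u <= v.
  by move=> H iu iv; have [|/ltW] := leP u v => uv; [|apply: esym]; exact: H.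
move=> /andP[u1 u2] /andP[v1 v2]; apply: D_same => //.
- exact: le_trans m0 (ltW u1).
- exact: ltW (lt_trans v2 Ml).
- move=> t h1 h2; apply: goodI; apply/andP; split.
    exact: lt_le_trans u1 h1.
  exact: le_lt_trans h2 v2.
Qed.

Let sameL u v : 0 <= u -> u <= v -> v < m -> (0 < D u) = (0 < D v).
Proof.
move=> u0 uv vm; apply: D_same => //; first exact: ltW (lt_trans vm ml).
by move=> t h1 h2; apply: goodL; [exact: le_trans h1|exact: le_lt_trans vm].
Qed.

Let sameR u v : M < u -> u <= v -> v < l -> (0 < D u) = (0 < D v).
Proof.
move=> u0 uv vm; apply: D_same => //; [exact: le_trans M0 (ltW u0)|exact: ltW|].
by move=> t h1 h2; apply: goodR; [exact: lt_le_trans h1|exact: le_lt_trans vm].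
Qed.

Let sameRl u : 0 < m -> M < u -> u < l -> (0 < D u) = (0 < D l).
Proof.
move=> mp u0 ul; apply: D_same => //; [exact: le_trans M0 (ltW u0)|exact: ltW|].
by move=> t h1 h2; apply: goodR' => //; exact: lt_le_trans h1.
Qed.

Let sameO u v : outside u -> outside v -> (0 < D u) = (0 < D v).
Proof.
have lr s t : 0 <= s -> s < m -> M < t -> t < l -> (0 < D s) = (0 < D t).
  move=> s0 sm Mt tl; have mp := le_lt_trans s0 sm.
  by rewrite -(sameL (lexx 0) s0 sm) (sameRl mp Mt tl) /D g0l.
move=> /orP[] /andP[u1 u2] /orP[] /andP[v1 v2].
- by have [uv|/ltW uv] := leP u v; [|apply: esym]; exact: sameL.
- exact: lr.
- by apply: esym; exact: lr.
- by have [uv|/ltW uv] := leP u v; [|apply: esym]; exact: sameR.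
Qed.

Let place t : 0 <= t -> t < l -> D t != 0 -> inside t \/ outside t.
Proof.
have [Dm DM] := DmM; move=> t0 tl Dt; rewrite /inside /outside t0 tl.
case: (ltgtP t m) => [tm|tm|tm]; [by right| |by rewrite tm Dm eqxx in Dt].
by case: (ltgtP t M) => [tM|tM|tM]; [by left|by right|by rewrite tM DM eqxx in Dt].
Qed.

Let in_l t : inside t \/ outside t -> 0 <= t <= l.
Proof.
move=> [/andP[h1 h2]|/orP[] /andP[h1 h2]].
- by rewrite (le_trans m0 (ltW h1)) (ltW (lt_trans h2 Ml)).
- by rewrite h1 (ltW (lt_trans h2 ml)).
- by rewrite (le_trans M0 (ltW h1)) ltW.
Qed.

Let yI t : inside t -> (0 < D t -> y t = f (x t)) /\ (~~ (0 < D t) -> y t = 0).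
Proof. by move=> it; have [] := good_cases (in_l (or_introl it)) (goodI it). Qed.

Let yO t : outside t -> (0 < D t -> y t = f (x t)) /\ (~~ (0 < D t) -> y t = 0).
Proof.
move=> ot; have tl := in_l (or_intror ot).
move: ot; rewrite /outside => /orP[] /andP[h1 h2].
  by have [] := good_cases tl (goodL h1 h2).
by have [] := good_cases tl (goodR h1 h2).
Qed.

Let close_outer (h : R -> R) : h 0 = 0 -> h 2 = 0 ->
  (forall t, outside t -> y t = h (x t)) ->
  (forall t, 0 <= t -> t <= m -> y t = h (x t)) /\ (forall t, M <= t -> t <= l -> y t = h (x t)).
Proof.
move=> h0 h2 H.
have hm : y m = h (x m) by case: mab => -[-> _]/=.
have hM : y M = h (x M) by case: mab => -[_ ->]/=.
have L t : 0 <= t -> t <= m -> y t = h (x t).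
  move=> t0; rewrite le_eqVlt => /predU1P[->//|tm].
  by apply: H; rewrite /outside t0 tm.
split => // t; rewrite le_eqVlt => /predU1P[<- //|Mt].
rewrite le_eqVlt => /predU1P[->|tl]; last by apply: H; rewrite /outside Mt tl orbT.
by rewrite -g0l; exact: L.
Qed.

Let close_inner (h : R -> R) : h 0 = 0 -> h 2 = 0 ->
  (forall t, inside t -> y t = h (x t)) -> forall t, m <= t -> t <= M -> y t = h (x t).
Proof.
move=> h0 h2 H t; rewrite le_eqVlt => /predU1P[<- _|mt]; first by case: mab => -[-> _]/=.
rewrite le_eqVlt => /predU1P[->|tM]; first by case: mab => -[_ ->]/=.
by apply: H; rewrite /inside mt tM.
Qed.

(** The sign of D is constant on ]m, M[, and also on the rest of the loop,
    whose two parts are joined at 0 = l. As both the graph and the base are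
    reached, each of the two arcs is one of them. *)
Lemma loop_dichotomy : exists h k : R -> R,
  [/\ (forall t, m <= t -> t <= M -> y t = h (x t)),
      (forall t, 0 <= t -> t <= m -> y t = k (x t)),
      (forall t, M <= t -> t <= l -> y t = k (x t)) &
      (h = f /\ k = (fun=> 0)) \/ (h = (fun=> 0) /\ k = f)].
Proof.
have h1 : 0 <= (1 : R) <= 2 by lra.
have [|bot /andP[b0 bl] gbot] := @loop_onto (1, 0) _ (or_introl erefl); first exact: h1.
have [|top /andP[t0 tl] gtop] := @loop_onto (1, f 1) _ (or_intror erefl); first exact: h1.
have f1 : 0 < f 1 by apply: fpos; lra.
have Dbot : D bot < 0 by rewrite /D gbot/= sub0r oppr_lt0 divr_gt0.
have Dtop : 0 < D top by rewrite /D gtop/=; lra.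
have nbot : (0 < D bot) = false by apply: le_gtF; exact: ltW.
have pb := place b0 bl (ltr0_neq0 Dbot); have pt := place t0 tl (lt0r_neq0 Dtop).
case: pt => pt.
  have IP t : inside t -> 0 < D t by move=> it; rewrite (sameI it pt).
  have ob : outside bot by case: pb => // /IP; rewrite nbot.
  have ON t : outside t -> ~~ (0 < D t) by move=> ot; rewrite (sameO ot ob) nbot.
  exists f, (fun=> 0).
  have [|||c1 c2] := @close_outer (fun=> 0) => //.
    by move=> t ot; apply: (yO ot).2; exact: ON.
  split => //; last by left.
  by apply: (@close_inner f) => // t it; apply: (yI it).1; exact: IP.
have OP t : outside t -> 0 < D t by move=> ot; rewrite (sameO ot pt).
have ib : inside bot by case: pb => // /OP; rewrite nbot.
have IN t : inside t -> ~~ (0 < D t) by move=> it; rewrite (sameI it ib) nbot.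
exists (fun=> 0), f.
have [|||c1 c2] := @close_outer f => //.
  by move=> t ot; apply: (yO ot).1; exact: OP.
split => //; last by right.
by apply: (@close_inner (fun=> 0)) => // t it; apply: (yI it).2; exact: IN.
Qed.

Lemma cut_majorized : majorized phi 0 l (F 2 - F 0).
Proof.
have [h [k [yI' yl yr hk]]] := loop_dichotomy.
have gml : ~ (0 = 0 :> R /\ m = l) by move=> [_ e]; have := ml; rewrite e ltxx.
have gMl : ~ (M = 0 /\ l = l).
  by move=> [e _]; have := le_lt_trans m0 mM; rewrite e ltxx.
have gmM : ~ (m = 0 /\ M = l) by move=> [_ e]; have := Ml; rewrite e ltxx.
have i0 : (0 : R) \in `[0, 2] by rewrite in_itv/= lexx ler0n.
have i2 : (2 : R) \in `[0, 2] by rewrite in_itv/= lexx ler0n.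
have F02 : F 0 <= F 2 by apply: Fnd.
have mM' := ltW mM; have Ml' := ltW Ml; have ml' := ltW ml.
case: hk => -[hE kE]; rewrite {}hE {}kE in yI' yl yr.
  have m1 := flat_maj (lexx 0) m0 ml' gml yl.
  have m2 := graph_maj m0 mM' Ml' gmM yI'.
  have m3 := flat_maj M0 Ml' (lexx l) gMl yr.
  apply: majorizedW (majorized_cat M0 Ml' (majorized_cat m0 mM' m1 m2) m3).
  rewrite add0r addr0; case: mab => -[-> ->] /=; first by rewrite ger0_norm ?subr_ge0.
  by rewrite distrC ger0_norm ?subr_ge0.
have m1 := graph_maj (lexx 0) m0 ml' gml yl.
have m2 := flat_maj m0 mM' Ml' gmM yI'.
have m3 := graph_maj M0 Ml' (lexx l) gMl yr.
apply: majorizedW (majorized_cat M0 Ml' (majorized_cat m0 mM' m1 m2) m3).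
rewrite addr0 -g0l.
have x0in : x 0 \in `[0, 2].
  by have [|h0 _] := @loop_in 0; rewrite ?lexx ?ltW//= in_itv.
have /andP[x00 x02] : 0 <= x 0 <= 2 by move: x0in; rewrite in_itv.
have F1 : F 0 <= F (x 0) by apply: Fnd.
have F2 : F (x 0) <= F 2 by apply: Fnd.
case: mab => -[-> ->] /=.
  by rewrite ler0_norm ?subr_le0// ler0_norm ?subr_le0//; lra.
by rewrite ger0_norm ?subr_ge0// ger0_norm ?subr_ge0//; lra.
Qed.

End Cut.

Lemma loop_majorized : majorized phi 0 l (F 2 - F 0).
Proof.
have [m [M [m0 mM Ml mab gdiff]]] := loop_corners.
exact: cut_majorized m0 mM Ml mab gdiff.
Qed.

Lemma loop_integral_le :
  (\int[mu]_(s in `]0%R, l[) (curvature g s `^ 3^-1)%:E <= (F 2 - F 0)%:E)%E.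
Proof.
by apply: majorized_integral loop_majorized => [|s _]; [exact: ltW|exact: powR_ge0].
Qed.

End Loop.

(** * The hyperbola as a graph *)

Section PointwiseDerivatives.
Context {R : realType}.
Implicit Types (f g : R -> R) (x a b : R).

Lemma dcst k x : is_derive x (1:R) (fun=> k : R) (0 : R).
Proof. exact: is_derive_cst. Qed.

Lemma did x : is_derive x (1:R) (fun y => y) (1 : R).
Proof. exact: is_derive_id. Qed.

Lemma dD f g x a b : is_derive x (1:R) f a -> is_derive x (1:R) g b ->
  is_derive x (1:R) (fun y => f y + g y) (a + b).
Proof. exact: is_deriveD. Qed.

Lemma dN f x a : is_derive x (1:R) f a -> is_derive x (1:R) (fun y => - f y) (- a).
Proof. exact: is_deriveN. Qed.

Lemma dM f g x a b : is_derive x (1:R) f a -> is_derive x (1:R) g b ->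
  is_derive x (1:R) (fun y => f y * g y) (f x * b + g x * a).
Proof. exact: is_deriveM. Qed.

Lemma dX2 f x a : is_derive x (1:R) f a ->
  is_derive x (1:R) (fun y => f y ^+ 2) (2 * f x * a).
Proof.
move=> h; have := dM h h; rewrite (_ : _ + _ = 2 * f x * a); last by ring.
by under eq_fun do rewrite -expr2.
Qed.

Lemma dV f x a : f x != 0 -> is_derive x (1:R) f a ->
  is_derive x (1:R) (fun y => (f y)^-1) (- a / f x ^+ 2).
Proof.
move=> fx h; apply: (is_derive_eq (is_deriveV fx h)).
by rewrite /GRing.scale /= -exprVn mulrC mulNr mulrN exprVn.
Qed.

Lemma dcomp (h : R -> R) f x a b : is_derive x (1:R) f a -> is_derive (f x) (1:R) h b ->
  is_derive x (1:R) (fun y => h (f y)) (b * a).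
Proof.
by move=> df dh; apply: (is_derive_eq (is_derive1_comp dh df)); rewrite /GRing.scale/=.
Qed.

Lemma is_derive_lin f x a : is_derive x (1:R) f a ->
  forall e, 0 < e -> exists2 d, 0 < d & forall z, `|z - x| < d ->
   `|f z - f x - a * (z - x)| <= e * `|z - x|.
Proof.
move=> [df <-] e e0.
have := derivableP df.
have cv : h^-1 *: (f (h *: (1:R) + x) - f x) @[h --> 0^'] --> 'D_1 f x by exact: df.
move/cvgrPdist_lt : cv => /(_ _ e0) [d /= d0 H] _.
exists d => // z zd; have [->|zx] := eqVneq z x.
  by rewrite !subrr mulr0 subr0 normr0 mulr0.
have zx0 : z - x != 0 by rewrite subr_eq0.
have := H (z - x); rewrite /= sub0r normrN => /(_ zd zx0).
rewrite /GRing.scale/= mulr1 subrK => /ltW.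
rewrite -(@ler_pM2r _ `|z - x|) ?normr_gt0// -normrM => h.
rewrite -normrN; apply: le_trans h; rewrite le_eqVlt; apply/orP; left; apply/eqP.
by congr (`|_|); field.
Qed.

Lemma is_derive_continuous f x a : is_derive x (1:R) f a -> {for x, continuous f}.
Proof. by move=> [df _]; apply: differentiable_continuous; exact/derivable1_diffP. Qed.

Lemma MVT_is_derive f df u v : u < v ->
  (forall x, u <= x -> x <= v -> is_derive x (1:R) f (df x)) ->
  exists2 c, u <= c <= v & f v - f u = df c * (v - u).
Proof.
move=> uv H.
have [|c|c + E] := @MVT _ f df u v uv.
- by move=> x; rewrite in_itv/= => /andP[/ltW ux /ltW xv]; exact: H.
- by apply: derivable_within_continuous => x; rewrite in_itv/= => /andP[ux xv]; case: (H x ux xv).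
by rewrite in_itv/= => /andP[/ltW a /ltW b]; exists c; rewrite ?a ?b.
Qed.

Lemma is_derive_ge0_homo f df u v : (forall x, u <= x -> x <= v -> is_derive x (1:R) f (df x)) ->
  (forall x, u <= x -> x <= v -> 0 <= df x) -> {in `[u, v] &, nondecreasing_fun f}.
Proof.
move=> H df0 s t; rewrite !in_itv/= => /andP[us sv] /andP[ut tv].
rewrite le_eqVlt => /predU1P[->//|st].
have [x xs xt|c /andP[sc ct] E] := @MVT_is_derive f df s t st.
  by apply: H; [exact: le_trans xs|exact: le_trans tv].
rewrite -subr_ge0 E mulr_ge0 ?subr_ge0 ?(ltW st)// df0//; [exact: le_trans sc|exact: le_trans tv].
Qed.

End PointwiseDerivatives.

(** The value of the derivative is left as an existential variable. *)
Ltac der :=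
  lazymatch goal with
  | |- is_derive _ _ (fun _ => ?k) _ => eapply (dcst k)
  | |- is_derive _ _ (fun y => @?f y + @?g y) _ => eapply (@dD _ f g); der
  | |- is_derive _ _ (fun y => - @?f y) _ => eapply (@dN _ f); der
  | |- is_derive _ _ (fun y => (@?f y)^-1) _ => eapply (@dV _ f); [|der]
  | |- is_derive _ _ (fun y => @?f y ^+ 2) _ => eapply (@dX2 _ f); der
  | |- is_derive _ _ (fun y => @?f y * @?g y) _ => eapply (@dM _ f g); der
  | |- is_derive _ _ (fun y => y) _ => eapply did
  | _ => eauto
  end.

Section Model.
Context {R : realType}.
Variables S c ga : R.
Hypotheses (S0 : 0 < S) (c0 : 0 < c) (c2 : c ^+ 2 = 1 + S ^+ 2)
  (ga0 : 0 < ga) (ga3 : ga ^+ 3 = c).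

(** With S = sinh r, c = cosh r and x = 1 + sinh w / S, this is cosh w;
    hyp_angle below is w, and hyp_graph is the ordinate of the hyperbola. *)
Definition hyp_root (x : R) := Num.sqrt (1 + S ^+ 2 * (x - 1) ^+ 2).
Definition hyp_graph (x : R) := c / S ^+ 2 * (c - hyp_root x).
Definition hyp_slope (x : R) := - (c * (x - 1) / hyp_root x).
Definition hyp_angle (x : R) := ln (S * (x - 1) + hyp_root x).
(** An antiderivative of ga / hyp_root, the affine length element: the second
    derivative of hyp_graph is the opposite of the cube of ga / hyp_root when
    ga ^+ 3 = c. *)
Definition hyp_affine_arc (x : R) := ga / S * hyp_angle x.
Definition hyp_primitive (x : R) := c / S ^+ 2 * (c * (x - 1) - ((x - 1) * hyp_root x + hyp_angle x / S) / 2).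

Lemma hyp_root_sqr x : hyp_root x ^+ 2 = 1 + S ^+ 2 * (x - 1) ^+ 2.
Proof. by rewrite sqr_sqrtr// addr_ge0// mulr_ge0 ?sqr_ge0. Qed.

Lemma hyp_root_gt0 x : 0 < hyp_root x.
Proof. by rewrite sqrtr_gt0 ltr_pwDl// mulr_ge0 ?sqr_ge0. Qed.

Lemma hyp_root_ge1 x : 1 <= hyp_root x.
Proof.
rewrite -(@ler_pXn2r _ 2%N)// ?nnegrE ?(ltW (hyp_root_gt0 x))// expr1n hyp_root_sqr.
by rewrite lerDl mulr_ge0 ?sqr_ge0.
Qed.

Lemma hyp_root_end x : (x - 1) ^+ 2 = 1 -> hyp_root x = c.
Proof. by move=> e; rewrite /hyp_root e mulr1 -c2 sqrtr_sqr gtr0_norm. Qed.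

Lemma hyp_root0 : hyp_root 0 = c. Proof. by apply: hyp_root_end; rewrite sub0r sqrrN expr1n. Qed.
Lemma hyp_root2 : hyp_root 2 = c.
Proof. by apply: hyp_root_end; rewrite (_ : 2 - 1 = 1) ?expr1n//; lra. Qed.

Lemma hyp_root_lt x : 0 < x < 2 -> hyp_root x < c.
Proof.
move=> x02; rewrite -(@ltr_pXn2r _ 2%N)// ?nnegrE ?(ltW (hyp_root_gt0 x)) ?(ltW c0)//.
rewrite hyp_root_sqr c2 ltrD2l gtr_pMr ?exprn_gt0// expr2; nra.
Qed.

Lemma hlog_gt0 x : 0 < S * (x - 1) + hyp_root x.
Proof.
have := hyp_root_sqr x; have q0 := hyp_root_gt0 x.
rewrite -exprMn => E; rewrite -(opprK (S * (x - 1))) addrC subr_gt0.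
apply: (le_lt_trans (ler_norm _)); rewrite normrN.
by rewrite -(@ltr_pXn2r _ 2%N)// ?nnegrE ?ltW// real_normK ?num_real// E ltrDr.
Qed.

Lemma is_derive_hyp_root x : is_derive x (1:R) hyp_root (S ^+ 2 * (x - 1) / hyp_root x).
Proof.
have p0 : 0 < 1 + S ^+ 2 * (x - 1) ^+ 2 by rewrite -hyp_root_sqr exprn_gt0// hyp_root_gt0.
have d1 : is_derive x (1:R) (fun x => 1 + S ^+ 2 * (x - 1) ^+ 2) (2 * S ^+ 2 * (x - 1)).
  by eapply is_derive_eq; [der|ring].
apply: (is_derive_eq (dcomp d1 (is_derive1_sqrt p0))).
by rewrite -/(hyp_root x); field; rewrite gt_eqF ?hyp_root_gt0.
Qed.

Lemma is_derive_hyp_graph x : is_derive x (1:R) hyp_graph (hyp_slope x).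
Proof.
have := is_derive_hyp_root x => h; rewrite /hyp_graph.
by eapply is_derive_eq; [der|rewrite /hyp_slope; field]; rewrite ?expf_neq0 ?gt_eqF ?hyp_root_gt0.
Qed.

Lemma is_derive_hyp_slope x : is_derive x (1:R) hyp_slope (- (c / hyp_root x ^+ 3)).
Proof.
have := is_derive_hyp_root x => h; rewrite /hyp_slope; have q0 := hyp_root_gt0 x.
eapply is_derive_eq; first by der; rewrite gt_eqF.
have q2 : (hyp_root x) ^+ 2 - S ^+ 2 * (x - 1) ^+ 2 = 1 by rewrite hyp_root_sqr addrK.
rewrite (_ : c / hyp_root x ^+ 3 = c * (hyp_root x ^+ 2 - S ^+ 2 * (x - 1) ^+ 2) / hyp_root x ^+ 3); last by rewrite q2 mulr1.
field.
by rewrite gt_eqF.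
Qed.

Lemma is_derive_hyp_angle x : is_derive x (1:R) hyp_angle (S / hyp_root x).
Proof.
have := is_derive_hyp_root x => h; have q0 := hyp_root_gt0 x; have l0 := hlog_gt0 x.
have d1 : is_derive x (1:R) (fun x => S * (x - 1) + hyp_root x) (S + S ^+ 2 * (x - 1) / hyp_root x).
  by eapply is_derive_eq; [der|ring].
apply: (is_derive_eq (dcomp d1 (is_derive1_ln l0))).
by field; rewrite !gt_eqF.
Qed.

Lemma is_derive_hyp_affine_arc x : is_derive x (1:R) hyp_affine_arc (ga / hyp_root x).
Proof.
have := is_derive_hyp_angle x => h; rewrite /hyp_affine_arc; have q0 := hyp_root_gt0 x.
by eapply is_derive_eq; [der|field; rewrite !gt_eqF].
Qed.

Lemma is_derive_hyp_primitive x : is_derive x (1:R) hyp_primitive (hyp_graph x).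
Proof.
have h := is_derive_hyp_angle x; have h' := is_derive_hyp_root x; rewrite /hyp_primitive; have q0 := hyp_root_gt0 x.
eapply is_derive_eq; first by der.
have q2 : S ^+ 2 * (x - 1) ^+ 2 = (hyp_root x) ^+ 2 - 1 by rewrite hyp_root_sqr; ring.
have -> : (x - 1) * (S ^+ 2 * (x - 1) / hyp_root x) = (hyp_root x ^+ 2 - 1) / hyp_root x by rewrite -q2; ring.
by rewrite /hyp_graph; field; rewrite !gt_eqF.
Qed.

Lemma hyp_graph0 : hyp_graph 0 = 0. Proof. by rewrite /hyp_graph hyp_root0 subrr mulr0. Qed.
Lemma hyp_graph2 : hyp_graph 2 = 0. Proof. by rewrite /hyp_graph hyp_root2 subrr mulr0. Qed.
Lemma hyp_graph_gt0 x : 0 < x < 2 -> 0 < hyp_graph x.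
Proof. by move=> x2; rewrite /hyp_graph mulr_gt0 ?subr_gt0 ?hyp_root_lt// divr_gt0// exprn_gt0. Qed.

Lemma hyp_slope_le1 x : 0 <= x <= 2 -> `|hyp_slope x| <= 1.
Proof.
move=> x2; rewrite /hyp_slope normrN normrM normfV (gtr0_norm (hyp_root_gt0 x)).
rewrite ler_pdivrMr ?hyp_root_gt0// mul1r.
rewrite -(@ler_pXn2r _ 2%N)// ?nnegrE ?(ltW (hyp_root_gt0 x))//.
rewrite real_normK ?num_real// exprMn hyp_root_sqr c2 mulrDl mul1r lerD2r expr2; nra.
Qed.

Lemma hyp_graph_lip u v : 0 <= u <= 2 -> 0 <= v <= 2 -> `|hyp_graph v - hyp_graph u| <= `|v - u|.
Proof.
wlog uv : u v / u <= v.
  move=> H u2 v2; have [uv|/ltW vu] := leP u v; first exact: H.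
  by rewrite distrC [`|v - u|]distrC; exact: H.
move=> /andP[u0 u2] /andP[v0 v2]; move: uv; rewrite le_eqVlt => /predU1P[->|uv].
  by rewrite !subrr.
have [x _ _|x /andP[ux xv] ->] := @MVT_is_derive _ hyp_graph hyp_slope u v uv; first exact: is_derive_hyp_graph.
rewrite normrM ler_piMl// hyp_slope_le1//; apply/andP; split.
  exact: le_trans ux.
exact: le_trans v2.
Qed.

Definition hyp_affine_length := hyp_affine_arc 2 - hyp_affine_arc 0.
Definition hyp_area := hyp_primitive 2 - hyp_primitive 0.

Lemma hyp_affine_length_gt0 : 0 < hyp_affine_length.
Proof.
have [x _ _|x _ E] := @MVT_is_derive R hyp_affine_arc (fun x => ga / hyp_root x) 0 2 (ltr0n _ _).
  exact: is_derive_hyp_affine_arc.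
by rewrite /hyp_affine_length E subr0 mulr_gt0// divr_gt0// hyp_root_gt0.
Qed.

(** Both integrals reduce to the same logarithm, hence are affinely related. *)
Lemma hyp_area_length : hyp_area = c ^+ 2 / S ^+ 2 - c / (2 * ga * S ^+ 2) * hyp_affine_length.
Proof.
rewrite /hyp_area /hyp_affine_length /hyp_primitive /hyp_affine_arc hyp_root0 hyp_root2; field.
by rewrite !gt_eqF.
Qed.

End Model.

(** * The calibration attached to the hyperbola *)

Section PieceCalibration.
Context {R : realType}.
Variables S c ga : R.
Hypotheses (S0 : 0 < S) (c0 : 0 < c) (c2 : c ^+ 2 = 1 + S ^+ 2)
  (ga0 : 0 < ga) (ga3 : ga ^+ 3 = c).
Variables f p Ar : R -> R.
Hypothesis fp : cap f p.
Hypothesis ArP : forall x y, 0 <= x -> x <= y -> y <= 2 ->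
  Ar y - Ar x <= (y - x) * f x + p x * (y - x) ^+ 2 / 2.

Variables (e0 e1 eps a b : R).
(** One affine side of the tent function used to perturb the weights; eps = 0
    gives back the weights of the hyperbola. *)
Definition tent x : R := e0 + e1 * x.
Hypotheses (a0 : 0 <= a) (b2 : b <= 2).
Hypothesis eta01 : forall x, a <= x <= b -> 0 <= tent x <= 1.
Hypothesis eps_small : `|eps| * ga ^+ 2 <= 1 / 2.

Definition weight0 := c ^+ 2 / ga ^+ 2 + eps * e0.
Definition weight1 := - 2 * S ^+ 2 / ga ^+ 2 + eps * e1.
Definition weight2 := S ^+ 2 / ga ^+ 2.
(** A quadratic polynomial: for eps = 0 it is the power -2/3 of the second
    derivative of the hyperbola in absolute value, see slope_weightE. *)
Definition slope_weight x := quad weight0 weight1 weight2 x.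
(** The expansion of slope_weight to the power -1/2 at first order in eps,
    increased by a multiple of eps ^+ 2 that makes length_weight ^+ 2 *
    slope_weight at least 1. *)
Definition length_weight x := ga / hyp_root S x - eps / 2 * (ga / hyp_root S x) ^+ 3 * tent x + 2 * ga ^+ 5 * eps ^+ 2.
(** An antiderivative of length_weight. The cube of ga / hyp_root is the
    opposite of the second derivative of hyp_graph, hence its product with the
    affine function tent integrates by parts. *)
Definition length_primitive x := hyp_affine_arc S ga x - eps / 2 * (- hyp_slope S c x * tent x + hyp_graph S c x * e1)
  + 2 * ga ^+ 5 * eps ^+ 2 * x.
Definition tent_calibration x := 2 / 3 * length_primitive x + 1 / 3 * moment f p Ar weight0 weight1 weight2 x.

Lemma slope_weightE x : slope_weight x = (hyp_root S x / ga) ^+ 2 + eps * tent x.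
Proof.
rewrite exprMn hyp_root_sqr exprVn /slope_weight /quad /weight0 /weight1 /weight2 /tent c2.
by field; rewrite gt_eqF.
Qed.

Lemma is_derive_length_primitive x : is_derive x (1:R) length_primitive (length_weight x).
Proof.
have h1 : is_derive x (1:R) (hyp_affine_arc S ga) (ga / hyp_root S x) by exact: is_derive_hyp_affine_arc.
have h2 : is_derive x (1:R) (hyp_graph S c) (hyp_slope S c x) by exact: is_derive_hyp_graph.
have h3 : is_derive x (1:R) (hyp_slope S c) (- (c / hyp_root S x ^+ 3)) by exact: is_derive_hyp_slope.
rewrite /length_primitive /tent; eapply is_derive_eq; first by der.
rewrite /length_weight /tent exprMn ga3; field.
by rewrite gt_eqF// hyp_root_gt0.
Qed.

(** With s = ga / hyp_root and de = eps * tent * s ^+ 2 the two weights are (1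
    + de) / s ^+ 2 and s * (1 - de / 2 + ka). Since (1 - de / 2) ^+ 2 * (1 +
    de) is 1 up to a multiple of de ^+ 2, ka >= 2 * de ^+ 2 suffices. *)
Lemma weights_dual x : a <= x <= b ->
  [/\ (2 * ga ^+ 2)^-1 <= slope_weight x, 0 < length_weight x & 1 <= length_weight x ^+ 2 * slope_weight x].
Proof.
move=> xab; have /andP[n0 n1] := eta01 xab.
have q1 := hyp_root_ge1 S x; have q0 := hyp_root_gt0 S x.
pose s := ga / hyp_root S x.
have s0 : 0 < s by rewrite divr_gt0.
have sga : s <= ga by rewrite /s ler_pdivrMr// ler_peMr// ltW.
pose de := eps * tent x * s ^+ 2.
pose ka := 2 * ga ^+ 5 * eps ^+ 2 / s.
have s2 : 0 < s ^+ 2 by rewrite exprn_gt0.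
have s2g : s ^+ 2 <= ga ^+ 2 by rewrite ler_pXn2r// nnegrE ltW.
have de1 : `|de| <= 1 / 2.
  rewrite /de -mulrA normrM [X in _ * X]ger0_norm; last by rewrite mulr_ge0// ltW.
  apply: le_trans eps_small; rewrite ler_wpM2l//.
  by rewrite -[leRHS]mul1r; apply: ler_pM => //; exact: ltW.
have ka2 : 2 * de ^+ 2 <= ka.
  rewrite /ka ler_pdivlMr//.
  have -> : 2 * de ^+ 2 * s = (2 * eps ^+ 2) * (tent x ^+ 2 * s ^+ 5) by rewrite /de; ring.
  have -> : 2 * ga ^+ 5 * eps ^+ 2 = (2 * eps ^+ 2) * (1 * ga ^+ 5) by ring.
  apply: ler_wpM2l; first by rewrite mulr_ge0// sqr_ge0.
  apply: (@le_trans _ _ (1 * s ^+ 5)).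
    apply: ler_wpM2r; first by rewrite exprn_ge0// ltW.
    by rewrite -(expr1n _ 2) ler_pXn2r// nnegrE.
  by apply: ler_wpM2l => //; rewrite ler_pXn2r// nnegrE ltW.
have uE : slope_weight x = (1 + de) / s ^+ 2.
  by rewrite slope_weightE /de /s; field; rewrite !gt_eqF.
have vE : length_weight x = s * (1 - de / 2 + ka).
  by rewrite /length_weight /ka -/s /de; field; rewrite gt_eqF.
have ka0 : 0 <= ka by apply: le_trans ka2; rewrite mulr_ge0// sqr_ge0.
move: de1; rewrite ler_norml => /andP[d1 d2].
split.
- rewrite uE ler_pdivlMr//.
  apply: (@le_trans _ _ ((2 * ga ^+ 2)^-1 * ga ^+ 2)).
    by rewrite ler_wpM2l// invr_ge0 mulr_ge0// exprn_ge0// ltW.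
  have -> : (2 * ga ^+ 2)^-1 * ga ^+ 2 = 1 / 2 by field; rewrite gt_eqF.
  lra.
- by rewrite vE mulr_gt0//; lra.
rewrite uE vE.
have -> : (s * (1 - de / 2 + ka)) ^+ 2 * ((1 + de) / s ^+ 2) =
  (1 - de / 2 + ka) ^+ 2 * (1 + de) by field; rewrite gt_eqF.
rewrite -subr_ge0.
have -> : (1 - de / 2 + ka) ^+ 2 * (1 + de) - 1 =
  ka ^+ 2 * (1 + de) + (2 * ka * ((1 - de / 2) * (1 + de)) - de ^+ 2 * (3 / 4 - de / 4)) by field.
apply: addr_ge0; first by rewrite mulr_ge0 ?sqr_ge0//; lra.
have h1 : 3 / 8 <= (1 - de / 2) * (1 + de) by nra.
have h2 : ka * (3 / 8) <= ka * ((1 - de / 2) * (1 + de)) by rewrite ler_wpM2l.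
have h3 : de ^+ 2 * (3 / 4 - de / 4) <= de ^+ 2 by rewrite ler_piMr ?sqr_ge0//; lra.
lra.
Qed.

Lemma tent_calibration_nondecreasing : {in `[a, b] &, nondecreasing_fun tent_calibration}.
Proof.
move=> x y xab yab xy; rewrite /tent_calibration.
have h1 : length_primitive x <= length_primitive y.
  apply: (@is_derive_ge0_homo _ length_primitive length_weight a b) => // z az zb; first exact: is_derive_length_primitive.
  by have [] := @weights_dual z; rewrite ?az ?zb// => _ /ltW.
have h2 : moment f p Ar weight0 weight1 weight2 x <= moment f p Ar weight0 weight1 weight2 y.
  apply: (@moment_nondecreasing _ _ _ fp _ ArP weight0 weight1 weight2 _ a b (2 * ga ^+ 2)^-1) => //.
  - by rewrite divr_ge0 ?sqr_ge0.
  - by rewrite invr_gt0 mulr_gt0// exprn_gt0.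
  - by move=> z az zb; have [] := @weights_dual z; rewrite ?az ?zb.
lra.
Qed.

Lemma tent_calibration_calibrates z : a <= z <= b -> exists u v : R,
  [/\ 0 < u, 0 < v, 1 <= v ^+ 2 * u & forall e : R, 0 < e -> exists2 d : R, 0 < d &
    forall y : R, a <= y <= b -> `|y - z| < d ->
      2 / 3 * (v - e) * `|y - z| + 1 / 3 * (u - e) * `|p y - p z| <= `|tent_calibration y - tent_calibration z| ].
Proof.
move=> zab; have [u1 v1 vu] := weights_dual zab.
have ga2 : 0 < 2 * ga ^+ 2 by rewrite mulr_gt0// exprn_gt0.
exists (slope_weight z), (length_weight z); split => //; first by apply: lt_le_trans u1; rewrite invr_gt0.
move=> e e_gt0; have [d d0 Hd] := is_derive_lin (is_derive_length_primitive z) e_gt0.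
pose C := 3 * (`|weight1| + 4 * weight2) + 1.
have pga0 : 0 <= weight2 by rewrite divr_ge0 ?sqr_ge0.
have C0 : 0 < C by rewrite /C; have := normr_ge0 weight1; lra.
exists (Num.min d (e / C)); first by rewrite lt_min d0 divr_gt0.
move=> y yab; rewrite lt_min => /andP[yd]; rewrite ltr_pdivlMr// => yC.
have /andP[az zb] := zab; have /andP[ay yb] := yab.
have z02 : 0 <= z <= 2 by rewrite (le_trans a0 az) (le_trans zb b2).
have y02 : 0 <= y <= 2 by rewrite (le_trans a0 ay) (le_trans yb b2).
have dM := @moment_abs _ _ _ fp _ ArP weight0 weight1 weight2 pga0 z y z02 y02.
have Vlin := Hd y yd.
have hu : (slope_weight z - e) * `|p y - p z| <= `|moment f p Ar weight0 weight1 weight2 y - moment f p Ar weight0 weight1 weight2 z|.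
  apply: le_trans dM; rewrite ler_wpM2r//.
  rewrite -/(slope_weight z) lerD2l lerN2; apply: le_trans (ltW yC); rewrite mulrC ler_wpM2l//.
  by rewrite /C; lra.
have mnd : {in `[a, b] &, nondecreasing_fun (moment f p Ar weight0 weight1 weight2)}.
  apply: (@moment_nondecreasing _ _ _ fp _ ArP weight0 weight1 weight2 _ a b (2 * ga ^+ 2)^-1) => //.
  - by rewrite invr_gt0.
  - by move=> t at_ tb; have [] := @weights_dual t; rewrite ?at_ ?tb.
have vnd : {in `[a, b] &, nondecreasing_fun length_primitive}.
  apply: (@is_derive_ge0_homo _ length_primitive length_weight a b) => // t at_ tb; first exact: is_derive_length_primitive.
  by have [] := @weights_dual t; rewrite ?at_ ?tb// => _ /ltW.
have hv : (length_weight z - e) * `|y - z| <= `|length_primitive y - length_primitive z|.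
  have h1 : length_weight z * `|y - z| = `|length_weight z * (y - z)| by rewrite normrM (gtr0_norm v1).
  rewrite mulrBl h1.
  have := ler_distD (length_primitive y - length_primitive z) (length_weight z * (y - z)) 0; rewrite !subr0 distrC; lra.
apply: (@le_trans _ _ (2 / 3 * `|length_primitive y - length_primitive z| +
   1 / 3 * `|moment f p Ar weight0 weight1 weight2 y - moment f p Ar weight0 weight1 weight2 z|)); first lra.
rewrite /tent_calibration.
have yI : y \in `[a, b] by rewrite in_itv. have zI : z \in `[a, b] by rewrite in_itv.
have [yz|/ltW yz] := leP y z.
  have i1 := vnd _ _ yI zI yz; have i2 := mnd _ _ yI zI yz.
  rewrite !ler0_norm ?subr_le0//; lra.
have i1 := vnd _ _ zI yI yz; have i2 := mnd _ _ zI yI yz.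
rewrite !ger0_norm ?subr_ge0//; lra.
Qed.

End PieceCalibration.

Section KinkedBound.
Context {R : realType}.
Notation mu := (@lebesgue_measure R).
Variables S c ga : R.
Hypotheses (S0 : 0 < S) (c0 : 0 < c) (c2 : c ^+ 2 = 1 + S ^+ 2)
  (ga0 : 0 < ga) (ga3 : ga ^+ 3 = c).
Variables f p Ar : R -> R.
Hypothesis fp : cap f p.
Hypothesis ArP : forall x y, 0 <= x -> x <= y -> y <= 2 ->
  Ar y - Ar x <= (y - x) * f x + p x * (y - x) ^+ 2 / 2.
Hypotheses (f0 : f 0 = 0) (f2 : f 2 = 0) (p0 : p 0 = 1) (p2 : p 2 = -1) (Ar0 : Ar 0 = 0).

(** The weights are perturbed by eps times the tent function with vertex P.
    Its derivative jumps by - 2 / (P * (2 - P)) at P, and in the boundary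
    terms of the two integrations by parts this jump multiplies the ordinates
    f P and hyp_graph P: to first order in eps the bound detects their
    difference. *)
Lemma kinked_calibration (P eps : R) : 0 < P < 2 -> `|eps| * ga ^+ 2 <= 1 / 2 ->
  exists F : R -> R, [/\ {in `[0, 2] &, nondecreasing_fun F},
   forall z, 0 < z < 2 -> z != P -> calibrates p F z &
   F 2 - F 0 = hyp_affine_length S ga + 2 / 3 * (S ^+ 2 / ga ^+ 2) * (hyp_area S c - Ar 2)
     + 2 / 3 * eps * (f P - hyp_graph S c P) / (P * (2 - P)) + 8 / 3 * ga ^+ 5 * eps ^+ 2].
Proof.
move=> /andP[P0 P2] eps1.
have P2' : 0 < 2 - P by rewrite subr_gt0.
pose F1 := tent_calibration S c ga f p Ar 0 P^-1 eps.
pose F2 := tent_calibration S c ga f p Ar (2 / (2 - P)) (- (2 - P)^-1) eps.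
have eta1 x : 0 <= x <= P -> 0 <= tent 0 P^-1 x <= 1.
  move=> /andP[x0 xP]; rewrite /tent add0r mulrC divr_ge0 ?(ltW P0)//=.
  by rewrite ler_pdivrMr// mul1r.
have eta2 x : P <= x <= 2 -> 0 <= tent (2 / (2 - P)) (- (2 - P)^-1) x <= 1.
  move=> /andP[Px x2]; rewrite /tent.
  have -> : 2 / (2 - P) + - (2 - P)^-1 * x = (2 - x) / (2 - P) by field; rewrite gt_eqF.
  by rewrite divr_ge0 ?subr_ge0 ?(ltW P2)//= ler_pdivrMr// mul1r; lra.
have nd1 : {in `[0, P] &, nondecreasing_fun F1}.
  by move=> x y; exact: (tent_calibration_nondecreasing S0 c2 ga0 ga3 fp ArP (lexx 0) (ltW P2) eta1 eps1).
have nd2 : {in `[P, 2] &, nondecreasing_fun F2}.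
  by move=> x y; exact: (tent_calibration_nondecreasing S0 c2 ga0 ga3 fp ArP (ltW P0) (lexx 2) eta2 eps1).
have cal1 := tent_calibration_calibrates S0 c2 ga0 ga3 fp ArP (lexx 0) (ltW P2) eta1 eps1.
have cal2 := tent_calibration_calibrates S0 c2 ga0 ga3 fp ArP (ltW P0) (lexx 2) eta2 eps1.
pose F x := if x <= P then F1 x else F1 P + F2 x - F2 P.
have FP x : P <= x -> F x = F1 P + F2 x - F2 P.
  rewrite /F le_eqVlt => /predU1P[<-|Px]; first by rewrite lexx addrK.
  by rewrite leNgt Px.
exists F; split.
- move=> x y; rewrite !in_itv/= => /andP[x0 x2] /andP[y0 y2] xy.
  have [yP|/ltW yP] := leP y P.
    by rewrite /F yP (le_trans xy yP) nd1// in_itv/= ?x0 ?y0 ?yP ?(le_trans xy yP).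
  have [xP|/ltW xP] := leP x P.
    rewrite (FP _ yP) /F xP.
    have : F1 x <= F1 P by rewrite nd1// in_itv/= ?x0 ?xP ?lexx ?(ltW P0).
    have : F2 P <= F2 y by rewrite nd2// in_itv/= ?yP ?y2 ?lexx ?(ltW P2).
    lra.
  rewrite (FP _ yP) (FP _ xP).
  have : F2 x <= F2 y by rewrite nd2// in_itv/= ?xP ?yP ?x2 ?y2.
  lra.
- move=> z /andP[z0 z2] zP; have [zltP|zgtP] := ltP z P.
    have [|u [v [u_gt0 v_gt0 vu H]]] := cal1 z; first by rewrite !ltW.
    exists u, v; split => // e e0; have [d d0 Hd] := H e e0.
    exists (Num.min d (P - z)); first by rewrite lt_min d0 subr_gt0.
    move=> y /andP[y0 y2]; rewrite lt_min => /andP[yd yP].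
    have yP' : y <= P by have := le_lt_trans (ler_norm _) yP; lra.
    by rewrite /F yP' (ltW zltP); apply: Hd => //; rewrite y0.
  have {zP}zgtP : P < z by rewrite lt_neqAle eq_sym zP.
  have [|u [v [u_gt0 v_gt0 vu H]]] := cal2 z; first by rewrite !ltW.
  exists u, v; split => // e e0; have [d d0 Hd] := H e e0.
  exists (Num.min d (z - P)); first by rewrite lt_min d0 subr_gt0.
  move=> y /andP[y0 y2]; rewrite lt_min => /andP[yd yP].
  have yP' : P <= y.
    by have := le_lt_trans (ler_norm (z - y)) (_ : `|z - y| < z - P); rewrite distrC => /(_ yP); lra.
  rewrite (FP _ yP') (FP _ (ltW zgtP)).
  have -> : F1 P + F2 y - F2 P - (F1 P + F2 z - F2 P) = F2 y - F2 z by ring.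
  by apply: Hd => //; rewrite yP'.
rewrite (FP _ (ltW P2)) {1}/F (ltW P0).
rewrite /F1 /F2 /tent_calibration /moment /length_primitive /quad /weight0 /weight1 /weight2 /tent f0 f2 p0 p2 Ar0.
rewrite !(hyp_graph0 c0 c2) !(hyp_graph2 c0 c2).
rewrite (@hyp_area_length _ S c ga)// /hyp_affine_length /hyp_slope (hyp_root0 c0 c2) (hyp_root2 c0 c2) -ga3.
field.
by rewrite !gt_eqF ?hyp_root_gt0// ?subr_gt0//.
Qed.

Hypothesis fpos : forall z, 0 < z < 2 -> 0 < f z.
Notation length_integral l g :=
  (\int[mu]_(s in `]0%R, l[) (curvature g s `^ 3^-1)%:E)%E.

(** Weak duality with the weights of the hyperbola: the affine length is
    bounded by an affine function of the area Ar 2. *)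
Lemma length_integral_le l g : arclength_param (hypograph f) l g ->
  (length_integral l g <= (hyp_affine_length S ga + 2 / 3 * (S ^+ 2 / ga ^+ 2) * (hyp_area S c - Ar 2))%:E)%E.
Proof.
move=> par.
(* for eps = 0 the vertex is immaterial *)
have [||F [Fnd Fc FE]] := @kinked_calibration 1 0; first lra.
  by rewrite normr0 mul0r; lra.
have := loop_integral_le fp f0 f2 fpos par Fnd Fc.
by rewrite FE expr0n !mulr0 !mul0r !addr0.
Qed.

(** At equal areas the bound of kinked_calibration has a first-order term in
    eps proportional to f P - hyp_graph P and a quadratic error: a small eps
    of the right sign improves it strictly. *)
Lemma length_integral_lt P : 0 < P < 2 -> f P != hyp_graph S c P -> Ar 2 = hyp_area S c ->
  exists2 d, 0 < d & forall l g, arclength_param (hypograph f) l g ->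
  (length_integral l g <= (hyp_affine_length S ga - d)%:E)%E.
Proof.
move=> P02 fP ArE; have /andP[P0 P2] := P02.
pose D := 2 / 3 * (f P - hyp_graph S c P) / (P * (2 - P)).
have PP : 0 < P * (2 - P) by rewrite mulr_gt0// subr_gt0.
have D0 : D != 0.
  apply: mulf_neq0; last by rewrite invr_eq0 gt_eqF.
  by apply: mulf_neq0; [rewrite gt_eqF//; lra|rewrite subr_eq0].
pose K := 8 / 3 * ga ^+ 5.
have K0 : 0 < K by rewrite mulr_gt0// exprn_gt0.
pose t := Num.min ((2 * K)^-1) ((2 * ga ^+ 2)^-1 / `|D|).
have nD : 0 < `|D| by rewrite normr_gt0.
have g2 : 0 < ga ^+ 2 by rewrite exprn_gt0.
have t0 : 0 < t by rewrite lt_min ?divr_gt0 ?invr_gt0 ?mulr_gt0.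
have tK : t * (2 * K) <= 1.
  by rewrite -ler_pdivlMr ?mulr_gt0// div1r ge_min lexx.
have tD : t * `|D| <= (2 * ga ^+ 2)^-1.
  by rewrite -ler_pdivlMr// ge_min lexx orbT.
exists (t / 2 * D ^+ 2).
  by rewrite mulr_gt0 ?divr_gt0// lt_neqAle sqr_ge0 andbT eq_sym sqrf_eq0.
move=> l g par.
have [||F [Fnd Fc FE]] := @kinked_calibration P (- (t * D)); first exact: P02.
  rewrite normrN normrM (gtr0_norm t0).
  apply: (@le_trans _ _ ((2 * ga ^+ 2)^-1 * ga ^+ 2)); first by rewrite ler_wpM2r// ltW.
  have -> : (2 * ga ^+ 2)^-1 * ga ^+ 2 = 1 / 2 by field; rewrite gt_eqF.
  lra.
apply: (le_trans (loop_integral_le fp f0 f2 fpos par Fnd Fc)).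
rewrite lee_fin FE ArE subrr mulr0 addr0.
have -> : hyp_affine_length S ga + 2 / 3 * - (t * D) * (f P - hyp_graph S c P) / (P * (2 - P)) +
   8 / 3 * ga ^+ 5 * (- (t * D)) ^+ 2 =
   hyp_affine_length S ga - t * D ^+ 2 + t * D ^+ 2 * (t * K).
  have -> : 2 / 3 * - (t * D) * (f P - hyp_graph S c P) / (P * (2 - P)) = - (t * D) * D.
    by transitivity (- (t * D) * (2 / 3 * (f P - hyp_graph S c P) / (P * (2 - P)))); [ring|].
  by rewrite /K; ring.
have h : 0 <= t * D ^+ 2 by rewrite mulr_ge0 ?sqr_ge0// ltW.
have := ler_wpM2l h (_ : t * K <= 1 / 2); move=> /(_ _)/wrap[]; lra.
Qed.

End KinkedBound.

(** * Antiderivatives and areas *)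

Section Antiderivative.
Context {R : realType}.
Notation mu := (@lebesgue_measure R).

Lemma antiderivative (phi : R -> R) : continuous phi ->
  exists G : R -> R, forall x : R, -1 < x -> x < 4 -> is_derive x (1:R) G (phi x).
Proof.
(* The margins around [0, 2] give two-sided derivatives at its ends. *)
move=> cphi; exists (fun x => \int[mu]_(t in `[-2, x]) phi t)%R => x x1 x4.
have int : mu.-integrable `[-2, 5] (EFin \o phi).
  apply: continuous_compact_integrable; first exact: segment_compact.
  exact: continuous_subspaceT.
have x5 : x < 5 by lra.
have x2 : -2 < x by lra.
have [d e] := continuous_FTC1_closed x5 int x2 (cphi x).
by apply: DeriveDef; [exact: d|rewrite -derive1E; exact: e].
Qed.

Lemma FTC2_is_derive (phi G : R -> R) a b : a < b -> {within `[a, b], continuous phi} ->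
  (forall x : R, a <= x -> x <= b -> is_derive x (1:R) G (phi x)) ->
  (\int[mu]_(x in `[a, b]) (phi x)%:E = (G b - G a)%:E)%E.
Proof.
move=> ab cphi dG; rewrite EFinB; apply: continuous_FTC2 => //.
  split.
  - by move=> x; rewrite in_itv/= => /andP[/ltW ax /ltW xb]; case: (dG x ax xb).
  - apply: cvg_at_right_filter; exact: (is_derive_continuous (dG a (lexx _) (ltW ab))).
  - apply: cvg_at_left_filter; exact: (is_derive_continuous (dG b (ltW ab) (lexx _))).
move=> x; rewrite in_itv/= => /andP[/ltW ax /ltW xb].
by rewrite derive1E; have [_ ->] := dG x ax xb.
Qed.

Lemma area_hypograph (f : R -> R) : (forall x, 0 <= x <= 2 -> 0 <= f x) ->
  area (hypograph f) = fine (\int[mu]_(x in `[0%R, 2%R]) (f x)%:E)%E.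
Proof.
move=> fge0; rewrite /area /product_measure1; congr fine.
rewrite [RHS]integral_mkcond; apply: eq_integral => x _ /=.
rewrite patchE mem_setE in_itv/=; case: ifPn => x2.
  have -> : xsection (hypograph f) x = `[0, f x]%classic.
    apply/seteqP; split => y; rewrite xsectionP /hypograph/= in_itv/=.
      by move=> [].
    by move=> yf; split.
  rewrite lebesgue_measure_itv/= lte_fin; have := fge0 x x2.
  rewrite le_eqVlt => /predU1P[<-|fx]; first by rewrite ltxx.
  by rewrite fx oppr0 adde0.
have -> : xsection (hypograph f) x = set0.
  apply/seteqP; split => y; rewrite xsectionP //= => -[h _].
  by rewrite h in x2.
by rewrite measure0.
Qed.

End Antiderivative.

(** * Admissible sets as hypographs of concave functions *)

Section ConvexPlane.
Context {R : realType}.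
Implicit Types (K : set (R * R)) (q u v : R * R).

Lemma convex_planeP K : @convex_set R (R * R)%type K <->
  forall u v t, K u -> K v -> 0 <= t -> t <= 1 ->
    K (t * u.1 + (1 - t) * v.1, t * u.2 + (1 - t) * v.2).
Proof.
split=> [cK u v t Ku Kv t0 t1|cK u v l].
  have := cK u v (Itv01 t0 t1); rewrite !inE => /(_ Ku Kv); exact.
rewrite !inE => Ku Kv; exact: cK.
Qed.

Definition triangle_ineqs : set (R * R) := [set q | [/\ 0 <= q.2, q.2 <= q.1 & q.1 + q.2 <= 2]].

Lemma triangleE : @triangle R = triangle_ineqs.
Proof.
apply/seteqP; split.
  apply: smallest_sub.
    apply/convex_planeP => u v t [a1 a2 a3] [b1 b2 b3] t0 t1; split => /=; nra.
  by move=> q [[->|->]|->]; split => /=; lra.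
move=> [x y] [/= y0 yx xy] A [/convex_planeP cA sub].
have aA : A (0, 0) by apply: sub; left; left.
have aB : A (2, 0) by apply: sub; left; right.
have aC : A (1, 1) by apply: sub; right.
have [y1|y1] := leP 1 y.
  have -> : (x, y) = (1, 1) by congr pair; lra.
  exact: aC.
have y1' : 1 - y != 0 by rewrite gt_eqF// subr_gt0.
pose s := (x - y) / (1 - y) / 2.
have s0 : 0 <= s by rewrite !divr_ge0// subr_ge0// ltW.
have s1 : s <= 1 by rewrite /s ler_pdivrMr// ler_pdivrMr ?subr_gt0//; lra.
have aD := cA _ _ s aB aA s0 s1.
have := cA _ _ y aC aD y0 (ltW y1); rewrite /=.
rewrite (_ : (_, _) = (x, y))//; congr pair; last by ring.
by rewrite /s; field.
Qed.

End ConvexPlane.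

Section Profile.
Context {R : realType}.
Variable K : set (R * R).
Hypothesis admK : admissible K.

Let cK : forall u v t, K u -> K v -> 0 <= t -> t <= 1 ->
    K (t * u.1 + (1 - t) * v.1, t * u.2 + (1 - t) * v.2).
Proof. by apply/convex_planeP; case: admK. Qed.

Let Ktri q : K q -> [/\ 0 <= q.2, q.2 <= q.1 & q.1 + q.2 <= 2].
Proof. by case: admK => _ _ h _ _ /h; rewrite triangleE. Qed.

Let Kclosed : closure K = K.
Proof.
apply/esym/closure_id; apply: compact_closed; first exact: norm_hausdorff.
by case: admK.
Qed.

Definition profile (x : R) : R := sup [set y | K (x, y)].
Notation f := profile.

Let Kbase x : 0 <= x <= 2 -> K (x, 0).
Proof.
move=> /andP[x0 x2]; case: admK => _ _ _ KA KB.
have := @cK _ _ (x / 2) KB KA; rewrite /ptA /ptB /= => H.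
have := H _ _; rewrite (_ : (_, _) = (x, 0)); last by congr pair; field.
by apply; rewrite ?divr_ge0// ler_pdivrMr//; lra.
Qed.

Let has_sup_fiber x : 0 <= x <= 2 -> has_sup [set y | K (x, y)].
Proof.
move=> x2; split; first by exists 0; exact: Kbase.
by exists 2 => y /Ktri[/= *]; lra.
Qed.

Let fiber_le x y : K (x, y) -> y <= f x.
Proof.
move=> Kxy; apply: ub_le_sup => //.
by exists 2 => z /Ktri[/= *]; lra.
Qed.

Let graph_in x : 0 <= x <= 2 -> K (x, f x).
Proof.
move=> x2; rewrite -Kclosed => U /nbhs_ballP[e /= e0 HU].
have [y Ky yf] := sup_adherent e0 (has_sup_fiber x2).
exists (x, y); split => //; apply: HU; split => /=; first exact: ballxx.
have yf' := fiber_le Ky.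
have : `|f x - y| < e by rewrite ger0_norm ?subr_ge0// ltrBlDr -ltrBlDl.
exact.
Qed.

Lemma profileE : K = hypograph f.
Proof.
apply/seteqP; split => [[x y] Kxy|[x y] [/= x2 /andP[y0 yf]]].
  have [/= h1 h2 h3] := Ktri Kxy; split => /=; first by apply/andP; split; lra.
  by rewrite h1 fiber_le.
have Kf := graph_in x2.
have [f0|f0] := leP (f x) 0.
  have -> : y = 0 by lra.
  exact: Kbase.
have t0 : 0 <= y / f x by rewrite divr_ge0// ltW.
have t1 : y / f x <= 1 by rewrite ler_pdivrMr// mul1r.
have := cK Kf (Kbase x2) t0 t1; rewrite /=.
by rewrite (_ : (_, _) = (x, y))//; congr pair; field; rewrite gt_eqF.
Qed.

Lemma profile_bounds x : 0 <= x <= 2 -> [/\ 0 <= f x, f x <= x & x + f x <= 2].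
Proof. by move=> /graph_in/Ktri. Qed.

Lemma profile0 : f 0 = 0.
Proof. by have [|b1 b2 b3] := @profile_bounds 0; lra. Qed.

Lemma profile2 : f 2 = 0.
Proof. by have [|b1 b2 b3] := @profile_bounds 2; lra. Qed.

Lemma profile_concave x z t : 0 <= x <= 2 -> 0 <= z <= 2 -> 0 <= t -> t <= 1 ->
  t * f x + (1 - t) * f z <= f (t * x + (1 - t) * z).
Proof. by move=> x2 z2 t0 t1; apply: fiber_le; exact: (cK (graph_in x2) (graph_in z2) t0 t1). Qed.

Lemma profile_slopes z x w : 0 <= z -> z < x -> x < w -> w <= 2 ->
  (f w - f x) / (w - x) <= (f x - f z) / (x - z).
Proof.
move=> z0 zx xw w2.
have zw : 0 < w - z by lra.
have := @profile_concave z w ((w - x) / (w - z)).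
rewrite (_ : 1 - (w - x) / (w - z) = (x - z) / (w - z)); last by field; rewrite gt_eqF.
rewrite (_ : (w - x) / (w - z) * z + (x - z) / (w - z) * w = x); last by field; rewrite gt_eqF.
move=> H; have {}H : (w - x) / (w - z) * f z + (x - z) / (w - z) * f w <= f x.
  by apply: H; rewrite ?divr_ge0 ?ler_pdivrMr//; lra.
rewrite ler_pdivrMr ?subr_gt0// mulrAC ler_pdivlMr ?subr_gt0//.
have {}H : (w - x) * f z + (x - z) * f w <= f x * (w - z).
  by rewrite -ler_pdivrMr// mulrDl !(mulrAC _ _ (w - z)^-1).
lra.
Qed.

(** Inside ]0, 2[ this is the right derivative. At the ends it is the slope of
    the side of the triangle: this makes the boundary terms of moment the same
    for all competitors, whatever the angles at A and B. *)
Definition supergradient (x : R) : R :=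
  if x <= 0 then 1 else if 2 <= x then -1
  else sup [set (f w - f x) / (w - x) | w in [set w | x < w <= 2]].

Lemma supergradient0 : supergradient 0 = 1.
Proof. by rewrite /supergradient lexx. Qed.

Lemma supergradient2 : supergradient 2 = -1.
Proof. by rewrite /supergradient lexx lern0. Qed.

Lemma profile_cap : cap f supergradient.
Proof.
have key x : 0 < x -> x < 2 ->
   (forall w, x < w -> w <= 2 -> (f w - f x) / (w - x) <= supergradient x) /\
   (forall z, 0 <= z -> z < x -> supergradient x <= (f x - f z) / (x - z)).
  move=> x0 x2; rewrite /supergradient leNgt x0/= leNgt x2/=; split.
    move=> w xw w2; apply: ub_le_sup; last by exists w => //=; rewrite xw.
    exists ((f x - f 0) / (x - 0)) => _ [w' /= /andP[xw' w'2] <-].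
    exact: profile_slopes.
  move=> z z0 zx; apply: ge_sup.
    by exists ((f 2 - f x) / (2 - x)); exists 2 => //=; rewrite x2 lexx.
  move=> _ [w /= /andP[xw w2] <-]; exact: profile_slopes.
split.
  move=> x z /andP[x0 x2] /andP[z0 z2].
  have [b1 b2 b3] := @profile_bounds z (introT andP (conj z0 z2)).
  have [xle|xgt] := leP x 0.
    have -> : x = 0 by lra.
    by rewrite supergradient0 profile0; lra.
  have [xge|xlt] := leP 2 x.
    have -> : x = 2 by lra.
    by rewrite supergradient2 profile2; lra.
  have [h1 h2] := key x xgt xlt.
  have [->|zx] := eqVneq z x; first by rewrite subrr mulr0 addr0.
  have [zlx|xlz] := ltP z x.
    have := h2 z z0 zlx; rewrite ler_pdivlMr ?subr_gt0//; lra.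
  have {}xlz : x < z by rewrite lt_neqAle eq_sym zx.
  have := h1 z xlz z2; rewrite ler_pdivrMr ?subr_gt0//; lra.
move=> x /andP[x0 x2].
have [xle|xgt] := leP x 0.
  have -> : x = 0 by lra.
  by rewrite supergradient0 normr1.
have [xge|xlt] := leP 2 x.
  have -> : x = 2 by lra.
  by rewrite supergradient2 normrN1.
have [h1 h2] := key x xgt xlt.
have [b1 b2 b3] := @profile_bounds x (introT andP (conj x0 x2)).
rewrite ler_norml; apply/andP; split.
  apply: le_trans (h1 2 xlt (lexx _)).
  by rewrite profile2 ler_pdivlMr ?subr_gt0//; lra.
apply: le_trans (h2 0 (lexx _) xgt) _.
by rewrite profile0 ler_pdivrMr ?subr_gt0//; lra.
Qed.

Lemma profile_dichotomy : (forall x, 0 <= x <= 2 -> f x = 0) \/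
  (forall x, 0 < x < 2 -> 0 < f x).
Proof.
have [[x [x2 fx]]|H] := pselect (exists x, 0 <= x <= 2 /\ 0 < f x); last first.
  left => x x2; have [b1 _ _] := profile_bounds x2.
  apply/eqP; rewrite eq_le b1 andbT leNgt; apply/negP => fx.
  by apply: H; exists x.
have [b1 b2 b3] := profile_bounds x2; have /andP[x0 x2'] := x2.
right => z /andP[z0 z2]; have [zx|xz] := leP z x.
  have t1 : z / x <= 1 by rewrite ler_pdivrMr; lra.
  have t0 : 0 < z / x by rewrite divr_gt0//; lra.
  have := @profile_concave x 0 (z / x) x2 _ (ltW t0) t1.
  rewrite lexx ler0n profile0 !mulr0 !addr0 divfK ?gt_eqF//; last lra.
  by move=> /(_ isT); apply: lt_le_trans; rewrite mulr_gt0.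
have t1 : (2 - z) / (2 - x) <= 1 by rewrite ler_pdivrMr; lra.
have t0 : 0 < (2 - z) / (2 - x) by rewrite divr_gt0//; lra.
have := @profile_concave x 2 ((2 - z) / (2 - x)) x2 _ (ltW t0) t1.
rewrite lexx ler0n profile2 mulr0 addr0.
have -> : (2 - z) / (2 - x) * x + (1 - (2 - z) / (2 - x)) * 2 = z by field; rewrite gt_eqF; lra.
by move=> /(_ isT); apply: lt_le_trans; rewrite mulr_gt0.
Qed.

(** The tangent line at x lies above the profile and is integrated from x to
    y. *)
Lemma profile_area : exists Ar : R -> R, [/\ Ar 0 = 0, area K = Ar 2 &
  forall x y, 0 <= x -> x <= y -> y <= 2 ->
  Ar y - Ar x <= (y - x) * f x + supergradient x * (y - x) ^+ 2 / 2].
Proof.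
have lip := cap_lip profile_cap.
pose cl (x : R) := Num.min 2 (Num.max 0 x).
have cl_in x : 0 <= cl x <= 2 by rewrite le_min ge_min lexx ler0n/= le_max lexx.
have cl_id x : 0 <= x <= 2 -> cl x = x.
  by move=> /andP[x0 x2]; rewrite /cl max_r// min_r.
have cl_lip x z : `|cl z - cl x| <= `|z - x|.
  wlog xz : x z / x <= z.
    by move=> H; have [|/ltW] := leP x z; [exact: H|move=> /H; rewrite distrC [`|x - z|]distrC].
  rewrite [leRHS]ger0_norm ?subr_ge0//; rewrite /cl.
  have [h1|h1] := leP 0 x; have [h2|h2] := leP 0 z; try lra;
  have [h3|h3] := leP 2 x; have [h4|h4] := leP 2 z; rewrite ler_norml; try lra;
  have [h5|h5] := leP 2 (0:R); lra.
have ct : continuous (f \o cl).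
  move=> x; apply/cvgrPdist_lt => e e0; near=> z.
  rewrite /= distrC; apply: le_lt_trans (lip _ _ (cl_in x) (cl_in z)) _.
  apply: le_lt_trans (cl_lip x z) _; rewrite distrC.
  by near: z; apply: (@cvgr_dist_lt _ _ _ _ _ id).
have [G dG] := antiderivative ct.
exists (fun x => G x - G 0); split; first by rewrite subrr.
- rewrite profileE area_hypograph; last by move=> x x2; have [] := profile_bounds x2.
  transitivity (fine (\int[lebesgue_measure]_(x in `[0%R, 2%R]) ((f \o cl) x)%:E)%E).
    congr fine; apply: eq_integral => x; rewrite inE/= in_itv/= => x2.
    by rewrite cl_id.
  have dG' (x : R) : 0 <= x -> x <= 2 -> is_derive x (1:R) G ((f \o cl) x).
    by move=> x0 x2; apply: dG; lra.
  by rewrite (FTC2_is_derive (ltr0n _ 2) (continuous_subspaceT ct) dG').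
move=> x y x0 xy y2.
rewrite (_ : G y - G 0 - _ = G y - G x); last by ring.
pose p := supergradient x.
pose h t := (t - x) * f x + p * (t - x) ^+ 2 / 2 - G t.
have dh t : x <= t -> t <= y -> is_derive t (1:R) h (f x + p * (t - x) - f t).
  move=> xt ty; have dt : is_derive t (1:R) G (f t).
    have := dG t; rewrite /= cl_id; last by apply/andP; split; lra.
    by apply; lra.
  by rewrite /h; eapply is_derive_eq; [der|field].
have h0 t : x <= t -> t <= y -> 0 <= f x + p * (t - x) - f t.
  move=> xt ty; rewrite subr_ge0.
  by apply: (cap_sg profile_cap); apply/andP; split; lra.
have := @is_derive_ge0_homo _ h (fun t => f x + p * (t - x) - f t) x y dh h0 x y.
rewrite !in_itv/= !lexx xy => /(_ isT isT isT).
by rewrite /h subrr expr0n /= !(mul0r, mulr0) add0r -/p; lra.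
Unshelve. all: by end_near. Qed.

End Profile.

(** * Lower bounds for lengths of curves, and the formula of Peano *)

Section CurveLengthLower.
Context {R : realType}.
Implicit Types (g : R -> R * R).

Lemma enorm_triangle (u v : R * R) : enorm (u + v) <= enorm u + enorm v.
Proof.
rewrite enorm_le ?addr_ge0 ?enorm_ge0//=.
have h : u.1 * v.1 + u.2 * v.2 <= enorm u * enorm v.
  apply: le_trans (ler_norm _) _.
  rewrite -(@ler_pXn2r _ 2%N)// ?nnegrE ?mulr_ge0 ?enorm_ge0//.
  rewrite real_normK ?num_real// exprMn !enorm_sqr -subr_ge0.
  have -> : (u.1 ^+ 2 + u.2 ^+ 2) * (v.1 ^+ 2 + v.2 ^+ 2) - (u.1 * v.1 + u.2 * v.2) ^+ 2
    = (u.1 * v.2 - u.2 * v.1) ^+ 2 by ring.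
  exact: sqr_ge0.
have := enorm_sqr u; have := enorm_sqr v.
have -> : (enorm u + enorm v) ^+ 2 =
  enorm u ^+ 2 + enorm v ^+ 2 + 2 * (enorm u * enorm v) by ring.
move=> -> ->.
have -> : (u.1 + v.1) ^+ 2 + (u.2 + v.2) ^+ 2 =
 (v.1 ^+ 2 + v.2 ^+ 2) + (u.1 ^+ 2 + u.2 ^+ 2) + 2 * (u.1 * v.1 + u.2 * v.2) by ring.
lra.
Qed.

Fixpoint inscribed_length g (a : R) (q : seq R) : R :=
  if q is x :: q' then enorm (g x - g a) + inscribed_length g x q' else 0.

Lemma polygonal_lengthE a b g q : polygonal_length a b g q = inscribed_length g a q.
Proof.
elim: q a => [|x q IH] a; first by rewrite /polygonal_length big_nil.
by rewrite /polygonal_length big_nat_recl//= -IH.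
Qed.

Lemma inscribed_length_cat g a q1 q2 :
  inscribed_length g a (q1 ++ q2) = inscribed_length g a q1 + inscribed_length g (last a q1) q2.
Proof. by elim: q1 a => [|x q IH] a; rewrite /= ?add0r// IH addrA. Qed.

(** The inequality b - a <= curve_length a b g, in a form that only involves
    finite sums. *)
Definition rectifies g a b := forall e, 0 < e ->
  exists2 q, itv_partition a b q & (b - a) - e <= inscribed_length g a q.

Lemma rectifies_refl g a : rectifies g a a.
Proof.
move=> e e0; exists [::]; first by split => /=.
by rewrite subrr sub0r /= oppr_le0 ltW.
Qed.

Lemma rectifies_trans g a b c : rectifies g a b -> rectifies g b c -> rectifies g a c.
Proof.
move=> ab bc e e0; have e2 : 0 < e / 2 by rewrite divr_gt0.
have [q1 p1 h1] := ab _ e2; have [q2 p2 h2] := bc _ e2.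
exists (q1 ++ q2); first exact: itv_partition_cat p1 p2.
rewrite inscribed_length_cat; have [_ /eqP ->] := p1; lra.
Qed.

Lemma rectifies_curve_length g a b : rectifies g a b -> ((b - a)%:E <= curve_length a b g)%E.
Proof.
move=> rec; apply/lee_addgt0Pr => e e0; have [q pq h] := rec _ e0.
rewrite -leeBlDr// -EFinB; apply: (@le_trans _ _ (polygonal_length a b g q)%:E).
  by rewrite lee_fin polygonal_lengthE.
by apply: ereal_sup_ubound; exists q.
Qed.

(** Bisecting n times divides the total quadratic defect of the chords by 2 ^
    n. *)
Lemma rectifies_quadratic g (C a b : R) : 0 <= C -> a <= b ->
  (forall u v, a <= u -> u < v -> v <= b -> (v - u) - C * (v - u) ^+ 2 <= enorm (g v - g u)) ->
  rectifies g a b.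
Proof.
move=> C0; rewrite le_eqVlt => /predU1P[<- _|ab H]; first exact: rectifies_refl.
have key n : forall u v, a <= u -> u < v -> v <= b -> exists2 q, itv_partition u v q &
    (v - u) - C * (v - u) ^+ 2 / 2 ^+ n <= inscribed_length g u q.
  elim: n => [|n IH] u v au uv vb.
    exists [:: v]; first exact: itv_partition1.
    by rewrite expr0 divr1 /= addr0; exact: H.
  pose w := (u + v) / 2.
  have [||| q1 p1 h1] := IH u w; rewrite /w; try lra.
  have [||| q2 p2 h2] := IH w v; rewrite /w; try lra.
  exists (q1 ++ q2); first exact: itv_partition_cat p1 p2.
  rewrite inscribed_length_cat; have [_ /eqP ->] := p1.
  apply: le_trans (lerD h1 h2); rewrite le_eqVlt; apply/orP; left; apply/eqP.
  rewrite (exprS 2 n); have z0 : (2 : R) ^+ n != 0 by rewrite expf_neq0.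
  move: z0; rewrite /w; move: (2 ^+ n) => z z0; field; exact: z0.
move=> e e0; pose M := C * (b - a) ^+ 2.
have [n hn] : exists n : nat, M / e < 2 ^+ n.
  have M0 : 0 <= M / e := divr_ge0 (mulr_ge0 C0 (sqr_ge0 _)) (ltW e0).
  exists (Num.bound (M / e)); apply: lt_le_trans (archi_boundP M0) _.
  by rewrite -natrX ler_nat ltnW// ltn_expl.
have [q pq hq] := key n a b (lexx _) ab (lexx _).
exists q => //; apply: le_trans hq; rewrite lerD2l lerN2 -/M.
by rewrite ler_pdivrMr ?exprn_gt0// mulrC -ler_pdivrMr// ltW.
Qed.

End CurveLengthLower.

Section Peano.
Context {R : realType}.

(** Taylor formula of Peano at order 2, by the mean value theorem applied to
    the remainder. *)
Lemma peano (X dX : R -> R) (s b r : R) : 0 < r ->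
  (forall t, `|t - s| < r -> is_derive t (1:R) X (dX t)) ->
  is_derive s (1:R) dX b -> jet2 X s (dX s) b.
Proof.
move=> r0 HX Hd; apply/cvgrPdist_le => e e0 /=.
have [d d0 Hlin] := is_derive_lin Hd e0.
pose d' := Num.min d r; have d'0 : 0 < d' by rewrite lt_min d0.
pose rr t := X t - X s - (t - s) * dX s - (t - s) ^+ 2 / 2 * b.
have drr t : `|t - s| < d' -> is_derive t (1:R) rr (dX t - dX s - b * (t - s)).
  rewrite lt_min => /andP[_ tr]; have := HX t tr => h.
  by rewrite /rr; eapply is_derive_eq; [der|field].
have bound t : `|t - s| < d' -> `|rr t| <= e * (t - s) ^+ 2.
  move=> td; have rrs : rr s = 0 by rewrite /rr !subrr expr0n /= !mul0r !subr0.
  have [->|ts] := eqVneq t s; first by rewrite rrs normr0 mulr_ge0 ?sqr_ge0// ltW.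
  have sq : `|t - s| * `|t - s| = (t - s) ^+ 2 by rewrite -expr2 real_normK ?num_real.
  have aux u : `|u - s| <= `|t - s| ->
      `|dX u - dX s - b * (u - s)| * `|t - s| <= e * (t - s) ^+ 2.
    move=> us; rewrite -sq mulrA ler_wpM2r//.
    apply: le_trans (Hlin u _) _; last by rewrite ler_wpM2l// ltW.
    by apply: le_lt_trans us _; move: td; rewrite lt_min => /andP[].
  case: (ltgtP s t) ts => // [st|ts] _.
    have [x xs xt|x /andP[xs xt] E] := @MVT_is_derive _ rr (fun u => dX u - dX s - b * (u - s)) s t st.
      apply: drr; apply: le_lt_trans td; rewrite !ger0_norm; lra.
    rewrite rrs subr0 in E; rewrite E normrM; apply: aux.
    by rewrite !ger0_norm; lra.
  have [x xs xt|x /andP[xs xt] E] := @MVT_is_derive _ rr (fun u => dX u - dX s - b * (u - s)) t s ts.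
    apply: drr; apply: le_lt_trans td; rewrite !ler0_norm; lra.
  rewrite rrs sub0r in E; rewrite -normrN E normrM [`|s - t|]distrC; apply: aux.
  by rewrite !ler0_norm; lra.
exists d' => // h /=; rewrite sub0r normrN => hd h0.
have := bound (s + h); rewrite /rr (addrC s h) addrK (addrC h s) => /(_ hd) H.
rewrite sub0r normrN normrM ger0_norm ?sqr_ge0//.
by rewrite exprVn mulrC ler_pdivrMr// lt_neqAle sqr_ge0 andbT eq_sym sqrf_eq0.
Qed.

End Peano.

(** * The boundary of the hull, parametrized by arc length *)

Section ArclengthParam.
Context {R : realType}.
Variables S c ga : R.
Hypotheses (S0 : 0 < S) (c0 : 0 < c) (c2 : c ^+ 2 = 1 + S ^+ 2)
  (ga0 : 0 < ga) (ga3 : ga ^+ 3 = c).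

Notation df := (hyp_slope S c).
Notation Q := (hyp_root S).
Definition speed (x : R) := Num.sqrt (1 + df x ^+ 2).
Notation rho := speed.

Lemma speed_sqr x : rho x ^+ 2 = 1 + df x ^+ 2.
Proof. by rewrite sqr_sqrtr// addr_ge0// sqr_ge0. Qed.

Lemma speed_ge1 x : 1 <= rho x.
Proof. by rewrite -[leLHS]sqrtr1 ler_wsqrtr// lerDl sqr_ge0. Qed.

Lemma speed_gt0 x : 0 < rho x. Proof. exact: lt_le_trans (speed_ge1 x). Qed.

Let is_derive_df x : is_derive x (1:R) df (- (c / Q x ^+ 3)).
Proof. exact: is_derive_hyp_slope. Qed.

Lemma is_derive_speed x : is_derive x (1:R) rho (- (c / Q x ^+ 3) * df x / rho x).
Proof.
have h := is_derive_df x.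
have p0 : 0 < 1 + df x ^+ 2 by rewrite -speed_sqr exprn_gt0// speed_gt0.
have d1 : is_derive x (1:R) (fun x => 1 + df x ^+ 2) (2 * df x * - (c / Q x ^+ 3)).
  by eapply is_derive_eq; [der|ring].
apply: (is_derive_eq (dcomp d1 (is_derive1_sqrt p0))).
by rewrite -/(rho x); field; rewrite !gt_eqF ?hyp_root_gt0 ?speed_gt0.
Qed.

(** chi is the inverse of the arc length x -> int_0^x speed. The margin r
    provides two-sided derivatives at both ends. *)
Lemma arclength_inverse : exists l1 : R, exists chi : R -> R, exists r : R,
  [/\ 0 < l1, 0 < r, chi 0 = 0, chi l1 = 2 &
   (forall s : R, - r < s -> s < l1 + r -> is_derive s (1:R) chi (rho (chi s))^-1)] /\
   (forall s, 0 <= s -> s <= l1 -> 0 <= chi s <= 2) /\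
   (forall x, 0 <= x -> x <= 2 -> exists2 s, 0 <= s <= l1 & chi s = x).
Proof.
have ct : continuous rho.
  by move=> x; apply: is_derive_continuous (is_derive_speed x).
have [G dG] := antiderivative ct.
pose sg x := G x - G 0.
have dsg (x : R) : -1 < x -> x < 4 -> is_derive x (1:R) sg (rho x).
  by move=> x1 x4; have h := dG x x1 x4; rewrite /sg; eapply is_derive_eq; [der|ring].
have inc u v : -1 < u -> u < v -> v < 4 -> sg u < sg v.
  move=> u1 uv v4; have [x xu xv|x _ E] := @MVT_is_derive _ sg rho u v uv.
    by apply: dsg; lra.
  by rewrite -subr_gt0 E mulr_gt0 ?speed_gt0// subr_gt0.
have cts (u v : R) : -1 < u -> v < 4 -> {within `[u, v], continuous sg}.
  move=> u1 v4; apply: derivable_within_continuous => x; rewrite in_itv/= => /andP[ux xv].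
  by case: (dsg x (lt_le_trans u1 ux) (le_lt_trans xv v4)).
pose chi s := xget 0 [set x | -1 < x < 4 /\ sg x = s].
have chiK x : -1 < x -> x < 4 -> chi (sg x) = x.
  move=> x1 x4; have [/andP[y1 y4] E] : [set y | -1 < y < 4 /\ sg y = sg x] (chi (sg x)).
    by apply: (xgetPex 0); exists x; split => //; rewrite x1 x4.
  by case: (ltgtP (chi (sg x)) x) => // lt;
    [have := inc _ _ y1 lt x4|have := inc _ _ x1 lt y4]; rewrite E ltxx.
have onto (u v s : R) : -1 < u -> u <= v -> v < 4 -> sg u <= s -> s <= sg v ->
    exists2 x, u <= x <= v & sg x = s.
  move=> u1 uv v4 us sv.
  have [|x] := @IVT _ sg u v s uv (cts u v u1 v4).
    by rewrite ge_min us le_max sv orbT.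
  by rewrite in_itv/=; exists x.
have dchi (x : R) : -1 < x -> x < 4 -> is_derive (sg x) (1:R) chi (rho x)^-1.
  move=> x1 x4; apply: is_derive_inverse.
  - near=> y; apply: chiK.
      by near: y; exact: lt_nbhsr.
    by near: y; exact: lt_nbhsl.
  - near=> y; apply: is_derive_continuous; apply: dsg.
      by near: y; exact: lt_nbhsr.
    by near: y; exact: lt_nbhsl.
  - exact: dsg.
  - by rewrite gt_eqF// speed_gt0.
have sg0 : sg 0 = 0 by rewrite /sg subrr.
have sgm : sg (- 2^-1) < 0 by rewrite -sg0; apply: inc; lra.
have sg02 : 0 < sg 2 by rewrite -{1}sg0; apply: inc; lra.
have sg23 : sg 2 < sg 3 by apply: inc; lra.
pose r := Num.min (- sg (- 2^-1)) (sg 3 - sg 2).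
exists (sg 2), chi, r; split; [split|split].
- exact: sg02.
- by rewrite lt_min oppr_gt0 sgm subr_gt0.
- by rewrite -[X in chi X]sg0 chiK//; lra.
- by rewrite chiK//; lra.
- move=> s s1 s2.
  have r1 : r <= - sg (- 2^-1) by rewrite ge_min lexx.
  have r2 : r <= sg 3 - sg 2 by rewrite ge_min lexx orbT.
  have [|||||x /andP[x1 x3] <-] := onto (- 2^-1) 3 s; try lra.
  by rewrite chiK; [apply: dchi; lra|lra|lra].
- move=> s s1 s2; have [|||||x /andP[x0 x2] <-] := onto 0 2 s; rewrite ?sg0//; try lra.
  by rewrite chiK ?x0 ?x2//; lra.
- move=> x x0 x2; exists (sg x); last by rewrite chiK//; lra.
  apply/andP; split.
    have [->|x0'] := eqVneq x 0; first by rewrite sg0.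
    by rewrite -sg0; apply/ltW/inc; rewrite ?lt_neqAle 1?eq_sym ?x0' ?x0//; lra.
  have [->//|x2'] := eqVneq x 2.
  by apply/ltW/inc; rewrite ?lt_neqAle ?x2' ?x2//; lra.
Unshelve. all: by end_near. Qed.

End ArclengthParam.

Section ClosedCurve.
Context {R : realType}.
Notation mu := (@lebesgue_measure R).
Variables S c ga : R.
Hypotheses (S0 : 0 < S) (c0 : 0 < c) (c2 : c ^+ 2 = 1 + S ^+ 2)
  (ga0 : 0 < ga) (ga3 : ga ^+ 3 = c).

Notation f := (hyp_graph S c).
Notation df := (hyp_slope S c).
Notation Q := (hyp_root S).
Notation rho := (speed S c).

Variables (l1 : R) (chi : R -> R) (r : R).
Hypotheses (l10 : 0 < l1) (r0 : 0 < r) (chi0 : chi 0 = 0) (chil : chi l1 = 2).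
Hypothesis dchi : forall s : R, - r < s -> s < l1 + r -> is_derive s (1:R) chi (rho (chi s))^-1.
Hypothesis chi02 : forall s, 0 <= s -> s <= l1 -> 0 <= chi s <= 2.
Hypothesis chi_onto : forall x, 0 <= x -> x <= 2 -> exists2 s, 0 <= s <= l1 & chi s = x.

Definition tan_x s := (rho (chi s))^-1.
Definition tan_y s := df (chi s) / rho (chi s).
Definition nor_x s := c / Q (chi s) ^+ 3 * df (chi s) / rho (chi s) ^+ 4.
Definition nor_y s := - (c / Q (chi s) ^+ 3) / rho (chi s) ^+ 4.
Definition fchi s := f (chi s).

Let rho_neq0 x : rho x != 0. Proof. by rewrite gt_eqF// speed_gt0. Qed.
Let Q_neq0 x : Q x != 0. Proof. by rewrite gt_eqF// hyp_root_gt0. Qed.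

Let d_tan_x (s : R) : - r < s -> s < l1 + r -> is_derive s (1:R) tan_x (nor_x s).
Proof.
move=> s1 s2; have h := dcomp (dchi s1 s2) (is_derive_speed S c (chi s)).
rewrite /tan_x; eapply is_derive_eq; first by der; exact: rho_neq0.
by rewrite /nor_x; field; rewrite rho_neq0 Q_neq0.
Qed.

Let d_tan_y (s : R) : - r < s -> s < l1 + r -> is_derive s (1:R) tan_y (nor_y s).
Proof.
move=> s1 s2; have h := dcomp (dchi s1 s2) (is_derive_speed S c (chi s)).
have h' := dcomp (dchi s1 s2) (is_derive_hyp_slope S c (chi s)).
rewrite /tan_y; eapply is_derive_eq; first by der; exact: rho_neq0.
have e : rho (chi s) ^+ 2 - df (chi s) ^+ 2 = 1 by rewrite speed_sqr addrK.
rewrite /nor_y -[X in _ = - X / _]mulr1 -e; field.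
by rewrite rho_neq0 Q_neq0.
Qed.

Let dfchi (s : R) : - r < s -> s < l1 + r -> is_derive s (1:R) fchi (tan_y s).
Proof.
move=> s1 s2; have h : is_derive (chi s) (1:R) f (df (chi s)) by exact: is_derive_hyp_graph.
exact: dcomp (dchi s1 s2) h.
Qed.

Let TT s : tan_x s ^+ 2 + tan_y s ^+ 2 = 1.
Proof.
have -> : tan_x s ^+ 2 + tan_y s ^+ 2 = (1 + df (chi s) ^+ 2) / rho (chi s) ^+ 2.
  by rewrite /tan_x /tan_y; field; rewrite rho_neq0.
by rewrite -speed_sqr divff// expf_neq0.
Qed.

Let NN s : nor_x s ^+ 2 + nor_y s ^+ 2 = (c / (Q (chi s) * rho (chi s)) ^+ 3) ^+ 2.
Proof.
have -> : nor_x s ^+ 2 + nor_y s ^+ 2 =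
   c ^+ 2 * (1 + df (chi s) ^+ 2) / (Q (chi s) ^+ 6 * rho (chi s) ^+ 8).
  by rewrite /nor_x /nor_y; field; rewrite rho_neq0 Q_neq0.
by rewrite -speed_sqr; field; rewrite rho_neq0 Q_neq0.
Qed.

Let NNc s : nor_x s ^+ 2 + nor_y s ^+ 2 <= c ^+ 2.
Proof.
have Q1 := hyp_root_ge1 S (chi s); have r1 := speed_ge1 S c (chi s).
have k1 : 1 <= (Q (chi s) * rho (chi s)) ^+ 3.
  by apply: exprn_ege1; rewrite -[leLHS]mulr1; apply: ler_pM.
have k0 := lt_le_trans ltr01 k1.
rewrite NN ler_pXn2r ?nnegrE ?(ltW c0)//; last by rewrite divr_ge0 ?(ltW k0) ?(ltW c0).
by rewrite ler_pdivrMr// ler_peMr// ltW.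
Qed.

Let bnd (a b e : R) : a ^+ 2 + b ^+ 2 <= e ^+ 2 -> 0 <= e -> `|a| <= e /\ `|b| <= e.
Proof.
move=> h e0; split; rewrite -(@ler_pXn2r _ 2%N)// ?nnegrE// real_normK ?num_real//.
  by apply: le_trans h; rewrite lerDl sqr_ge0.
by apply: le_trans h; rewrite lerDr sqr_ge0.
Qed.

Let inr (t : R) : 0 <= t -> t <= l1 -> - r < t /\ t < l1 + r.
Proof. by move: r0; split; lra. Qed.

Let A s : R * R := (chi s, fchi s).

Let dot_MVT (a b u v : R) : 0 <= u -> u < v -> v <= l1 ->
  exists2 w, u <= w <= v &
   a * (chi v - chi u) + b * (fchi v - fchi u) = (a * tan_x w + b * tan_y w) * (v - u).
Proof.
move=> u0 uv vl.
have [x ux xv|w uwv E] := @MVT_is_derive _ (fun t => a * chi t + b * fchi t)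
    (fun t => a * tan_x t + b * tan_y t) u v uv.
  have [i1 i2] : - r < x /\ x < l1 + r by apply: inr; lra.
  have h1 := dchi i1 i2; have h2 := dfchi i1 i2.
  by eapply is_derive_eq; [der|rewrite /tan_x; ring].
by exists w => //; rewrite -E; ring.
Qed.

(** The mean value theorem is applied to the inner product of the curve with
    its own chord. *)
Lemma arc_chord_le u v : 0 <= u -> u < v -> v <= l1 -> enorm (A v - A u) <= v - u.
Proof.
move=> u0 uv vl; have vu0 : 0 <= v - u by rewrite subr_ge0 ltW.
set a := chi v - chi u; set b := fchi v - fchi u.
have [w _ E] := dot_MVT a b u0 uv vl; rewrite -/a -/b in E.
rewrite enorm_le//= -/a -/b.
have h : (a * tan_x w + b * tan_y w) ^+ 2 <= a ^+ 2 + b ^+ 2.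
  rewrite -[leRHS]mulr1 -(TT w) -subr_ge0.
  have -> : (a ^+ 2 + b ^+ 2) * (tan_x w ^+ 2 + tan_y w ^+ 2) - (a * tan_x w + b * tan_y w) ^+ 2 =
    (a * tan_y w - b * tan_x w) ^+ 2 by ring.
  exact: sqr_ge0.
have n0 : 0 <= a ^+ 2 + b ^+ 2 by rewrite addr_ge0 ?sqr_ge0.
move: h; set m := a ^+ 2 + b ^+ 2 in n0 *; set d := _ + _ => h.
have {}E : m = d * (v - u) by rewrite -E /m; ring.
have [->|m0] := eqVneq m 0; first by rewrite sqr_ge0.
have mp : 0 < m by rewrite lt_neqAle eq_sym m0.
have : m * m <= m * (v - u) ^+ 2.
  by rewrite {1 2}E mulrACA -!expr2 ler_wpM2r ?sqr_ge0.
by rewrite ler_pM2l.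
Qed.

(** The chord is projected on the tangent at its origin; each component of the
    tangent varies at a rate at most c. *)
Lemma arc_chord_ge u v : 0 <= u -> u < v -> v <= l1 ->
  (v - u) - 2 * c * (v - u) ^+ 2 <= enorm (A v - A u).
Proof.
move=> u0 uv vl; have vu0 : 0 <= v - u by rewrite subr_ge0 ltW.
have [w /andP[uw wv] E] := dot_MVT (tan_x u) (tan_y u) u0 uv vl.
set a := chi v - chi u in E; set b := fchi v - fchi u in E.
have h1 : tan_x u * a + tan_y u * b <= enorm (A v - A u).
  apply: le_trans (ler_norm _) _.
  rewrite -(@ler_pXn2r _ 2%N)// ?nnegrE ?enorm_ge0//.
  rewrite real_normK ?num_real// enorm_sqr /= -/a -/b.
  rewrite -[leRHS]mul1r -(TT u) -subr_ge0.
  have -> : (tan_x u ^+ 2 + tan_y u ^+ 2) * (a ^+ 2 + b ^+ 2) - (tan_x u * a + tan_y u * b) ^+ 2 =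
    (tan_x u * b - tan_y u * a) ^+ 2 by ring.
  exact: sqr_ge0.
apply: le_trans h1; rewrite E.
have lipT (T N : R -> R) : (forall s : R, - r < s -> s < l1 + r -> is_derive s (1:R) T (N s)) ->
    (forall s, `|N s| <= c) -> `|T w - T u| <= c * (v - u).
  move=> dT Nc; have [->|wu] := eqVneq w u.
    by rewrite subrr normr0 mulr_ge0// ltW.
  have uw' : u < w by rewrite lt_neqAle eq_sym wu.
  have [x ux xw|x _ ->] := @MVT_is_derive _ T N u w uw'.
    have [i1 i2] : - r < x /\ x < l1 + r by apply: inr; lra.
    exact: dT.
  rewrite normrM [`|w - u|]ger0_norm ?subr_ge0//.
  by apply: ler_pM; rewrite ?subr_ge0//; lra.
have l1' := lipT _ _ d_tan_x (fun s => (bnd (NNc s) (ltW c0)).1).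
have l2' := lipT _ _ d_tan_y (fun s => (bnd (NNc s) (ltW c0)).2).
have [t1 t2] : `|tan_x u| <= 1 /\ `|tan_y u| <= 1 by apply: bnd; rewrite ?TT ?expr1n.
have cv : 0 <= c * (v - u) by rewrite mulr_ge0// ltW.
have k (t d : R) : `|t| <= 1 -> `|d| <= c * (v - u) -> - (c * (v - u)) <= t * d.
  move=> h1 h2; have : `|t * d| <= 1 * (c * (v - u)) by rewrite normrM; apply: ler_pM.
  by rewrite mul1r ler_norml => /andP[].
have k1 := k _ _ t1 l1'; have k2 := k _ _ t2 l2'.
have : 1 - 2 * c * (v - u) <= tan_x u * tan_x w + tan_y u * tan_y w.
  have := TT u; rewrite !expr2; lra.
move=> /(ler_wpM2r vu0); rewrite expr2; lra.
Qed.

(** Along the hyperbola from A to B, then back along the base. *)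
Definition hull_curve (s : R) : R * R := if s <= l1 then A s else (2 - (s - l1), 0).
Notation l := (l1 + 2).

Let gL s : s <= l1 -> hull_curve s = A s. Proof. by rewrite /hull_curve => ->. Qed.
Let gR s : l1 <= s -> hull_curve s = (2 - (s - l1), 0).
Proof.
rewrite /hull_curve; case: ltgtP => // <- _.
by rewrite /A chil /fchi chil (hyp_graph2 c0 c2) subrr subr0.
Qed.

Let segE u v : u <= v -> enorm ((2 - (v - l1), 0) - (2 - (u - l1), 0) : R * R) = v - u.
Proof.
move=> uv; rewrite /enorm /= subrr expr0n addr0 sqrtr_sqr.
rewrite (_ : _ - _ = - (v - u)); last by ring.
by rewrite normrN ger0_norm ?subr_ge0.
Qed.

Lemma hull_curve_chord_le u v : 0 <= u -> u < v -> v <= l -> enorm (hull_curve v - hull_curve u) <= v - u.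
Proof.
move=> u0 uv vl; have [vl1|/ltW vl1] := leP v l1.
  by rewrite !gL ?(le_trans (ltW uv))//; exact: arc_chord_le.
have [ul1|/ltW ul1] := leP l1 u.
  by rewrite !gR ?(le_trans ul1 (ltW uv))// segE// ltW.
rewrite (_ : hull_curve v - hull_curve u = (hull_curve v - hull_curve l1) + (hull_curve l1 - hull_curve u)); last first.
  by rewrite addrA subrK.
apply: le_trans (enorm_triangle _ _) _.
have -> : v - u = (v - l1) + (l1 - u) by ring.
apply: lerD; first by rewrite !gR// segE.
have [->|ul] := eqVneq u l1; first by rewrite !subrr /enorm /= expr0n addr0 sqrtr0.
by rewrite !gL//; apply: arc_chord_le => //; rewrite lt_neqAle ul.
Qed.

Lemma hull_curve_length s t : 0 <= s -> s <= t -> t <= l -> curve_length s t hull_curve = (t - s)%:E.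
Proof.
move=> s0' st tl; apply/eqP; rewrite eq_le; apply/andP; split.
  apply: (@curve_length_le _ s t hull_curve id) => u v su uv vt.
  by apply: hull_curve_chord_le => //; [exact: le_trans su|exact: le_trans tl].
apply: rectifies_curve_length.
have c2' : 0 <= 2 * c by rewrite mulr_ge0// ltW.
have RL u v : 0 <= u -> u <= v -> v <= l1 -> rectifies hull_curve u v.
  move=> u0 uv vl; apply: (@rectifies_quadratic _ _ (2 * c)) => // a b ua ab bv.
  by rewrite !gL; [apply: arc_chord_ge|..]; lra.
have RR u v : l1 <= u -> u <= v -> rectifies hull_curve u v.
  move=> u0 uv; apply: (@rectifies_quadratic _ _ 0) => // a b ua ab bv.
  have la : l1 <= a := le_trans u0 ua.
  by rewrite mul0r subr0 (gR la) (gR (le_trans la (ltW ab))) segE// ltW.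
have [tl1|/ltW tl1] := leP t l1; first exact: RL.
have [sl1|/ltW sl1] := leP l1 s; first exact: RR.
exact: rectifies_trans (RL s l1 s0' sl1 (lexx _)) (RR _ _ (lexx _) tl1).
Qed.

Let chi_inj s t : 0 <= s -> s <= l1 -> 0 <= t -> t <= l1 -> chi s = chi t -> s = t.
Proof.
have key u v : 0 <= u -> u < v -> v <= l1 -> chi u < chi v.
  move=> u0 uv vl; have [x ux xv|x _ E] := @MVT_is_derive _ chi tan_x u v uv.
    have [i1 i2] : - r < x /\ x < l1 + r by apply: inr; lra.
    exact: dchi.
  by rewrite -subr_gt0 E mulr_gt0 ?subr_gt0// invr_gt0 speed_gt0.
move=> s0' sl t0 tl E; case: (ltgtP s t) => // lt.
  by have := key _ _ s0' lt tl; rewrite E ltxx.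
by have := key _ _ t0 lt sl; rewrite E ltxx.
Qed.

Lemma hull_curve_param : arclength_param (hypograph f) l hull_curve.
Proof.
have fp x : 0 < x < 2 -> 0 < f x by exact: hyp_graph_gt0.
have gl : hull_curve l = (0, 0).
  by rewrite gR ?lerDl//; congr pair; ring.
have g0 : hull_curve 0 = (0, 0) by rewrite gL ?(ltW l10)// /A /fchi chi0 (hyp_graph0 c0 c2).
split.
- by rewrite addr_gt0.
- by rewrite gl g0.
- have arc_seg s t : 0 <= s -> s <= l1 -> l1 < t -> t < l -> hull_curve s <> hull_curve t.
    move=> s0' sl lt tl; rewrite gL// gR ?(ltW lt)// => -[e1 e2].
    have := fp (chi s); rewrite e1 => /(_ _)/wrap[]; first by lra.
    by rewrite -e1 -/(fchi s) e2 ltxx.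
  move=> s t; rewrite !in_itv/= => /andP[s0' sl] /andP[t0 tl] E.
  have [sl1|sl1] := leP s l1; have [tl1|tl1] := leP t l1.
  + by move: E; rewrite !gL// => -[/chi_inj E _]; apply: E.
  + by have := arc_seg _ _ s0' sl1 tl1 tl.
  + by have := arc_seg _ _ t0 tl1 sl1 sl; rewrite E.
  + by move: E; rewrite !gR ?ltW// => -[]; lra.
- rewrite (@boundary_hypograph _ f) ?(hyp_graph0 c0 c2) ?(hyp_graph2 c0 c2)//; last first.
    exact: hyp_graph_lip.
  apply/seteqP; split.
    move=> _ [s /= + <-]; rewrite in_itv/= => /andP[s0' sl].
    have [sl1|/ltW sl1] := leP s l1.
      by rewrite gL//=; split; [exact: chi02|right].
    by rewrite gR//=; split; [apply/andP; split; lra|left].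
  have l10' := l10.
  move=> [x y] [/= /andP[x0 x2] [->|->]].
    exists (l1 + (2 - x)); first by rewrite /= in_itv/=; apply/andP; split; lra.
    by rewrite gR; [congr pair; ring|lra].
  have [s /andP[s0' sl] sx] := chi_onto x0 x2.
  exists s; first by rewrite /= in_itv/= s0'/=; lra.
  by rewrite gL// /A /fchi sx.
- exact: hull_curve_length.
Qed.

Lemma jet2_unique (X : R -> R) s a b a' b' : jet2 X s a b -> jet2 X s a' b' -> b = b'.
Proof.
move=> j j'.
have E : a = a'.
  have := jet2_quot (th := 1) j; have := jet2_quot (th := 1) j'; rewrite !mul1r.
  by move=> h h'; exact: (cvg_unique _ h' h).
rewrite -E in j'.
have := jet2_quot2 (th := 1) j; have := jet2_quot2 (th := 1) j' => h h'.
have e : (1 : R) ^+ 2 / 2 * b = 1 ^+ 2 / 2 * b' by exact: (cvg_unique _ h' h).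
by rewrite !expr1n in e; lra.
Qed.

(** The expansion of Peano shows that curvature is here the norm of the
    derivative of the tangent, which is the cube of ga / (hyp_root * speed). *)
Lemma hull_curve_curvature s : 0 < s -> s < l1 ->
  curvature hull_curve s `^ 3^-1 = ga / (Q (chi s) * rho (chi s)).
Proof.
move=> s0' sl; have r0' := r0.
pose d := Num.min s (l1 - s); have d0 : 0 < d by rewrite lt_min s0' subr_gt0.
have ind t : `|t - s| < d -> - r < t /\ t < l1 + r /\ t <= l1.
  by rewrite lt_min !ltr_norml => /andP[/andP[h1 h2] /andP[h3 h4]]; lra.
have j1 : jet2 chi s (tan_x s) (nor_x s).
  apply: (@peano _ chi tan_x s (nor_x s) d d0); last by apply: d_tan_x; lra.
  by move=> t /ind[h1 [h2 _]]; exact: dchi.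
have j2 : jet2 fchi s (tan_y s) (nor_y s).
  apply: (@peano _ fchi tan_y s (nor_y s) d d0); last by apply: d_tan_y; lra.
  by move=> t /ind[h1 [h2 _]]; exact: dfchi.
have loc (X Y : R -> R) a b : (forall t, `|t - s| < d -> X t = Y t) -> jet2 X s a b -> jet2 Y s a b.
  move=> XY; apply: cvg_trans; apply: near_eq_cvg; near=> h.
  rewrite !XY// ?subrr ?normr0// addrAC subrr add0r.
  by near: h; apply: dnbhs0_lt.
have jA : second_order_expansion hull_curve s (tan_x s, tan_y s) (nor_x s, nor_y s).
  apply/second_order_expansionP; split.
    by apply: loc j1 => t /ind[_ [_ h]]; rewrite gL.
  by apply: loc j2 => t /ind[_ [_ h]]; rewrite gL.
have -> : curvature hull_curve s = (ga / (Q (chi s) * rho (chi s))) ^+ 3.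
  rewrite /curvature.
  pose NS := [set N : R * R | exists T, second_order_expansion hull_curve s T N].
  have ex : exists N, NS N by exists (nor_x s, nor_y s), (tan_x s, tan_y s).
  have [T /second_order_expansionP[k1 k2]] := xgetPex (0 : R * R) ex.
  rewrite -/NS.
  have /second_order_expansionP[k1' k2'] := jA.
  rewrite /enorm -(jet2_unique k1' k1) -(jet2_unique k2' k2) /= NN sqrtr_sqr ger0_norm.
    by rewrite expr_div_n ga3.
  by rewrite divr_ge0 ?(ltW c0)// exprn_ge0// mulr_ge0 ?(ltW (hyp_root_gt0 _ _)) ?(ltW (speed_gt0 _ _ _)).
have n0 : 0 <= ga / (Q (chi s) * rho (chi s)).
  by rewrite divr_ge0 ?(ltW ga0)// mulr_ge0 ?(ltW (hyp_root_gt0 _ _)) ?(ltW (speed_gt0 _ _ _)).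
by rewrite -powR_mulrn// -powRrM divff ?powRr1// pnatr_eq0.
Unshelve. all: by end_near. Qed.

(** On the arc of hyperbola the integrand is the derivative of hyp_affine_arc
    along chi. *)
Lemma hull_curve_integral_ge :
  ((hyp_affine_length S ga)%:E <= \int[mu]_(s in `]0%R, (l1 + 2)%R[) (curvature hull_curve s `^ 3^-1)%:E)%E.
Proof.
pose psi s := ga / (Q (chi s) * rho (chi s)).
have dpsi (s : R) : 0 <= s -> s <= l1 -> is_derive s (1:R) (fun s => hyp_affine_arc S ga (chi s)) (psi s).
  move=> s0' sl; have [i1 i2] := inr s0' sl.
  apply: (is_derive_eq (dcomp (dchi i1 i2) (is_derive_hyp_affine_arc ga S0 (chi s)))).
  by rewrite /psi; field; rewrite Q_neq0 rho_neq0.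
have cpsi : {within `[0, l1], continuous psi}.
  apply: derivable_within_continuous => s; rewrite in_itv/= => /andP[s0' sl].
  have [i1 i2] := inr s0' sl.
  have h1 := dcomp (dchi i1 i2) (is_derive_speed S c (chi s)).
  have h2 := dcomp (dchi i1 i2) (is_derive_hyp_root S (chi s)).
  have [a [//]] : exists a, is_derive s (1:R) psi a.
  by eexists; rewrite /psi; der; rewrite mulf_neq0.
have mpsi : measurable_fun `]0, l1[ (EFin \o psi).
  apply/measurable_EFinP.
  have m : measurable_fun `[0, l1] psi by exact: subspace_continuous_measurable_fun.
  by apply: measurable_funS m => //; exact: subset_itv_oo_cc.
have -> : hyp_affine_length S ga = hyp_affine_arc S ga (chi l1) - hyp_affine_arc S ga (chi 0) by rewrite chil chi0.
rewrite -(FTC2_is_derive l10 cpsi dpsi) (integral_itv_bndoo true false mpsi).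
apply: ge0_integral_mono.
- by move=> s /=; rewrite !in_itv/= => /andP[-> h]/=; apply: lt_trans h _; rewrite ltrDl.
- by move=> s _; rewrite lee_fin powR_ge0.
- move=> s _; rewrite lee_fin /psi divr_ge0 ?(ltW ga0)// mulr_ge0 ?(ltW (hyp_root_gt0 _ _)) ?(ltW (speed_gt0 _ _ _))//.
- by move=> s /=; rewrite in_itv/= => /andP[h1 h2]; rewrite hull_curve_curvature.
Qed.

End ClosedCurve.

(** * The hull of the hyperbola *)

Section Hyperbolic.
Context {R : realType}.
Implicit Types (x y r : R).

Lemma sinhE2 x : sinh (2 * x) = 2 * sinh x * cosh x.
Proof.
have -> : 2 * x = x + x by ring.
by rewrite /sinh /cosh opprD !expRD; field.
Qed.

Lemma cosh_sqr x : cosh x ^+ 2 = 1 + sinh x ^+ 2.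
Proof.
have e : expR x * expR (- x) = 1 by rewrite -expRD subrr expR0.
have -> : 1 + sinh x ^+ 2 = 1 - expR x * expR (- x) + cosh x ^+ 2 by rewrite /sinh /cosh; field.
by rewrite e subrr add0r.
Qed.

Lemma cosh_gt0 x : 0 < cosh x.
Proof. by rewrite divr_gt0// addr_gt0 ?expR_gt0. Qed.

Lemma sinh_gt0 x : 0 < x -> 0 < sinh x.
Proof. by move=> x0; rewrite divr_gt0// subr_gt0 ltr_expR; lra. Qed.

Lemma ln_sinhDcosh x : ln (sinh x + cosh x) = x.
Proof. by rewrite (_ : sinh x + cosh x = expR x) ?expRK// /sinh /cosh; field. Qed.

Lemma sinh_homo x y : x <= y -> sinh x <= sinh y.
Proof.
move=> xy; rewrite ler_pM2r ?invr_gt0// lerD ?lerN2 ?ler_expR//; lra.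
Qed.

Lemma sinhN x : sinh (- x) = - sinh x.
Proof. by rewrite /sinh opprK; field. Qed.

Lemma coshN x : cosh (- x) = cosh x.
Proof. by rewrite /cosh opprK addrC. Qed.

Lemma sinh_mul x y : sinh x * sinh y = (cosh (x + y) - cosh (x - y)) / 2.
Proof. by rewrite /sinh /cosh !opprD opprK !expRD; field. Qed.

Lemma is_derive_sinh x : is_derive x (1:R) sinh (cosh x).
Proof.
have h := is_derive_expR x; have h' := is_derive_expR (- x).
have h2 : is_derive x (1:R) (fun y => - y) (-1) by apply: dN; exact: did.
have h3 := dcomp h2 h'.
rewrite /sinh /cosh; eapply is_derive_eq; first by der.
by rewrite /=; field.
Qed.

Lemma sinh_small (k : R) : 0 < k -> exists2 x, 0 < x & sinh x <= (1 + k) * x.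
Proof.
move=> k0; have x0 : 0 < ln (1 + k) by rewrite ln_gt0// ltrDl.
exists (ln (1 + k)) => //.
have [x _ _|x /andP[xa xb] E] := @MVT_is_derive _ sinh cosh 0 _ x0; first exact: is_derive_sinh.
have s0 : sinh (0 : R) = 0 by rewrite /sinh oppr0 subrr mul0r.
rewrite s0 !subr0 in E; rewrite E ler_wpM2r ?(ltW x0)//.
apply: (@le_trans _ _ (expR x)).
  by rewrite /cosh ler_pdivrMr// mulr_natr mulr2n lerD2l ler_expR; lra.
by rewrite -[leRHS]lnK ?ler_expR// posrE addr_gt0.
Qed.

Lemma sinh_large (k : R) : 0 < k -> (1 + k) * (8 * (1 + k)) <= sinh (8 * (1 + k)).
Proof.
move=> k0; set x := 8 * (1 + k); have x0 : 0 < x by rewrite mulr_gt0// addr_gt0.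
have e1 : expR (- x) <= 1 by rewrite -[leRHS]expR0 ler_expR; lra.
have e2 : (1 + x / 2) ^+ 2 <= expR x.
  rewrite {2}(_ : x = 2%:R * (x / 2)); last by field.
  by rewrite expRM_natl ler_pXn2r ?expR_ge1Dx// nnegrE ?expR_ge0//; lra.
have xk : x = 8 * (1 + k) by [].
rewrite /sinh ler_pdivlMr//; move: e2; rewrite expr2 => e2.
have : x * x = x * (8 * (1 + k)) by rewrite {2}xk.
lra.
Qed.

(** The function sinh x - (1 + k) * x changes sign between a small and a large
    argument; x is 2 * r. *)
Lemma Psi_onto (k : R) : 0 < k -> exists r, 0 <= r /\ Psi r = k.
Proof.
move=> k0; have [x0 x0p hx0] := sinh_small k0; have hx1 := sinh_large k0.
set x1 := 8 * (1 + k) in hx1; have x1p : 0 < x1 by rewrite mulr_gt0// addr_gt0.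
pose u x := sinh x - (1 + k) * x.
have cu (a b : R) : {within `[a, b], continuous u}.
  apply: derivable_within_continuous => x _.
  have h := is_derive_sinh x.
  have [a' [//]] : exists a', is_derive x (1:R) u a'.
  by eexists; rewrite /u; der.
have [x xp ux] : exists2 x, 0 < x & u x = 0.
  have u0 : u x0 <= 0 by rewrite /u subr_le0.
  have u1 : 0 <= u x1 by rewrite /u subr_ge0.
  have [le01|/ltW le10] := leP x0 x1.
    have [|c] := @IVT _ u x0 x1 0 le01 (cu _ _); first by rewrite ge_min u0 le_max u1 orbT.
    by rewrite in_itv/= => /andP[h _] uc; exists c => //; exact: lt_le_trans h.
  have [|c] := @IVT _ u x1 x0 0 le10 (cu _ _); first by rewrite ge_min u0 orbT le_max u1.
  by rewrite in_itv/= => /andP[h _] uc; exists c => //; exact: lt_le_trans h.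
exists (x / 2); split; first by rewrite divr_ge0// ltW.
have x20 : x / 2 != 0 by rewrite gt_eqF// divr_gt0.
rewrite /Psi (negbTE x20) (_ : 2 * (x / 2) = x); last by field.
have -> : sinh x = (1 + k) * x by move: ux; rewrite /u; lra.
by field; rewrite gt_eqF.
Qed.

Lemma r_ofP (k : R) : 0 < k -> 0 < r_of k /\ sinh (2 * r_of k) = (1 + k) * (2 * r_of k).
Proof.
move=> k0; have [r0' Pr'] := xgetPex (0 : R) (Psi_onto k0).
have [r r0 [Pr ->]] : exists2 r, 0 <= r & Psi r = k /\ r_of k = r by exists (r_of k).
have rn0 : r != 0.
  by apply: contraTneq k0 => h; move: Pr; rewrite h /Psi eqxx => <-; rewrite ltxx.
split; first by rewrite lt_neqAle eq_sym rn0.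
move: Pr; rewrite /Psi (negbTE rn0) => <-; field.
by rewrite rn0.
Qed.

End Hyperbolic.

Section Extremal.
Context {R : realType}.
Variable lambda : R.
Hypothesis lambda0 : 0 < lambda.
Let r := r_of lambda.
Let S := sinh r.
Let c := cosh r.
Let r0 : 0 < r := (r_ofP lambda0).1.
Let S0 : 0 < S := sinh_gt0 r0.
Let c0 : 0 < c := cosh_gt0 r.
Let c2 : c ^+ 2 = 1 + S ^+ 2 := cosh_sqr r.

Notation K0 := (hypograph (hyp_graph S c)).

Let Scr : S * c = (1 + lambda) * r.
Proof. by have := (r_ofP lambda0).2; rewrite sinhE2 -/r -/S -/c; lra. Qed.

Lemma hyp_affine_arc_total ga : hyp_affine_length S ga = ga / S * (2 * r).
Proof.
have h0 : hyp_angle S 0 = - r.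
  rewrite /hyp_angle (hyp_root0 c0 c2) sub0r mulrN mulr1.
  have -> : - S + c = sinh (- r) + cosh (- r) by rewrite sinhN coshN.
  exact: ln_sinhDcosh.
have h2 : hyp_angle S 2 = r.
  rewrite /hyp_angle (hyp_root2 c0 c2) (_ : 2 - 1 = 1 :> R); last by lra.
  by rewrite mulr1 ln_sinhDcosh.
by rewrite /hyp_affine_length /hyp_affine_arc h0 h2; ring.
Qed.

(** This is where lambda enters: the equation sinh (2 r) = (1 + lambda) * 2 r
    says that the affine bound of length_integral_le is tangent to the level
    line of Phi through the hyperbola. *)
Lemma critical_length ga : 0 < ga -> ga ^+ 3 = c ->
  lambda * hyp_affine_length S ga = 2 * (S ^+ 2 / ga ^+ 2) * hyp_area S c.
Proof.
move=> ga0 ga3.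
have e : 2 * (S ^+ 2 / ga ^+ 2) * hyp_area S c = 2 * c ^+ 2 / ga ^+ 2 - hyp_affine_length S ga.
  by rewrite (hyp_area_length S0 c0 c2 ga0) -ga3; field; rewrite !gt_eqF.
have e' : (1 + lambda) * hyp_affine_length S ga = 2 * c ^+ 2 / ga ^+ 2.
  rewrite hyp_affine_arc_total; have -> : (1 + lambda) * (ga / S * (2 * r)) = 2 * ga / S * ((1 + lambda) * r) by ring.
  by rewrite -Scr -ga3; field; rewrite !gt_eqF.
lra.
Qed.

(** The root is the Euclidean norm of a vector depending affinely on x, hence
    convex. *)
Lemma hull_convex : @convex_set R (R * R)%type K0.
Proof.
apply/convex_planeP => u v t [/andP[u0 u2] /andP[u3 u4]] [/andP[v0 v2] /andP[v3 v4]] t0 t1.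
have t1' : 0 <= 1 - t by rewrite subr_ge0.
have Qc : hyp_root S (t * u.1 + (1 - t) * v.1) <= t * hyp_root S u.1 + (1 - t) * hyp_root S v.1.
  have E (k z : R) : 0 <= k -> k * hyp_root S z = enorm (k, k * (S * (z - 1))).
    move=> k0; rewrite -[X in X * _]ger0_norm// -sqrtr_sqr -sqrtrM ?sqr_ge0//.
    by congr Num.sqrt; rewrite /=; ring.
  rewrite !E//; apply: le_trans (enorm_triangle _ _).
  rewrite -[leLHS]mul1r E// le_eqVlt; apply/orP; left; apply/eqP.
  by congr enorm; congr pair => /=; ring.
split => /=; first by apply/andP; split; nra.
apply/andP; split; first by rewrite addr_ge0 ?mulr_ge0.
apply: (@le_trans _ _ (t * hyp_graph S c u.1 + (1 - t) * hyp_graph S c v.1)).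
  by rewrite lerD// ler_wpM2l.
have k0 : 0 <= c / S ^+ 2 by rewrite divr_ge0 ?(ltW c0)// sqr_ge0.
have := ler_wpM2l k0 Qc; rewrite /hyp_graph; lra.
Qed.

Lemma hyp_in t : 0 <= t -> t <= 1 ->
  0 <= hyp_X lambda t <= 2 /\ hyp_Y lambda t = hyp_graph S c (hyp_X lambda t).
Proof.
move=> t0 t1; pose w := r * (1 - 2 * t).
have p1 : 0 <= r * (1 - t) by rewrite mulr_ge0 ?subr_ge0// ltW.
have p2 : 0 <= r * t by rewrite mulr_ge0// ltW.
have w1 : - r <= w by rewrite /w; lra.
have w2 : w <= r by rewrite /w; lra.
have XE : hyp_X lambda t = 1 + sinh w / S by [].
have s1 := sinh_homo w1; have s2 := sinh_homo w2; rewrite sinhN -/S in s1 s2.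
split.
  rewrite XE; have : -1 <= sinh w / S by rewrite ler_pdivlMr//; lra.
  have : sinh w / S <= 1 by rewrite ler_pdivrMr//; lra.
  by move=> h1 h2; apply/andP; split; lra.
have QE : hyp_root S (hyp_X lambda t) = cosh w.
  rewrite XE /hyp_root (_ : 1 + S ^+ 2 * (1 + sinh w / S - 1) ^+ 2 = cosh w ^+ 2).
    by rewrite sqrtr_sqr gtr0_norm// cosh_gt0.
  by rewrite cosh_sqr; field; rewrite gt_eqF.
rewrite /hyp_graph QE /hyp_Y -/r -/S -/c -mulrA sinh_mul.
rewrite (_ : r * (1 - t) + r * t = r); last by ring.
rewrite (_ : r * (1 - t) - r * t = w); last by rewrite /w; ring.
by rewrite -/c; field; rewrite gt_eqF.
Qed.

(** The parameter is an affine function of hyp_angle. *)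
Lemma hyp_onto x : 0 <= x <= 2 -> exists2 t, 0 <= t <= 1 & hyp_X lambda t = x.
Proof.
move=> /andP[x0 x2]; pose w := hyp_angle S x.
have lp := hlog_gt0 S x.
have Q0 := hyp_root_gt0 S x.
have inv : expR (- w) = hyp_root S x - S * (x - 1).
  rewrite expRN /w /hyp_angle lnK ?posrE//; apply: (@mulIf _ (S * (x - 1) + hyp_root S x)).
    by rewrite gt_eqF.
  rewrite mulVf ?gt_eqF//.
  have -> : (hyp_root S x - S * (x - 1)) * (S * (x - 1) + hyp_root S x) = hyp_root S x ^+ 2 - S ^+ 2 * (x - 1) ^+ 2 by ring.
  by rewrite hyp_root_sqr addrK.
have ew : expR w = S * (x - 1) + hyp_root S x by rewrite /w /hyp_angle lnK ?posrE.
have sw : sinh w = S * (x - 1) by rewrite /sinh ew inv; field.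
have Qc : hyp_root S x <= c.
  rewrite -(@ler_pXn2r _ 2%N)// ?nnegrE ?(ltW Q0) ?(ltW c0)//.
  by rewrite hyp_root_sqr c2 lerD2l ler_piMr ?sqr_ge0// expr2; nra.
have er : expR r = S + c by rewrite /S /c /sinh /cosh; field.
have Sx : S * (x - 1) <= S * 1 by rewrite ler_wpM2l ?(ltW S0)//; lra.
have Sx' : S * -1 <= S * (x - 1) by rewrite ler_wpM2l ?(ltW S0)//; lra.
have wr : w <= r by rewrite -ler_expR ew er; lra.
have wr' : - w <= r by rewrite -ler_expR inv er; lra.
exists ((1 - w / r) / 2).
  have h1 : w / r <= 1 by rewrite ler_pdivrMr ?mul1r.
  have h2 : -1 <= w / r by rewrite ler_pdivlMr//; lra.
  by apply/andP; split; lra.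
rewrite /hyp_X -/r -/S (_ : r * (1 - 2 * ((1 - w / r) / 2)) = w).
  by rewrite sw; field; rewrite gt_eqF.
by field; rewrite gt_eqF.
Qed.

Lemma hullE : convex_hull (hyperbola lambda) = K0.
Proof.
apply/seteqP; split.
  apply: smallest_sub; first exact: hull_convex.
  move=> _ [t /= + <-]; rewrite in_itv/= => /andP[t0 t1].
  have [h1 h2] := hyp_in t0 t1; split => //=.
  by rewrite h2 lexx andbT; apply: (@hypograph_f_ge0 _ (hyp_graph S c));
    [exact: hyp_graph0|exact: hyp_graph2|move=> z; exact: hyp_graph_gt0|].
move=> [x y] [/= x2 /andP[y0 yf]] A [/convex_planeP cA sub].
have graph z : 0 <= z <= 2 -> A (z, hyp_graph S c z).
  move=> /hyp_onto[t /andP[t0 t1] <-]; have [_ <-] := hyp_in t0 t1.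
  by apply: sub; exists t => //=; rewrite in_itv/= t0.
have base : A (x, 0).
  have g2 := graph 2; have g0 := graph 0.
  rewrite (hyp_graph2 c0 c2) in g2; rewrite (hyp_graph0 c0 c2) in g0.
  have := cA _ _ (x / 2) (g2 _) (g0 _); rewrite /= => H.
  have := H _ _ _ _; rewrite (_ : (_, _) = (x, 0)); last by congr pair; field.
  by move/andP : x2 => [x0 x2]; apply; rewrite ?lexx ?ler0n ?divr_ge0// ler_pdivrMr// mul1r.
have [f0|f0] := leP (hyp_graph S c x) 0.
  have -> : y = 0 by lra.
  exact: base.
have t0 : 0 <= y / hyp_graph S c x by rewrite divr_ge0// ltW.
have t1 : y / hyp_graph S c x <= 1 by rewrite ler_pdivrMr// mul1r.
have := cA _ _ _ (graph _ x2) base t0 t1; rewrite /=.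
by rewrite (_ : (_, _) = (x, y))//; congr pair; field; rewrite gt_eqF.
Qed.

Lemma hull_admissible : admissible K0.
Proof.
have lip u v : 0 <= u <= 2 -> 0 <= v <= 2 -> `|hyp_graph S c v - hyp_graph S c u| <= `|v - u| by exact: hyp_graph_lip.
have f0 := hyp_graph0 c0 c2; have f2 := hyp_graph2 c0 c2.
have bnd x : 0 <= x <= 2 -> hyp_graph S c x <= x /\ hyp_graph S c x <= 2 - x.
  move=> x2; have i0 : 0 <= (0 : R) <= 2 by rewrite lexx ler0n.
  have i2 : 0 <= (2 : R) <= 2 by rewrite lexx ler0n.
  have := lip _ _ i0 x2; have := lip _ _ i2 x2; rewrite f0 f2 !subr0.
  move/andP : x2 => [x0 x2]; rewrite [`|x|]ger0_norm// [`|x - 2|]ler0_norm ?subr_le0//.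
  have := ler_norm (hyp_graph S c x); split; lra.
split.
- pose B : set (R * R) := (`[0, 2]%classic : set R) `*` (`[0, 2]%classic : set R).
  apply: (@subclosed_compact _ _ B).
  + rewrite -(closure_hypograph lip); exact: closed_closure.
  + by apply: compact_setX; exact: segment_compact.
  + move=> [x y] [/= x2 /andP[y0 yf]]; split; rewrite /= in_itv/= ?x2 ?y0//=.
    have [h _] := bnd x x2; move/andP: x2 => [_ x2]; exact: le_trans yf (le_trans h x2).
- exact: hull_convex.
- rewrite triangleE => -[x y] [/= x2 /andP[y0 yf]]; have [h1 h2] := bnd x x2.
  split => /=; lra.
- by split; rewrite /= ?f0 ?lexx ?ler0n.
- by split; rewrite /= ?f2 ?lexx ?ler0n.
Qed.

Lemma hull_area : area K0 = hyp_area S c.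
Proof.
have pos x : 0 <= x <= 2 -> 0 <= hyp_graph S c x.
  apply: hypograph_f_ge0; [exact: hyp_graph0|exact: hyp_graph2|move=> z; exact: hyp_graph_gt0].
rewrite (area_hypograph pos).
have dG (x : R) : 0 <= x -> x <= 2 -> is_derive x (1:R) (hyp_primitive S c) (hyp_graph S c x).
  by move=> _ _; exact: is_derive_hyp_primitive.
have ct : {within `[0, 2], continuous (hyp_graph S c)}.
  apply: derivable_within_continuous => x _.
  have : is_derive x (1:R) (hyp_graph S c) (hyp_slope S c x) by exact: is_derive_hyp_graph.
  by case.
by rewrite (FTC2_is_derive (ltr0n _ 2) ct dG).
Qed.

End Extremal.

(** * Optimality *)

Section AffinePerimeterBounds.
Context {R : realType}.
Notation mu := (@lebesgue_measure R).
Notation length_integral l g :=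
  (\int[mu]_(s in `]0%R, l[) (curvature g s `^ 3^-1)%:E)%E.

Lemma length_integral_ge0 l (g : R -> R * R) : (0 <= length_integral l g)%E.
Proof. by apply: integral_ge0 => s _; rewrite lee_fin powR_ge0. Qed.

(** The hypothesis 0 <= B covers the sets without parametrization, whose
    affine perimeter is the supremum of the empty set. *)
Lemma affine_perimeter_le K (B : R) : 0 <= B ->
  (forall l g, arclength_param K l g -> (length_integral l g <= B%:E)%E) ->
  0 <= affine_perimeter K <= B.
Proof.
move=> B0 H; rewrite /affine_perimeter; set X := [set L | _].
have XB L : X L -> 0 <= L <= B.
  move=> [l [g [/H par ->]]]; have i0 := length_integral_ge0 l g.
  rewrite /Rintegral; move: i0 par; case: (length_integral l g) => [z||]//.
  by rewrite !lee_fin /= => -> ->.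
have [->|/set0P[L XL]] := eqVneq X set0; first by rewrite sup0 lexx.
have ub : ubound X B by move=> z /XB/andP[].
apply/andP; split; last by apply: ge_sup => //; exists L.
apply: (@le_trans _ _ L); first by case/XB/andP: XL.
by apply: ub_le_sup => //; exists B.
Qed.

Lemma affine_perimeter_ge K (B b : R) l g :
  (forall l g, arclength_param K l g -> (length_integral l g <= B%:E)%E) ->
  arclength_param K l g -> (b%:E <= length_integral l g)%E ->
  b <= affine_perimeter K.
Proof.
move=> H par bL; have i0 := length_integral_ge0 l g.
have LB := H _ _ par.
apply: (@le_trans _ _ (fine (length_integral l g))).
  by rewrite -lee_fin fineK// ge0_fin_numE// (le_lt_trans LB) ?ltry.
rewrite /affine_perimeter; apply: ub_le_sup; last by exists l, g.
exists B => _ [l' [g' [/H par' ->]]]; have := length_integral_ge0 l' g'.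
rewrite /Rintegral; move: par'; by case: (length_integral l' g') => [z||].
Qed.

End AffinePerimeterBounds.

Lemma hypograph_inj (R : realType) (f h : R -> R) :
  (forall x, 0 <= x <= 2 -> 0 <= f x) -> (forall x, 0 <= x <= 2 -> 0 <= h x) ->
  hypograph f = hypograph h -> forall x, 0 <= x <= 2 -> f x = h x.
Proof.
move=> f0 h0 E x x2; apply/eqP; rewrite eq_le; apply/andP; split.
  have : hypograph f (x, f x) by split; rewrite //= f0 ?lexx.
  by rewrite E => -[_ /= /andP[]].
have : hypograph h (x, h x) by split; rewrite //= h0 ?lexx.
by rewrite -E => -[_ /= /andP[]].
Qed.

(** Here a and b stand for the ratios of areas and of affine perimeters. From
    ln t <= t - 1 one gets k * ln a + 3 * ln b <= k * (a - 1) + k * (1 - a) =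
    0, strictly unless a = 1. The maximum with 0 allows for areas so large
    that the affine bound is negative. *)
Lemma powR_cube_le (R : realType) (k a b : R) : 0 < k -> 0 < a -> 0 <= b ->
  b <= Num.max 0 (1 + k / 3 * (1 - a)) ->
  a `^ k * b ^+ 3 <= 1 /\ (a `^ k * b ^+ 3 = 1 -> a = 1).
Proof.
move=> k0 a0 b0 bk.
pose z := k * ln a + (3%:R * ln (1 + k / 3 * (1 - a))).
have [->|bn0] := eqVneq b 0.
  rewrite expr0n mulr0; split => // /eqP; by rewrite eq_sym oner_eq0.
have bp : 0 < b by rewrite lt_neqAle eq_sym bn0.
move: bk; rewrite le_max leNgt bp/= => bk.
have q0 : 0 < 1 + k / 3 * (1 - a) by exact: lt_le_trans bk.
have aE : a = expR (ln a) by rewrite lnK ?posrE.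
have qE : 1 + k / 3 * (1 - a) = expR (ln (1 + k / 3 * (1 - a))) by rewrite lnK ?posrE.
have le1 : a `^ k * b ^+ 3 <= expR z.
  rewrite /z expRD /powR (gt_eqF a0) ler_wpM2l ?expR_ge0//.
  by rewrite expRM_natl -qE lerXn2r// nnegrE ltW.
have l1 := expR_ge1Dx (ln (1 + k / 3 * (1 - a))); rewrite -qE in l1.
have l2 := expR_ge1Dx (ln a); rewrite -aE in l2.
have m2 := ler_wpM2l (ltW k0) l2.
have z0 : z <= 0 by rewrite /z; lra.
split; first by apply: le_trans le1 _; rewrite -expR0 ler_expR.
move=> E; rewrite E -expR0 ler_expR in le1.
have [la0|an1] := eqVneq (ln a) 0; first by rewrite aE la0 expR0.
have := expR_gt1Dx an1; rewrite -aE => l3.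
have m3 : k * (1 + ln a) < k * a by rewrite ltr_pM2l.
by move: le1; rewrite /z; lra.
Qed.

Section Optimality.
Context {R : realType}.
Variable lambda : R.
Hypothesis lambda0 : 0 < lambda.
Let r := r_of lambda.
Let S := sinh r.
Let c := cosh r.
Let r0 : 0 < r := (r_ofP lambda0).1.
Let S0 : 0 < S := sinh_gt0 r0.
Let c0 : 0 < c := cosh_gt0 r.
Let c2 : c ^+ 2 = 1 + S ^+ 2 := cosh_sqr r.
Let ga := c `^ 3^-1.
Let ga0 : 0 < ga.
Proof. by rewrite powR_gt0. Qed.
Let ga3 : ga ^+ 3 = c.
Proof. by rewrite /ga -powR_mulrn ?powR_ge0// -powRrM mulVf ?powRr1// ltW. Qed.
Let L0 := hyp_affine_length S ga.
Let A0 := hyp_area S c.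

Notation K0 := (hypograph (hyp_graph S c)).
Notation length_integral l g :=
  (\int[@lebesgue_measure R]_(s in `]0%R, l[) (curvature g s `^ 3^-1)%:E)%E.

Let L0_gt0 : 0 < L0.
Proof. exact: hyp_affine_length_gt0. Qed.

Let critical : lambda * L0 = 2 * (S ^+ 2 / ga ^+ 2) * A0.
Proof. exact: critical_length. Qed.

Let A0_gt0 : 0 < A0.
Proof.
have k0 : 0 < 2 * (S ^+ 2 / ga ^+ 2) by rewrite mulr_gt0// divr_gt0// exprn_gt0.
by rewrite -(pmulr_rgt0 _ k0) -critical mulr_gt0.
Qed.

Let hyp_graph_ge0 x : 0 <= x <= 2 -> 0 <= hyp_graph S c x.
Proof.
by apply: hypograph_f_ge0; [exact: hyp_graph0|exact: hyp_graph2|move=> z; exact: hyp_graph_gt0].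
Qed.

Section Competitor.
Variable K : set (R * R).
Hypothesis admK : admissible K.
Hypothesis posK : forall x, 0 < x < 2 -> 0 < profile K x.

Let a := area K / A0.

(** The bound of length_integral_le, normalized by critical_length. *)
Lemma competitor_length_le l g : arclength_param K l g ->
  (length_integral l g <= (L0 * (1 + lambda / 3 * (1 - a)))%:E)%E.
Proof.
have [Ar [Ar0 ArE ArP]] := profile_area admK.
rewrite {1}(profileE admK) => par.
have := length_integral_le S0 c0 c2 ga0 ga3 (profile_cap admK) ArP (profile0 admK)
  (profile2 admK) (supergradient0 K) (supergradient2 K) Ar0 posK par.
move=> /le_trans; apply; rewrite lee_fin -/L0 -/A0 -ArE le_eqVlt; apply/orP; left; apply/eqP.
have -> : L0 * (1 + lambda / 3 * (1 - a)) = L0 + lambda * L0 / 3 * (1 - a) by ring.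
by rewrite critical /a; field; rewrite !gt_eqF.
Qed.

Lemma competitor_length_lt P : 0 < P < 2 -> profile K P != hyp_graph S c P -> a = 1 ->
  exists2 d, 0 < d & forall l g, arclength_param K l g ->
    (length_integral l g <= (L0 - d)%:E)%E.
Proof.
move=> P2 fP a1; have [Ar [Ar0 ArE ArP]] := profile_area admK.
have ArA : Ar 2 = A0 by rewrite -ArE -[RHS]mul1r -a1 /a mulfVK// gt_eqF.
have [d d0 H] := length_integral_lt S0 c0 c2 ga0 ga3 (profile_cap admK) ArP (profile0 admK)
  (profile2 admK) (supergradient0 K) (supergradient2 K) Ar0 posK P2 fP ArA.
by exists d => // l g; rewrite {1}(profileE admK); exact: H.
Qed.

End Competitor.

Let admK0 : admissible K0 := hull_admissible lambda0.

Let profile_hull x : 0 <= x <= 2 -> profile K0 x = hyp_graph S c x.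
Proof.
apply: hypograph_inj => //; last by rewrite -profileE.
by move=> z /(profile_bounds admK0)[].
Qed.

(** The upper bound is the one valid for all competitors; the explicit
    parametrization attains it. *)
Lemma hull_length : affine_perimeter K0 = L0.
Proof.
have pos x : 0 < x < 2 -> 0 < profile K0 x.
  by move=> /andP[x0 x2]; rewrite profile_hull ?hyp_graph_gt0 ?x0 ?x2// !ltW.
have ub l g : arclength_param K0 l g -> (length_integral l g <= L0%:E)%E.
  move=> /(competitor_length_le admK0 pos) h.
  by rewrite (hull_area lambda0) -/r -/S -/c -/A0 divff ?gt_eqF// subrr mulr0 addr0 mulr1 in h.
have /andP[_ leL] := affine_perimeter_le (ltW L0_gt0) ub.
apply/eqP; rewrite eq_le leL/=.
have [l1 [chi [e [[l10 e0 chi0 chil dchi] [chi02 chi_onto]]]]] := arclength_inverse S c.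
by apply: (affine_perimeter_ge ub (hull_curve_param S0 c0 c2 l10 e0 chi0 chil dchi chi02 chi_onto));
  exact: (hull_curve_integral_ge S0 c0 ga0 ga3 l10 e0 chi0 chil dchi).
Qed.

Lemma hull_Phi : Phi lambda K0 = A0 `^ lambda * L0 ^+ 3.
Proof. by rewrite /Phi hull_length (hull_area lambda0). Qed.

Let hull_Phi_gt0 : 0 < Phi lambda K0.
Proof. by rewrite hull_Phi mulr_gt0 ?powR_gt0 ?exprn_gt0. Qed.

Lemma Phi_le K : admissible K ->
  Phi lambda K <= Phi lambda K0 /\ (Phi lambda K = Phi lambda K0 -> K = K0).
Proof.
move=> admK.
have null : area K = 0 -> Phi lambda K <= Phi lambda K0 /\
    (Phi lambda K = Phi lambda K0 -> K = K0).
  move=> aK; have -> : Phi lambda K = 0 by rewrite /Phi aK powR0 ?mul0r// gt_eqF.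
  by split => [|E]; [exact: ltW|move: hull_Phi_gt0; rewrite -E ltxx].
have prof0 x : 0 <= x <= 2 -> 0 <= profile K x by move=> /(profile_bounds admK)[].
have areaE : area K = area (hypograph (profile K)) by rewrite -profileE.
have [f0|posK] := profile_dichotomy admK.
  apply: null; rewrite areaE (area_hypograph prof0).
  by rewrite integral0_eq// => x; rewrite /= in_itv/= => /f0 ->.
have [aK0|aK0] := eqVneq (area K) 0; first exact: null.
have aK : 0 < area K.
  rewrite lt_neqAle eq_sym aK0 areaE (area_hypograph prof0) fine_ge0//.
  by apply: integral_ge0 => x /=; rewrite in_itv/= => x2; rewrite lee_fin prof0.
set a := area K / A0.
have a0 : 0 < a by rewrite divr_gt0.
have aE : area K = a * A0 by rewrite /a mulfVK// gt_eqF.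
pose q := 1 + lambda / 3 * (1 - a).
pose B := Num.max 0 q.
have B0 : 0 <= B by rewrite le_max lexx.
have Bint l g : arclength_param K l g -> (length_integral l g <= (L0 * B)%:E)%E.
  move=> /(competitor_length_le admK posK)/le_trans; apply.
  by rewrite lee_fin ler_pM2l// le_max lexx orbT.
have /andP[l0 lB] := affine_perimeter_le (mulr_ge0 (ltW L0_gt0) B0) Bint.
set b := affine_perimeter K / L0.
have b0 : 0 <= b by rewrite divr_ge0// ltW.
have bB : b <= B by rewrite ler_pdivrMr// mulrC.
have bE : affine_perimeter K = b * L0 by rewrite /b mulfVK// gt_eqF.
have PhiE : Phi lambda K = a `^ lambda * b ^+ 3 * Phi lambda K0.
  by rewrite hull_Phi /Phi aE bE powRM ?(ltW a0) ?(ltW A0_gt0)// exprMn; ring.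
have main : a `^ lambda * b ^+ 3 <= 1 /\ (a `^ lambda * b ^+ 3 = 1 -> a = 1).
  exact: powR_cube_le.
rewrite PhiE; split; first by rewrite ler_piMl ?(ltW hull_Phi_gt0)//; case: main.
move=> E; have ab1 : a `^ lambda * b ^+ 3 = 1.
  by apply: (mulIf (lt0r_neq0 hull_Phi_gt0)); rewrite mul1r.
(* Equal values of Phi force equal areas and equal perimeters; a different
   profile would then have a strictly smaller perimeter. *)
have a1 : a = 1 by case: main => _; apply.
have b1 : b = 1.
  apply/eqP; rewrite -(@pexpr_eq1 _ b 3)//; apply/eqP.
  by move: ab1; rewrite a1 powR1 mul1r.
rewrite (profileE admK).
suff EK x : 0 <= x <= 2 -> profile K x = hyp_graph S c x.
  by apply/seteqP; split => -[x y] [/= x2 y2]; split => //=; rewrite ?EK// -EK.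
move=> /andP[x0 x2].
have [->|xn0] := eqVneq x 0; first by rewrite (profile0 admK) (hyp_graph0 c0 c2).
have [->|xn2] := eqVneq x 2; first by rewrite (profile2 admK) (hyp_graph2 c0 c2).
have x02 : 0 < x < 2 by rewrite !lt_neqAle eq_sym xn0 xn2 x0.
apply/eqP; apply: contraT => fx.
have [d d0 H] := competitor_length_lt admK posK x02 fx a1.
have L0E : affine_perimeter K = L0 by rewrite bE b1 mul1r.
have [h|h] := leP 0 (L0 - d).
  have /andP[_] := affine_perimeter_le h H; rewrite L0E; lra.
have H0 l g : arclength_param K l g -> (length_integral l g <= 0%:E)%E.
  by move=> /H/le_trans; apply; rewrite lee_fin ltW.
have /andP[_] := affine_perimeter_le (lexx 0) H0; rewrite L0E; have := L0_gt0; lra.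
Qed.

End Optimality.

Theorem theorem1p11 (R : realType) (lambda : R) (hlambda : 0 < lambda) :
  admissible (convex_hull (hyperbola lambda)) /\
  forall K : set (R * R), admissible K ->
    Phi lambda K <= Phi lambda (convex_hull (hyperbola lambda)) /\
    (Phi lambda K = Phi lambda (convex_hull (hyperbola lambda)) ->
     K = convex_hull (hyperbola lambda)).
Proof.
rewrite (hullE hlambda); split; first exact: hull_admissible.
by move=> K; exact: Phi_le.
Qed.
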